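(* Let $t'=\mu_kt$ be adjacent injective-reachable quantum seeds in $\Delta^+$, $k\in I_{uf}$, and let $\mathbf L^t$ be the triangular basis, with respect to the seed $t$, of a subalgebra $\mathrm A(t)\subset\mathcal U_q(t)$. If $\mathbf L^t$ is admissible in direction $k$, then $\mathbf L^{t'}:=(\mu_k^* )^{-1}\mathbf L^t$ is the triangular basis with respect to $t'$ (of $\mathrm A(t')=(\mu_k^* )^{-1}\mathrm A(t)$). Moreover, $\mathbf L^t$ and $\mathbf L^{t'}$ are compatible.
   Context: **Quantum seeds.** $\Bbbk=\mathbb Z[q^{\pm1/2}]$, $v=q^{1/2}$, $\mathbf m=v^{-1}\mathbb Z[v^{-1}]$, $[x]_+=\max(x,0)$ (componentwise for vectors), $\mathbb N=\{0,1,\dots\}$. $I=I_{uf}\sqcup I_f$ is a finite set (unfrozen/frozen vertices). A quantum seed $t$ consists of an integer matrix $\tilde B(t)=(b_{ij})_{i\in I,j\in I_{uf}}$ of full rank $|I_{uf}|$ whose square part $B(t)=(b_{ij})_{i,j\in I_{uf}}$ is skew-symmetrizable, a skew-symmetric integer matrix $\Lambda(t)=(\Lambda_{ij})_{i,j\in I}$ with $\tilde B(t)^T\Lambda(t)=(D'\ 0)$, $D'=\mathrm{diag}(d'_k)_{k\in I_{uf}}$, $d'_k\in\mathbb Z_{>0}$, and variables $X_i(t)$, $i\in I$. $M^\circ(t)=\bigoplus_{i\in I}\mathbb Zf_i\cong\mathbb Z^I$ carries $\lambda(f_i,f_j)=\Lambda_{ij}$. $\mathcal{LP}(t)=\bigoplus_{m\in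 M^\circ(t)}\Bbbk X(t)^m$ has commutative product $X^m\cdot X^{m'}=X^{m+m'}$ and twisted product $X^m*X^{m'}=v^{\lambda(m,m')}X^{m+m'}$; $X_i(t)=X(t)^{f_i}$; as an algebra it is taken with $*$, and $\mathcal F(t)$ is its skew-field of fractions. $Y(t)^n=X(t)^{\tilde B(t)n}$ for $n\in\mathbb Z^{I_{uf}}$. The bar involution is the $\mathbb Z$-linear anti-automorphism with $v\mapsto v^{-1}$, $X(t)^m\mapsto X(t)^m$. For $k\in I_{uf}$, $t'=\mu_kt$ has $b'_{ij}=-b_{ij}$ if $k\in\{i,j\}$, otherwise $b'_{ij}=b_{ij}+b_{ik}[b_{kj}]_++[-b_{ik}]_+b_{kj}$; $\Lambda(t')_{ij}=\lambda(f'_i,f'_j)$ with $f'_i=f_i$ ($i\ne k$), $f'_k=-f_k+\sum_j[-b_{jk}]_+f_j$; and $\mu_k^*:\mathcal F(t')\cong\mathcal F(t)$ sends $X_i(t')\mapsto X_i(t)$ ($i\ne k$), $X_k(t')\mapsto X(t)^{-f_k+\sum_j[-b_{jk}]_+f_j}+X(t)^{-f_k+\sum_j[b_{jk}]_+f_j}$. $\Delta^+$ is the set of seeds obtained from an initial seed by iterated mutations. A mutation sequence $\overleftarrow\mu$ with $t_2=\overleftarrow\mu t_1$ induces the composite $\overleftarrow\mu^*:\mathcal F(t_2)\cong\mathcal F(t_1)$, which depends only on $t_1,t_2$ and is also written $\mu^*_{t_2,t_1}$. $\mathcal U_q(t)=\bigcap_{t'\in\Delta^+}\mu^*_{t',t}\mathcal{LP}(t')$.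 Quantum cluster monomials of a seed $s$ are the $\mu^*_{s,t}X(s)^m$, $m\in\mathbb N^I$. **Degrees.** $m'\preceq_tm$ in $M^\circ(t)$ iff $m'=m+\tilde B(t)n$ for some $n\in\mathbb N^{I_{uf}}$. An element is $g$-pointed (pointed at $g$, of degree $g$) if it has the form $X(t)^g\cdot(1+\sum_{0\ne n\in\mathbb N^{I_{uf}}}c_nY(t)^n)$, $c_n\in\Bbbk$. If $Z$ has a unique $\prec_t$-maximal Laurent degree, $[Z]^t$ denotes $Z$ divided by the coefficient at that degree. **Tropical transformation, compatibility.** For $t'=\mu_kt$, $\phi_{t',t}:M^\circ(t)\to M^\circ(t')$, $g\mapsto g'$, is $g'_k=-g_k$, $g'_i=g_i+[b_{ik}]_+g_k$ if $i\neq k,g_k\ge0$, $g'_i=g_i+[-b_{ik}]_+g_k$ if $i\ne k,g_k<0$. Pointed sets $\{S_g\}_{g\in M^\circ(t)}\subset\mathcal{LP}(t)$ and $\{S'_{g'}\}_{g'\in M^\circ(t')}\subset\mathcal{LP}(t')$ are compatible if $(\mu_k^* )^{-1}S_g=S'_{\phi_{t',t}g}$ for all $g$. **Injective-reachability.** $t$ is injective-reachable if there are $t[1]=\overleftarrow\mu t\in\Delta^+$ and a permutation $\sigma$ of $I_{uf}$ such that for each $k\in I_{uf}$ the $I_{uf}$-part of the degree of $I_k(t):=\overleftarrow\mu^*X_{\sigma k}(t[1])\in\mathcal{LP}(t)$ is $-f_k$; the property then holds for all seeds of $\Delta^+$, and $(\mu_kt)[1]=\mu_{\sigma k}(t[1])$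 with the same $\sigma$. **Triangular bases.** A $\Bbbk$-basis $\mathbf L$ of the subalgebra $\mathrm A(t)\subset\mathcal U_q(t)$ is the triangular basis for $t$ if: (1) its elements are bar-invariant; (2) it contains the quantum cluster monomials of $t$ and $t[1]$; (3) $\mathbf L=\{\mathbf L_g\mid g\in M^\circ(t)\}$ with $\mathbf L_g$ $g$-pointed; (4) for all $i\in I$, $g$: $[X_i(t)*\mathbf L_g]^t=\mathbf L_{g+f_i}+\sum_{g'\prec_tg+f_i}b_{g'}\mathbf L_{g'}$, $b_{g'}\in\mathbf m$. **Admissibility.** For $t'=\mu_kt$, $\mathbf L^t$ is admissible in direction $k$ if it contains the quantum cluster monomials $\mu_k^*X_k(t')^d$ and $\mu_k^*I_k(t')^d$ for all $d\in\mathbb N$. *)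

(* Defs.v *)
From HB Require Import structures.
From mathcomp Require Import all_boot all_order all_algebra all_fingroup.
From mathcomp Require Import finmap ring.
From mathcomp.multinomials Require Import monalg.

Set Implicit Arguments.
Unset Strict Implicit.
Unset Printing Implicit Defensive.

Import Order.TTheory GRing.Theory Num.Theory.

Local Open Scope fset_scope.
Local Open Scope ring_scope.

(* Product on finitely supported functions G -> R determined on the basis by
   X^a X^b = w(a, b) X^(a + b). *)
Definition twmul (R : comNzRingType) (G : zmodType) (w : G -> G -> R)
    (p q : {malg R[G]}) : {malg R[G]} :=
  \sum_(a <- msupp p) \sum_(b <- msupp q) << p@_a * q@_b * w a b *g a + b >>.

Record twist (R : comNzRingType) (G : zmodType) := Twist {
  twist_fun :> G -> G -> R;
  twistA : forall a b c, twist_fun a b * twist_fun (a + b) c =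
                         twist_fun b c * twist_fun a (b + c);
  twist0l : forall a, twist_fun 0 a = 1;
  twist0r : forall a, twist_fun a 0 = 1 }.

Definition twalg (R : comNzRingType) (G : zmodType) (w : twist R G) : Type :=
  {malg R[G]}.

Section TwistedAlgebra.
Variables (R : comNzRingType) (G : zmodType) (w : twist R G).
Implicit Types g : {malg R[G]}.

Local Notation "g1 *M_[ k1 , k2 ] g2" :=
  << g1@_k1 * g2@_k2 * w k1 k2 *g k1 + k2 >>
  (at level 40, no associativity).

Lemma twmullw (d1 d2 : {fset G}) g1 g2 :
  msupp g1 `<=` d1 -> msupp g2 `<=` d2 ->
  twmul w g1 g2 = \sum_(k1 <- d1) \sum_(k2 <- d2) g1 *M_[k1, k2] g2.
Proof.
move=> le_d1 le_d2; rewrite /twmul (big_fset_incl _ le_d1) /=.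
  apply/eq_bigr=> k1 _; apply/big_fset_incl => // k _ /mcoeff_outdom ->.
  by rewrite mulr0 mul0r monalgU0.
move=> k _ /mcoeff_outdom g1k.
by rewrite big1 => // k' _; rewrite g1k !mul0r monalgU0.
Qed.

Lemma twmul0g : left_zero 0 (twmul w).
Proof. by move=> g; rewrite /twmul msupp0 big_seq_fset0. Qed.

Lemma twmulg0 : right_zero 0 (twmul w).
Proof. by move=> g; rewrite /twmul exchange_big msupp0 big_seq_fset0. Qed.

Lemma twmulUg c k g :
  twmul w << c *g k >> g =
  \sum_(k' <- msupp g) << c * g@_k' * w k k' *g k + k' >>.
Proof.
rewrite (twmullw msuppU_le (fsubset_refl _)) big_seq_fset1.
by apply/eq_bigr => k' _; rewrite mcoeffUU.
Qed.

Lemma twmulgU c k g :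
  twmul w g << c *g k >> =
  \sum_(k' <- msupp g) << g@_k' * c * w k' k *g k' + k >>.
Proof.
rewrite (twmullw (fsubset_refl _) msuppU_le).
by apply/eq_bigr=> k' _; rewrite big_seq_fset1 mcoeffUU.
Qed.

Lemma twmulUU c1 c2 k1 k2 :
  twmul w << c1 *g k1 >> << c2 *g k2 >> = << c1 * c2 * w k1 k2 *g k1 + k2 >>.
Proof.
by rewrite (twmullw msuppU_le msuppU_le) !big_seq_fset1 !mcoeffUU.
Qed.

Lemma twmulEl1 g1 g2 :
  twmul w g1 g2 = \sum_(k1 <- msupp g1) twmul w << g1@_k1 *g k1 >> g2.
Proof. by apply/eq_bigr=> k _; rewrite twmulUg. Qed.

Lemma twmulEr1 g1 g2 :
  twmul w g1 g2 = \sum_(k2 <- msupp g2) twmul w g1 << g2@_k2 *g k2 >>.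
Proof.
by rewrite /twmul exchange_big; apply/eq_bigr=> k _; rewrite -/(twmul _ _ _)
  twmulgU.
Qed.

Lemma twmul1g : left_id << 1 *g 0%R >> (twmul w).
Proof.
move=> g; rewrite twmulUg [RHS]monalgE.
by apply/eq_bigr=> kg _; rewrite mul1r add0r twist0l mulr1.
Qed.

Lemma twmulg1 : right_id << 1 *g 0%R >> (twmul w).
Proof.
move=> g; rewrite twmulgU [RHS]monalgE.
by apply/eq_bigr=> k _; rewrite mulr1 addr0 twist0r mulr1.
Qed.

Lemma twmulDl : left_distributive (twmul w) +%R.
Proof.
move=> g1 g2 g.
rewrite [in RHS](twmullw (fsubsetUl _ (msupp g2)) (fsubset_refl _)).
rewrite [in RHS](twmullw (fsubsetUr (msupp g1) _) (fsubset_refl _)).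
rewrite (twmullw (msuppD_le _ _) (fsubset_refl _)).
rewrite -big_split /=; apply/eq_bigr=> k1 _.
rewrite -big_split /=; apply/eq_bigr=> k2 _.
by rewrite mcoeffD !mulrDl monalgUD.
Qed.

Lemma twmulDr : right_distributive (twmul w) +%R.
Proof.
move=> g g1 g2.
rewrite [in RHS](twmullw (fsubset_refl _) (fsubsetUl _ (msupp g2))).
rewrite [in RHS](twmullw (fsubset_refl _) (fsubsetUr (msupp g1) _)).
rewrite (twmullw (fsubset_refl _) (msuppD_le _ _)).
rewrite -big_split /=; apply/eq_bigr => k1 _.
rewrite -big_split /=; apply/eq_bigr => k2 _.
by rewrite mcoeffD mulrDr mulrDl monalgUD.
Qed.

Lemma twmulA : associative (twmul w).
Proof.
move=> g1 g2 g3.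
rewrite [RHS](big_morph ((twmul w)^~ _) (fun _ _ => twmulDl _ _ _) (twmul0g _)).
rewrite twmulEl1; apply/eq_bigr=> k1 _.
rewrite [LHS](big_morph (twmul w _) (fun _ _ => twmulDr _ _ _) (twmulg0 _)).
rewrite [RHS](big_morph ((twmul w)^~ _) (fun _ _ => twmulDl _ _ _) (twmul0g _)).
apply/eq_bigr=> k2 _.
rewrite [LHS](big_morph (twmul w _) (fun _ _ => twmulDr _ _ _) (twmulg0 _)).
rewrite -/(twmul _ _ _) -twmulUU twmulEr1.
apply/eq_bigr=> k3 _; rewrite !twmulUU addrA; congr (<< _ *g _ >>).
transitivity (g1@_k1 * g2@_k2 * g3@_k3 * (w k1 k2 * w (k1 + k2) k3)).
  by rewrite twistA; ring.
by ring.
Qed.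

Lemma tw1_neq0 : << 1 *g 0%R >> != 0 :> {malg R[G]}.
Proof. by rewrite monalgU_eq0 oner_eq0. Qed.

HB.instance Definition _ := GRing.Lmodule.on (twalg w).
HB.instance Definition _ := GRing.Zmodule_isNzRing.Build (twalg w)
  twmulA twmul1g twmulg1 twmulDl twmulDr tw1_neq0.

Lemma twmulZl (c : R) (g1 g2 : twalg w) : c *: (g1 * g2) = (c *: g1) * g2.
Proof.
rewrite /GRing.mul /= [in RHS](twmullw (msuppZ_le c g1) (fsubset_refl _)).
rewrite scaler_sumr; apply/eq_bigr=> k1 _.
rewrite scaler_sumr; apply/eq_bigr=> k2 _.
apply/malgP=> k; rewrite mcoeffZ !mcoeffU mcoeffZ mulrnAr.
by congr (_ *+ _); ring.
Qed.

Lemma twmulZr (c : R) (g1 g2 : twalg w) : c *: (g1 * g2) = g1 * (c *: g2).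
Proof.
rewrite /GRing.mul /= [in RHS](twmullw (fsubset_refl _) (msuppZ_le c g2)).
rewrite scaler_sumr; apply/eq_bigr=> k1 _.
rewrite scaler_sumr; apply/eq_bigr=> k2 _.
apply/malgP=> k; rewrite mcoeffZ !mcoeffU mcoeffZ mulrnAr.
by congr (_ *+ _); ring.
Qed.

HB.instance Definition _ :=
  GRing.Lmodule_isLalgebra.Build R (twalg w) twmulZl.
HB.instance Definition _ :=
  GRing.Lalgebra_isAlgebra.Build R (twalg w) twmulZr.
End TwistedAlgebra.

(* Z[v, v^-1]: the coefficient of v^a in c is c@_a. *)
Program Definition laurent_twist : twist int int :=
  @Twist int int (fun _ _ => 1) _ _ _.

Definition laurent : Type := twalg laurent_twist.
HB.instance Definition _ := GRing.NzRing.on laurent.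

Lemma laurent_mulC : commutative (@GRing.mul laurent).
Proof.
move=> p q; rewrite /GRing.mul /= /twmul exchange_big.
apply/eq_bigr=> a _; apply/eq_bigr=> b _.
by rewrite addrC [p@_b * _]mulrC.
Qed.

HB.instance Definition _ :=
  GRing.PzRing_hasCommutativeMul.Build laurent laurent_mulC.

Definition vpow (a : int) : laurent := << 1 *g a >>.

Lemma vpowD a b : vpow a * vpow b = vpow (a + b).
Proof. by rewrite /GRing.mul /= /vpow (twmulUU laurent_twist) !mulr1. Qed.

(* The ideal v^-1 Z[v^-1] of Z[v^-1]. *)
Definition in_m (c : laurent) : Prop :=
  forall a : int, a \in msupp (c : {malg int[int]}) -> a < 0.

Definition laurent_bar (c : laurent) : laurent :=
  \sum_(a <- msupp (c : {malg int[int]})) << (c : {malg int[int]})@_a *g - a >>.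

Definition pos (x : int) : int := Num.max x 0.

Section Seeds.
Variables nuf nf : nat.

(* Vertices are 'I_(nuf + nf): lshift nf k is unfrozen, rshift nuf l frozen. *)
Notation vertex := ('I_(nuf + nf)).
Notation lattice := ('cV[int]_(nuf + nf)).
Notation uf := (lshift nf).

Definition fvec (i : vertex) : lattice := delta_mx i 0.

Definition lam_form (Lam : 'M[int]_(nuf + nf)) (m m' : lattice) : int :=
  (m^T *m Lam *m m') 0 0.

Definition skew_symmetrizable (B : 'M[int]_nuf) : Prop :=
  exists d : 'I_nuf -> int,
    (forall i, 0 < d i) /\ (forall i j, d i * B i j = - (d j * B j i)).

Definition compatible_pair (B : 'M[int]_(nuf + nf, nuf))
    (Lam : 'M[int]_(nuf + nf)) : Prop :=
  exists d : 'rV[int]_nuf,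
    (forall k, 0 < d 0 k) /\ B^T *m Lam = row_mx (diag_mx d) 0.

Record qseed := QSeed {
  exB : 'M[int]_(nuf + nf, nuf);
  quasi : 'M[int]_(nuf + nf);
  exB_rank : \rank (map_mx intr exB : 'M[rat]_(nuf + nf, nuf)) = nuf;
  exB_skew : skew_symmetrizable (usubmx exB);
  quasi_skew : quasi^T = - quasi;
  exB_quasi : compatible_pair exB quasi }.

Definition mutB (B : 'M[int]_(nuf + nf, nuf)) (k : 'I_nuf) :
    'M[int]_(nuf + nf, nuf) :=
  \matrix_(i, j) if (i == uf k) || (j == k) then - B i j
    else B i j + B i k * pos (B (uf k) j) + pos (- B i k) * B (uf k) j.

(* The vector f'_j of the mutated seed, written in the basis (f_i). *)
Definition mut_fvec (B : 'M[int]_(nuf + nf, nuf)) (k : 'I_nuf) (j : vertex) :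
    lattice :=
  if j == uf k then - fvec (uf k) + \sum_i pos (- B i k) *: fvec i
  else fvec j.

Definition mutLam (B : 'M[int]_(nuf + nf, nuf)) (Lam : 'M[int]_(nuf + nf))
    (k : 'I_nuf) : 'M[int]_(nuf + nf) :=
  \matrix_(i, j) lam_form Lam (mut_fvec B k i) (mut_fvec B k j).

Section MutationSeed.
Variables (B : 'M[int]_(nuf + nf, nuf)) (Lam : 'M[int]_(nuf + nf)).
Variable k : 'I_nuf.
Hypotheses (Lam_skew : Lam^T = - Lam) (BLam : compatible_pair B Lam).

Lemma compatible_skew (d : 'rV[int]_nuf) :
  B^T *m Lam = row_mx (diag_mx d) 0 ->
  forall i j, d 0 i * B (uf i) j = - (d 0 j * B (uf j) i).
Proof.
move=> E i j.
have H a b : (B^T *m Lam *m B) a b = d 0 a * B (uf a) b.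
  rewrite E -[B in LHS]vsubmxK mul_row_col mul0mx addr0 mul_diag_mx !mxE.
  by [].
have /matrixP/(_ j i) : (B^T *m Lam *m B)^T = - (B^T *m Lam *m B).
  by rewrite !trmx_mul trmxK Lam_skew mulNmx mulmxN mulmxA.
by rewrite [LHS]mxE [RHS]mxE !H.
Qed.

Let P : 'M[int]_(nuf + nf) := \matrix_(i, j) mut_fvec B k j i 0.

Let Q : 'M[int]_nuf := \matrix_(i, j)
  if j == k then - (i == k)%:R
  else (i == j)%:R + (i == k)%:R * pos (B (uf k) j).

Lemma mutLamE : mutLam B Lam k = P^T *m Lam *m P.
Proof.
apply/matrixP=> i j; rewrite !mxE /lam_form !mxE.
apply: eq_bigr=> a _; rewrite !mxE; congr (_ * _).
by apply: eq_bigr=> b _; rewrite !mxE.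
Qed.

Lemma mut_skew : (mutLam B Lam k)^T = - mutLam B Lam k.
Proof.
by rewrite mutLamE !trmx_mul trmxK Lam_skew mulNmx mulmxN mulmxA.
Qed.

Lemma compatible_diag0 i : B (uf i) i = 0.
Proof.
have [d [d_gt0 E]] := BLam.
have /eqP := compatible_skew E i i.
by rewrite -addr_eq0 -mulr2n mulrn_eq0 mulf_eq0 /= gt_eqF // => /eqP.
Qed.

Lemma mut_PE i j : P i j = if j == uf k then - (i == uf k)%:R + pos (- B i k)
                           else (i == j)%:R.
Proof.
rewrite mxE /mut_fvec; case: eqP => _; rewrite !mxE ?andbT //.
rewrite summxE (bigD1 i) //= big1 ?addr0.
  by rewrite !mxE !eqxx mulr1.
by move=> a ai; rewrite !mxE eq_sym (negPf ai) mulr0.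
Qed.

Lemma mut_PB : P *m mutB B k = B *m Q.
Proof.
apply/matrixP=> i j; rewrite !mxE.
have -> : \sum_a P i a * mutB B k a j =
          (if i == uf k then 0 else mutB B k i j) + P i (uf k) * mutB B k (uf k) j.
  rewrite (bigD1 (uf k)) //= addrC; congr (_ + _).
  have [-> | ik] := eqVneq i (uf k).
    by rewrite big1 // => a ak; rewrite mut_PE (negPf ak) eq_sym (negPf ak) mul0r.
  rewrite (bigD1 i) //= mut_PE (negPf ik) eqxx mul1r big1 ?addr0 // => a.
  by case/andP=> ak ai; rewrite mut_PE (negPf ak) eq_sym (negPf ai) mul0r.
have -> : \sum_a B i a * Q a j =
          if j == k then - B i k else B i j + B i k * pos (B (uf k) j).
  case: (eqVneq j k) => [-> | jk].
    rewrite (bigD1 k) //= mxE !eqxx mulrN1 big1 ?addr0 // => a ak.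
    by rewrite mxE eqxx (negPf ak) oppr0 mulr0.
  rewrite (bigD1 j) //= (bigD1 k) 1?eq_sym //= !mxE (negPf jk) !eqxx.
  rewrite [k == j]eq_sym (negPf jk) mul0r add0r addr0 mulr1 mul1r big1 ?addr0 //.
  move=> a /andP[aj ak].
  by rewrite mxE (negPf jk) (negPf aj) (negPf ak) mul0r addr0 mulr0.
rewrite mut_PE !mxE !eqxx /=.
have [-> | ik] := eqVneq i (uf k); rewrite /=.
  rewrite compatible_diag0 /pos oppr0 maxxx.
  by case: (eqVneq j k) => [-> | jk]; rewrite ?compatible_diag0; ring.
by case: (eqVneq j k) => [-> | jk]; rewrite ?compatible_diag0; ring.
Qed.

Lemma mut_compatible : compatible_pair (mutB B k) (mutLam B Lam k).
Proof.
have [d [d_gt0 E]] := BLam; exists d; split=> //.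
have skB := compatible_skew E.
have -> : (mutB B k)^T *m mutLam B Lam k = Q^T *m row_mx (diag_mx d) 0 *m P.
  by rewrite mutLamE !mulmxA -trmx_mul mut_PB trmx_mul -E !mulmxA.
rewrite -[P]vsubmxK -mulmxA mul_row_col mul0mx addr0.
apply/matrixP=> a j; rewrite mxE.
have -> : (row_mx (diag_mx d) 0 : 'M[int]_(nuf, nuf + nf)) a j =
          d 0 a * (uf a == j)%:R.
  case: (split_ordP j) => b ->; last by rewrite row_mxEr mxE eq_lrshift mulr0.
  by rewrite row_mxEl mxE eq_lshift mulr_natr.
pose F b := d 0 b * P (uf b) j.
transitivity (\sum_b Q b a * F b).
  by apply: eq_bigr => b _; rewrite mxE mul_diag_mx mxE [usubmx _ _ _]mxE.
have -> : \sum_b Q b a * F b =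
          if a == k then - F k else F a + pos (B (uf k) a) * F k.
  case: (eqVneq a k) => [-> | ak].
    rewrite (bigD1 k) //= mxE !eqxx mulN1r big1 ?addr0 // => b bk.
    by rewrite mxE eqxx (negPf bk) oppr0 mul0r.
  rewrite (bigD1 a) //= (bigD1 k) 1?eq_sym //= !mxE (negPf ak) !eqxx.
  rewrite [k == a]eq_sym (negPf ak) mul0r add0r addr0 !mul1r big1 ?addr0 //.
  move=> b /andP[ba bk].
  by rewrite mxE (negPf ak) (negPf ba) (negPf bk) mul0r addr0 mul0r.
rewrite /F !mut_PE !eqxx compatible_diag0 /pos oppr0 maxxx addr0.
have [-> | jk] := eqVneq j (uf k); rewrite ?eq_lshift.
  have [-> | ak] := eqVneq a k; first by rewrite /=; ring.
  rewrite oppr0 add0r mulr0 mulrN mulr1 mulrN [_ * d 0 k]mulrC.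
  rewrite -{1}(mulr0 (d 0 a)) !maxr_pMr ?ltW // !mulr0 mulrN skB opprK.
  by rewrite subrr.
by have [-> | ak] := eqVneq a k;
  rewrite ?(negPf jk) /= ?[uf k == j]eq_sym ?(negPf jk) /= !mulr0 ?oppr0 ?addr0.
Qed.

End MutationSeed.

Lemma compatible_rank B Lam : compatible_pair B Lam ->
  \rank (map_mx intr B : 'M[rat]_(nuf + nf, nuf)) = nuf.
Proof.
case=> d [d_gt0 E]; apply/eqP; rewrite eqn_leq rank_leq_col /=.
have rD : \rank (map_mx intr (diag_mx d) : 'M[rat]_nuf) = nuf.
  apply: mxrank_unit; rewrite unitmxE map_diag_mx det_diag unitfE.
  by apply/prodf_neq0 => i _; rewrite mxE intr_eq0 gt_eqF.
rewrite -{1}rD -(rank_row_mx0 nf) -(mxrank_tr (map_mx intr B)) matrix.map_trmx.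
have -> : row_mx (map_mx intr (diag_mx d)) 0 =
          map_mx intr (B^T) *m map_mx intr Lam :> 'M[rat]_(_, _).
  by rewrite -map_mxM E map_row_mx map_mx0.
exact: mxrankM_maxl.
Qed.

Lemma compatible_symmetrizable B Lam : Lam^T = - Lam ->
  compatible_pair B Lam -> skew_symmetrizable (usubmx B).
Proof.
move=> skL [d [d_gt0 E]]; exists (fun i => d 0 i); split=> // i j.
by rewrite !mxE (compatible_skew skL E).
Qed.

Definition mutate (k : 'I_nuf) (t : qseed) : qseed :=
  let skL := mut_skew (exB t) k (quasi_skew t) in
  let cBL := mut_compatible k (quasi_skew t) (exB_quasi t) in
  QSeed (compatible_rank cBL) (compatible_symmetrizable skL cBL) skL cBL.

Section LaurentPolynomials.
Variable t : qseed.

Lemma lam_form0l m : lam_form (quasi t) 0 m = 0.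
Proof. by rewrite /lam_form trmx0 !mul0mx mxE. Qed.

Lemma lam_form0r m : lam_form (quasi t) m 0 = 0.
Proof. by rewrite /lam_form mulmx0 mxE. Qed.

Lemma lam_formDl m1 m2 m :
  lam_form (quasi t) (m1 + m2) m = lam_form (quasi t) m1 m + lam_form (quasi t) m2 m.
Proof. by rewrite /lam_form raddfD /= !mulmxDl mxE. Qed.

Lemma lam_formDr m m1 m2 :
  lam_form (quasi t) m (m1 + m2) = lam_form (quasi t) m m1 + lam_form (quasi t) m m2.
Proof. by rewrite /lam_form mulmxDr mxE. Qed.

Definition qtwist_fun (m m' : lattice) : laurent := vpow (lam_form (quasi t) m m').

Lemma qtwistA a b c : qtwist_fun a b * qtwist_fun (a + b) c =
                      qtwist_fun b c * qtwist_fun a (b + c).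
Proof.
by rewrite /qtwist_fun !vpowD lam_formDl lam_formDr; congr vpow; ring.
Qed.

Lemma qtwist0l a : qtwist_fun 0 a = 1.
Proof. by rewrite /qtwist_fun lam_form0l. Qed.

Lemma qtwist0r a : qtwist_fun a 0 = 1.
Proof. by rewrite /qtwist_fun lam_form0r. Qed.

Definition qtwist : twist laurent lattice := Twist qtwistA qtwist0l qtwist0r.

(* The ring multiplication is the twisted product
   X^m * X^m' = v^(lambda(m, m')) X^(m + m'). *)
Definition LP : Type := twalg qtwist.
HB.instance Definition _ := GRing.Algebra.on LP.

Definition coeffs (p : LP) : {malg laurent[lattice]} := p.

Definition cprod (p q : LP) : LP := twmul (fun _ _ => 1) p q.

Definition Xm (m : lattice) : LP := << 1 *g m >>.

Definition Xv (i : vertex) : LP := Xm (fvec i).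

Definition Ym (n : 'cV[int]_nuf) : LP := Xm (exB t *m n).

Definition bar (p : LP) : LP :=
  \sum_(m <- msupp (coeffs p)) << laurent_bar (coeffs p)@_m *g m >>.

Definition natv (n : 'cV[nat]_nuf) : 'cV[int]_nuf := map_mx Posz n.

Definition dom_le (m' m : lattice) : Prop :=
  exists n : 'cV[nat]_nuf, m' = m + exB t *m natv n.

Definition dom_lt (m' m : lattice) : Prop := dom_le m' m /\ m' <> m.

Definition pointed (g : lattice) (p : LP) : Prop :=
  exists c : {malg laurent['cV[nat]_nuf]},
    const_mx 0%N \notin msupp c /\
    p = cprod (Xm g) (1 + \sum_(n <- msupp c) c@_n *: Ym (natv n)).

Definition maximal_degree (p : LP) (g : lattice) : Prop :=
  g \in msupp (coeffs p) /\
  forall g', g' \in msupp (coeffs p) -> ~ dom_lt g g'.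

(* p0 = [p]^t.  Division is expressed as p = c *: p0 with c the (nonzero)
   coefficient; p0 is unique since Z[v, v^-1] is a domain. *)
Definition normalization (p p0 : LP) : Prop :=
  exists g, [/\ maximal_degree p g,
                forall g', maximal_degree p g' -> g' = g
              & p = (coeffs p)@_g *: p0].

Definition expand (L : lattice -> LP) (c : {malg laurent[lattice]}) : LP :=
  \sum_(g <- msupp c) c@_g *: L g.

(* mu_k^* X_i(mu_k t), an element of LP(t). *)
Definition mut_var (k : 'I_nuf) (i : vertex) : LP :=
  if i == uf k then
    Xm (- fvec (uf k) + \sum_j pos (- exB t j k) *: fvec j) +
    Xm (- fvec (uf k) + \sum_j pos (exB t j k) *: fvec j)
  else Xv i.

(* phi_{t',t} for t' = mu_k t. *)
Definition tropical (k : 'I_nuf) (g : lattice) : lattice :=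
  let gk := g (uf k) 0 in
  \col_i if i == uf k then - gk
         else if 0 <= gk then g i 0 + pos (exB t i k) * gk
         else g i 0 + pos (- exB t i k) * gk.

(* A skew-field of (right) fractions of the Ore domain LP(t); it is unique up
   to unique isomorphism over LP(t). *)
Record skew_fractions := SkewFractions {
  frac :> unitAlgType laurent;
  emb : {lrmorphism LP -> frac};
  emb_inj : injective emb;
  frac_skew : GRing.field_axiom frac;
  frac_quot : forall z : frac, exists p q, q != 0 /\ z = emb p / emb q }.

End LaurentPolynomials.

(* The skew-fields F(t) together with the mutation isomorphisms
   mu_k^* : F(mu_k t) -> F(t) and their inverses. *)
Record cluster_fields := ClusterFields {
  fld :> forall t : qseed, skew_fractions t;
  mu : forall (t : qseed) (k : 'I_nuf), {lrmorphism fld (mutate k t) -> fld t};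
  muV : forall (t : qseed) (k : 'I_nuf), fld t -> fld (mutate k t);
  muK : forall t k, cancel (@mu t k) (@muV t k);
  muVK : forall t k, cancel (@muV t k) (@mu t k);
  mu_var : forall t k i,
    @mu t k (emb (fld (mutate k t)) (Xv (mutate k t) i)) =
    emb (fld t) (mut_var t k i) }.

Arguments mu _ _ _ : clear implicits.
Arguments muV _ _ _ _ : clear implicits.

Section Cluster.
Variables (F : cluster_fields) (t0 : qseed).

(* The elements of Delta^+ are given by words in the unfrozen vertices, applied
   to the initial seed t0 from right to left. *)
Fixpoint seed (w : seq 'I_nuf) : qseed :=
  if w is k :: w' then mutate k (seed w') else t0.

Fixpoint mu_word (w : seq 'I_nuf) : F (seed w) -> F t0 :=
  match w with
  | [::] => id
  | k :: w' => fun z => mu_word (mu F (seed w') k z)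
  end.

Fixpoint muV_word (w : seq 'I_nuf) : F t0 -> F (seed w) :=
  match w with
  | [::] => id
  | k :: w' => fun z => muV F (seed w') k (muV_word w' z)
  end.

(* mu^*_{s,w} : F(s) -> F(w); for s = k :: w it coincides with mu_k^*. *)
Definition mu_star (s w : seq 'I_nuf) (z : F (seed s)) : F (seed w) :=
  muV_word w (mu_word z).

Definition in_upper (w : seq 'I_nuf) (z : F (seed w)) : Prop :=
  forall s, exists p : LP (seed s), z = mu_star w (emb (F (seed s)) p).

Definition subalgebra (w : seq 'I_nuf) (A : F (seed w) -> Prop) : Prop :=
  [/\ A 1, forall (c : laurent) x y, A x -> A y -> A (c *: x + y)
    & forall x y, A x -> A y -> A (x * y)].

Definition basis_of_alg (w : seq 'I_nuf) (A : F (seed w) -> Prop)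
    (L : lattice -> LP (seed w)) : Prop :=
  [/\ forall g, A (emb (F (seed w)) (L g)),
      forall c, expand L c = 0 -> c = 0
    & forall z, A z -> exists c, z = emb (F (seed w)) (expand L c)].

Definition contains (w : seq 'I_nuf) (L : lattice -> LP (seed w))
    (z : F (seed w)) : Prop :=
  exists g, emb (F (seed w)) (L g) = z.

Definition contains_monomials (w s : seq 'I_nuf)
    (L : lattice -> LP (seed w)) : Prop :=
  forall m : lattice, (forall i, 0 <= m i 0) ->
    contains L (mu_star w (emb (F (seed s)) (Xm (seed s) m))).

(* I_k(t) for t = w and t[1] = w1. *)
Definition inj_var (w w1 : seq 'I_nuf) (sigma : 'S_nuf) (k : 'I_nuf) :
    F (seed w) :=
  mu_star w (emb (F (seed w1)) (Xv (seed w1) (uf (sigma k)))).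

Definition injective_reachable (w w1 : seq 'I_nuf) (sigma : 'S_nuf) : Prop :=
  forall k, exists p g,
    [/\ emb (F (seed w)) p = inj_var w w1 sigma k, pointed g p
      & usubmx g = - delta_mx k 0].

(* L is the triangular basis of A for the seed t = w with t[1] = w1. *)
Record triangular_basis (w w1 : seq 'I_nuf) (A : F (seed w) -> Prop)
    (L : lattice -> LP (seed w)) : Prop := TriangularBasis {
  tri_subalg : subalgebra A;
  tri_upper : forall z, A z -> in_upper z;
  tri_basis : basis_of_alg A L;
  tri_bar : forall g, bar (L g) = L g;
  tri_monomials : contains_monomials w L;
  tri_monomials1 : contains_monomials w1 L;
  tri_pointed : forall g, pointed g (L g);
  tri_triangular : forall (i : vertex) (g : lattice),
    exists b : {malg laurent[lattice]},
      [/\ forall g', g' \in msupp b -> dom_lt (seed w) g' (g + fvec i),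
          forall g', in_m b@_g'
        & normalization (Xv (seed w) i * L g) (L (g + fvec i) + expand L b)] }.

(* Admissibility in direction k, for t = w and t'[1] = w1' where
   t' = k :: w. *)
Definition admissible (w w1' : seq 'I_nuf) (sigma : 'S_nuf) (k : 'I_nuf)
    (L : lattice -> LP (seed w)) : Prop :=
  forall d : nat,
    contains L (mu F (seed w) k
      (emb (F (seed (k :: w))) (Xv (seed (k :: w)) (uf k)) ^+ d)) /\
    contains L (mu F (seed w) k (inj_var (k :: w) w1' sigma k ^+ d)).

Definition compatible (w : seq 'I_nuf) (k : 'I_nuf)
    (S : lattice -> LP (seed w)) (S' : lattice -> LP (seed (k :: w))) : Prop :=
  forall g, muV F (seed w) k (emb (F (seed w)) (S g)) =
            emb (F (seed (k :: w))) (S' (tropical (seed w) k g)).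

End Cluster.
End Seeds.

Arguments mu {nuf nf} F t k : rename.
Arguments muV {nuf nf} F t k z : rename.
Arguments mu_star {nuf nf} F t0 s w z.
Arguments in_upper {nuf nf} F t0 w z.
Arguments contains {nuf nf} F t0 w L z.
Arguments inj_var {nuf nf} F t0 w w1 sigma k.
Arguments injective_reachable {nuf nf} F t0 w w1 sigma.
Arguments triangular_basis {nuf nf} F t0 w w1 A L.
Arguments admissible {nuf nf} F t0 w w1' sigma k L.
Arguments compatible {nuf nf} F t0 w k S S'.

(* Main.v *)
(* Call an element g-triangular if it is L_g plus an m-combination of the L_h.
   A bar-invariant g-triangular element equals L_g, left multiplication by X_i
   preserves triangularity by definition, and so does right multiplication by
   the monomials I of t[1], because L_g = [X * I] modulo smaller terms with
   coefficients in m.  By admissibility the cluster monomials of t' therefore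
   belong to L, and for every g there is a g-triangular product P_g = [S * I],
   where I avoids I_k and S is a monomial of t if g_k > 0 and of t' otherwise;
   P_g is pointed at g in t and at phi g in t'.  Grade both tori by the classes
   modulo b_k; this grading comes from conjugation by the X_i, i <> k, and is
   compatible with mu_k^*.  In top degree bar-invariance gives L_g = P_g, and
   by induction on the degree P_g - bar P_g detects all L_h occurring in P_g, so
   that they are dominated by phi g in t'.  Hence L_g is pointed at phi g in t'.
   Triangularity for X_k(t') is then checked on the elements P_g, using the
   exchange relation when g_k > 0. *)

From HB Require Import structures.
Require Import Defs.
From mathcomp Require Import all_boot all_order all_algebra all_fingroup.
From mathcomp Require Import finmap ring lra zify.
From mathcomp.multinomials Require Import monalg.

Set Implicit Arguments.
Unset Strict Implicit.
Unset Printing Implicit Defensive.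

Import Order.TTheory GRing.Theory Num.Theory.

Local Open Scope fset_scope.
Local Open Scope ring_scope.

(** The dominance orders of t and t' are not comparable, so lower terms for t say nothing directly
    about degrees in t'. The link is one integer, the pairing with [kap]. It agrees on g and phi g,
    it does not increase along dominance in either seed, and inside the cone of t it vanishes only
    on multiples of b_k. Conjugation by X^kap has v to twice this integer as eigenvalue, so its
    layers are preserved by [mu_k^*].

    Inside a layer, coefficients are detected by a single device: if c lies in m and c = bar c, then
    c = 0. Passing from P to P - bar P therefore keeps every nonzero c visible as c - bar c, while P
    - bar P vanishes in the top layer and is still dominated in t'.

    I_k is avoided because t'[1] differs from t[1] only at sigma k: the other monomials are common
    to both, have k-th degree 0 and keep their degree under phi. What has to be excluded is that
    such a monomial has further terms on its b_k-string; quasi-commutation with I_k, whose k-th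
    degree is -1, does this. *)

Section LaurentCoefficients.
Implicit Types (c d : laurent) (a x : int).

Definition lc c a : int := (c : {malg int[int]})@_a.

Lemma lcP c d : lc c =1 lc d -> c = d.
Proof. by move=> E; apply/malgP. Qed.

Lemma lc0 a : lc 0 a = 0.
Proof. exact: mcoeff0. Qed.

Lemma lcD c d a : lc (c + d) a = lc c a + lc d a.
Proof. exact: mcoeffD. Qed.

Lemma lcN c a : lc (- c) a = - lc c a.
Proof. exact: mcoeffN. Qed.

Lemma lc_vpow a x : lc (vpow a) x = (a == x)%:R.
Proof. exact: mcoeffU. Qed.

Lemma vpow0 : vpow 0 = 1.
Proof. by []. Qed.

Lemma lcM c d x : lc (c * d) x =
  \sum_(a <- msupp (c : {malg int[int]})) lc c a * lc d (x - a).
Proof.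
have -> : c * d = twmul laurent_twist c d by [].
rewrite /lc /twmul raddf_sum /=; apply: eq_bigr => a _.
rewrite raddf_sum /= [in RHS](monalgE (d : {malg int[int]})) raddf_sum /=.
rewrite mulr_sumr; apply: eq_bigr => b _; rewrite !mcoeffU mulr1 mulrnAr.
by congr (_ *+ nat_of_bool _); apply/eqP/eqP; lia.
Qed.

Lemma lc_vpowM a c x : lc (vpow a * c) x = lc c (x - a).
Proof.
have sa : msupp (vpow a : {malg int[int]}) = [fset a].
  by rewrite /vpow msuppU oner_eq0.
by rewrite lcM sa big_seq_fset1 lc_vpow eqxx mul1r.
Qed.

Lemma lc_bar c a : lc (laurent_bar c) a = lc c (- a).
Proof.
rewrite /lc /laurent_bar raddf_sum /=.
rewrite [in RHS](monalgE (c : {malg int[int]})) raddf_sum /=.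
apply: eq_bigr => b _; rewrite !mcoeffU.
by congr (_ *+ nat_of_bool _); apply/eqP/eqP; lia.
Qed.

Lemma lbarD : {morph laurent_bar : c d / c + d}.
Proof. by move=> c d; apply: lcP => a; rewrite !(lc_bar, lcD). Qed.

Lemma lbar0 : laurent_bar 0 = 0.
Proof. by apply: lcP => a; rewrite !(lc_bar, lc0). Qed.

Lemma lbar_sum I (r : seq I) (P : pred I) (f : I -> laurent) :
  laurent_bar (\sum_(i <- r | P i) f i) = \sum_(i <- r | P i) laurent_bar (f i).
Proof. by apply: (big_morph _ lbarD lbar0). Qed.

Lemma lbar_vpow a : laurent_bar (vpow a) = vpow (- a).
Proof.
by apply: lcP => x; rewrite lc_bar !lc_vpow; congr (nat_of_bool _)%:R; apply/eqP/eqP; lia.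
Qed.

Lemma lbarM : {morph laurent_bar : c d / c * d}.
Proof.
move=> c d; apply: lcP => x; rewrite [LHS]lc_bar [LHS]lcM [RHS]lcM.
have sc : perm_eq (msupp (laurent_bar c : {malg int[int]}))
   (map -%R (enum_fset (msupp (c : {malg int[int]})))).
  apply: uniq_perm => [||a]; rewrite ?fset_uniq //.
    by rewrite map_inj_uniq ?fset_uniq //; exact: oppr_inj.
  rewrite -[a in RHS]opprK (mem_map oppr_inj) -mcoeff_neq0 -mcoeff_neq0.
  by have := lc_bar c a; rewrite /lc => ->.
rewrite (perm_big _ sc) big_map; apply: eq_bigr => a _.
by rewrite lc_bar lc_bar !opprK opprD.
Qed.

Lemma in_mP c : in_m c <-> forall a, 0 <= a -> lc c a = 0.
Proof.
split=> [mc a a_ge0 | c0 a].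
  by apply/mcoeff_outdom/negP => /mc; rewrite ltNge a_ge0.
by rewrite -mcoeff_neq0 ltNge; apply: contraNN => /c0/eqP.
Qed.

Lemma in_mD c d : in_m c -> in_m d -> in_m (c + d).
Proof.
move=> /in_mP mc /in_mP md; apply/in_mP => a a0.
by rewrite lcD mc ?md.
Qed.

Lemma in_mN c : in_m c -> in_m (- c).
Proof. by move=> /in_mP mc; apply/in_mP => a a0; rewrite lcN mc ?oppr0. Qed.

Lemma in_m_vpow a : a < 0 -> in_m (vpow a).
Proof. by move=> a0; apply/in_mP => x x0; rewrite lc_vpow; case: eqP => //; lia. Qed.

Lemma in_m_vpowM a c : a <= 0 -> in_m c -> in_m (vpow a * c).
Proof.
move=> a0 /in_mP mc; apply/in_mP => x x0; rewrite lc_vpowM mc //; lia.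
Qed.

Lemma in_mM c d : in_m c -> in_m d -> in_m (c * d).
Proof.
move=> mc /in_mP md; apply/in_mP => x x0; rewrite lcM big_seq big1 // => a ac.
by rewrite md ?mulr0 //; have := mc a ac; lia.
Qed.

(** Bar exchanges the exponents [a] and [- a], while m allows only negative ones. Uniqueness of
    bar-invariant triangular elements rests on this. *)
Lemma in_m_bar c : in_m c -> laurent_bar c = c -> c = 0.
Proof.
move=> /in_mP mc bc; apply: lcP => a; rewrite lc0.
have [/mc // | a0] := lerP 0 a.
by rewrite -bc lc_bar mc //; lia.
Qed.

End LaurentCoefficients.

Ltac vring := apply/matrixP => ? ?; rewrite ?(mulmxnE, mxE); ring.

(** * Quantum tori over an abstract coefficient ring *)

Lemma seq_argmax (I : eqType) (s : seq I) (f : I -> int) x0 :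
  x0 \in s -> exists2 m, m \in s & forall x, x \in s -> f x <= f m.
Proof.
elim: s x0 => // y s IH x0 _; case: s IH => [_ | z s IH].
  by exists y; rewrite ?mem_head // => x; rewrite inE => /eqP->.
have [m ms mP] := IH z (mem_head _ _).
have [le | lt] := lerP (f y) (f m).
  exists m; first by rewrite inE ms orbT.
  by move=> x; rewrite inE => /orP[/eqP-> // | /mP].
exists y; first exact: mem_head.
move=> x; rewrite inE => /orP[/eqP-> // | /mP xm].
exact: le_trans xm (ltW lt).
Qed.

(* [qcoef] and [qtorus] axiomatize the properties of Z[v, v^-1] and of LP(t)
   which the argument uses: [vp a] is v^a, [br] the bar involution, [im] the
   ideal m, [cf p m] the coefficient of X^m in p. *)
Record qcoef := QCoef {
  qring :> comNzRingType;
  vp : int -> qring;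
  br : qring -> qring;
  im : qring -> Prop;
  vp0 : vp 0 = 1;
  vpD : forall a b, vp a * vp b = vp (a + b);
  brD : {morph br : c d / c + d};
  brM : {morph br : c d / c * d};
  br_vp : forall a, br (vp a) = vp (- a);
  imD : forall c d, im c -> im d -> im (c + d);
  imN : forall c, im c -> im (- c);
  imM : forall c d, im c -> im d -> im (c * d);
  im_vp : forall a, a < 0 -> im (vp a);
  im_vpM : forall a c, a <= 0 -> im c -> im (vp a * c);
  im_br : forall c, im c -> br c = c -> c = 0;
  vp_reg : forall a b c, a != b -> vp a * c = vp b * c -> c = 0 }.

Record qform (N : nat) := QForm {
  lam :> 'cV[int]_N -> 'cV[int]_N -> int;
  lamDr : forall a b c, lam a (b + c) = lam a b + lam a c;
  lamC : forall a b, lam b a = - lam a b }.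

Record qtorus (R : qcoef) (N : nat) (w : qform N) := QTorus {
  qalg :> algType R;
  cf : qalg -> 'cV[int]_N -> R;
  supp : qalg -> seq 'cV[int]_N;
  qX : 'cV[int]_N -> qalg;
  qbar : qalg -> qalg;
  supp_uniq : forall p, uniq (supp p);
  suppE : forall p m, (m \in supp p) = (cf p m != 0);
  cfP : forall p q, cf p =1 cf q -> p = q;
  cfD : forall p q m, cf (p + q) m = cf p m + cf q m;
  cfZ : forall c p m, cf (c *: p) m = c * cf p m;
  cf_X : forall a x, cf (qX a) x = (a == x)%:R;
  qX0 : qX 0 = 1;
  qXM : forall a b, qX a * qX b = vp R (w a b) *: qX (a + b);
  cf_bar : forall p m, cf (qbar p) m = br (cf p m) }.

Section Coefficients.
Variable R : qcoef.
Implicit Types c : R.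
Local Notation vp := (vp R).

Lemma br0 : br (0 : R) = 0.
Proof. by apply: (addrI (br (0 : R))); rewrite -brD !addr0. Qed.

Lemma br1 : br (1 : R) = 1.
Proof. by rewrite -vp0 br_vp oppr0. Qed.

Lemma brN : {morph @br R : c / - c}.
Proof. by move=> c; apply/eqP; rewrite -addr_eq0 -brD addNr br0. Qed.

Lemma br_sum I (r : seq I) (P : pred I) (f : I -> R) :
  br (\sum_(i <- r | P i) f i) = \sum_(i <- r | P i) br (f i).
Proof. by apply: (big_morph _ (@brD R) br0). Qed.

Lemma im0 : im (0 : R).
Proof. by rewrite -(subrr (vp (-1))); apply/imD/imN; apply: im_vp. Qed.

Lemma vpVK a c : vp (- a) * (vp a * c) = c.
Proof. by rewrite mulrA vpD addNr vp0 mul1r. Qed.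

Lemma vpM_eq0 a c : (vp a * c == 0) = (c == 0).
Proof.
apply/eqP/eqP => [E | ->]; last exact: mulr0.
by rewrite -(vpVK a c) E mulr0.
Qed.

Lemma vp_neq0 a : vp a != 0.
Proof. by rewrite -[vp a]mulr1 vpM_eq0 oner_eq0. Qed.

Lemma vp_inj : injective vp.
Proof.
move=> x1 x2 E0; apply/eqP/contraT => xy.
have /eqP := vp_reg (c := 1 : R) xy (congr1 (fun v => v * 1) E0).
by rewrite oner_eq0.
Qed.
End Coefficients.

Section Form.
Variables (N : nat) (w : qform N).
Local Notation G := 'cV[int]_N.
Implicit Types a b c : G.

Lemma lamDl a b c : w (a + b) c = w a c + w b c.
Proof. by rewrite lamC lamDr (lamC w a c) (lamC w b c) opprD !opprK. Qed.

Lemma lam0r a : w a 0 = 0.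
Proof. by have := lamDr w a 0 0; rewrite addr0; lia. Qed.

Lemma lam0l a : w 0 a = 0.
Proof. by rewrite lamC lam0r oppr0. Qed.

Lemma lamNr a b : w a (- b) = - w a b.
Proof. by have := lamDr w a b (- b); rewrite subrr lam0r; lia. Qed.

Lemma lamNl a b : w (- a) b = - w a b.
Proof. by rewrite lamC lamNr lamC opprK. Qed.

Lemma lamBr a b c : w a (b - c) = w a b - w a c.
Proof. by rewrite lamDr lamNr. Qed.

Lemma lamBl a b c : w (a - b) c = w a c - w b c.
Proof. by rewrite lamDl lamNl. Qed.

Lemma lamaa a : w a a = 0.
Proof. by have := lamC w a a; lia. Qed.

Lemma lamMnr a b n : w a (b *+ n) = w a b *+ n.
Proof. by elim: n => [|n IH]; rewrite ?mulr0n ?lam0r // !mulrS lamDr IH. Qed.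

Lemma lamMnl a b n : w (a *+ n) b = w a b *+ n.
Proof. by elim: n => [|n IH]; rewrite ?mulr0n ?lam0l // !mulrS lamDl IH. Qed.

Lemma lamZr a b (n : int) : w a (n *: b) = n * w a b.
Proof.
case: n => n; first by rewrite -natz scaler_nat lamMnr mulr_natl.
by rewrite NegzE scaleNr lamNr -natz scaler_nat lamMnr mulNr mulr_natl.
Qed.
End Form.

Section Torus.
Variables (R : qcoef) (N : nat) (w : qform N) (T : qtorus R w).
Local Notation G := 'cV[int]_N.
Implicit Types (p q : T) (a b m x : G) (c : R).
Local Notation vp := (vp R).
Local Notation X := (qX T).

Lemma cf0 m : cf (0 : T) m = 0.
Proof. by rewrite -(scale0r 0) cfZ mul0r. Qed.

Lemma cfN p m : cf (- p) m = - cf p m.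
Proof. by rewrite -scaleN1r cfZ mulN1r. Qed.

Lemma cfB p q m : cf (p - q) m = cf p m - cf q m.
Proof. by rewrite cfD cfN. Qed.

Lemma cf_sum I (r : seq I) (P : pred I) (f : I -> T) m :
  cf (\sum_(i <- r | P i) f i) m = \sum_(i <- r | P i) cf (f i) m.
Proof. by apply: (big_morph (@cf _ _ _ T ^~ m)) => [p q|]; [exact: cfD | exact: cf0]. Qed.

Lemma qE p : p = \sum_(m <- supp p) cf p m *: X m.
Proof.
apply: cfP => x; rewrite cf_sum.
have [xp | xp] := boolP (x \in supp p).
  rewrite (bigD1_seq x) ?supp_uniq //= cfZ cf_X eqxx mulr1 big1 ?addr0 //.
  by move=> y yx; rewrite cfZ cf_X (negPf yx) mulr0.
have /eqP -> : cf p x == 0 by move: xp; rewrite suppE negbK.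
rewrite big_seq big1 // => y yp; rewrite cfZ cf_X.
by case: eqP xp => [<-|]; rewrite ?yp ?mulr0.
Qed.

Lemma cf_XM a q x : cf (X a * q) x = vp (w a (x - a)) * cf q (x - a).
Proof.
rewrite [in LHS](qE q) mulr_sumr cf_sum [in RHS](qE q) cf_sum mulr_sumr.
apply: eq_bigr => b _; rewrite -scalerAr qXM !cfZ !cf_X.
have [-> | ne] := eqVneq b (x - a); first by rewrite [a + _]addrC subrK eqxx; ring.
case: eqP => [E | _]; last by rewrite !mulr0.
by rewrite -E [a + b]addrC addrK eqxx in ne.
Qed.

Lemma cf_MX a q x : cf (q * X a) x = vp (w (x - a) a) * cf q (x - a).
Proof.
rewrite [in LHS](qE q) mulr_suml cf_sum [in RHS](qE q) cf_sum mulr_sumr.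
apply: eq_bigr => b _; rewrite -scalerAl qXM !cfZ !cf_X.
have [-> | ne] := eqVneq b (x - a); first by rewrite subrK eqxx; ring.
case: eqP => [E | _]; last by rewrite !mulr0.
by rewrite -E addrK eqxx in ne.
Qed.

Lemma cfM p q x : cf (p * q) x =
  \sum_(a <- supp p) cf p a * (vp (w a (x - a)) * cf q (x - a)).
Proof.
rewrite [in LHS](qE p) mulr_suml cf_sum; apply: eq_bigr => a _.
by rewrite -scalerAl cfZ cf_XM.
Qed.

Lemma cfM_neq0 p q x : cf (p * q) x != 0 ->
  exists a, cf p a != 0 /\ cf q (x - a) != 0.
Proof.
rewrite cfM => ne; have /hasP[a ap qa] :
    has (fun a => cf p a * (vp (w a (x - a)) * cf q (x - a)) != 0) (supp p).
  apply: contraNT ne => /hasPn all0; rewrite big_seq big1 // => a /all0.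
  by rewrite negbK => /eqP.
exists a; rewrite -suppE; split=> //.
by apply: contraNneq qa => ->; rewrite !mulr0.
Qed.

Lemma cfM_single p q x a : (forall b, cf p b != 0 -> cf q (x - b) != 0 -> b = a) ->
  cf (p * q) x = vp (w a (x - a)) * (cf p a * cf q (x - a)).
Proof.
move=> H; rewrite cfM; have [ap | ap] := boolP (a \in supp p).
  rewrite (bigD1_seq a) ?supp_uniq //= big1_seq ?addr0; first by ring.
  move=> b /andP[ba bp]; have [-> | /H E] := eqVneq (cf q (x - b)) 0.
    by rewrite !mulr0.
  by rewrite E ?eqxx // -suppE in ba.
have /eqP -> : cf p a == 0 by move: ap; rewrite suppE negbK.
rewrite mul0r mulr0 big1_seq // => b /= bp.
have [-> | /H E] := eqVneq (cf q (x - b)) 0; first by rewrite !mulr0.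
by rewrite -E ?bp // -suppE in ap.
Qed.

Lemma barD : {morph @qbar _ _ _ T : p q / p + q}.
Proof. by move=> p q; apply: cfP => m; rewrite cf_bar !cfD brD !cf_bar. Qed.

Lemma bar0 : qbar (0 : T) = 0.
Proof. by apply: cfP => m; rewrite cf_bar cf0 br0. Qed.

Lemma barN : {morph @qbar _ _ _ T : p / - p}.
Proof. by move=> p; apply: cfP => m; rewrite cf_bar !cfN brN cf_bar. Qed.

Lemma bar_sum I (r : seq I) (P : pred I) (f : I -> T) :
  qbar (\sum_(i <- r | P i) f i) = \sum_(i <- r | P i) qbar (f i).
Proof. by apply: (big_morph _ barD bar0). Qed.

Lemma barZ c p : qbar (c *: p) = br c *: qbar p.
Proof. by apply: cfP => m; rewrite cf_bar !cfZ brM cf_bar. Qed.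

Lemma bar_X m : qbar (X m) = X m.
Proof.
apply: cfP => x; rewrite cf_bar cf_X; case: eqP => _; first exact: br1.
exact: br0.
Qed.

Lemma barM p q : qbar (p * q) = qbar q * qbar p.
Proof.
rewrite [in LHS](qE p) [in RHS](qE p) mulr_suml !bar_sum mulr_sumr.
apply: eq_bigr => a _; rewrite -scalerAl !barZ bar_X -scalerAr; congr (_ *: _).
apply: cfP => x; rewrite cf_bar cf_XM cf_MX cf_bar brM br_vp.
by rewrite (lamC w a).
Qed.

Lemma barX p n : qbar (p ^+ n) = qbar p ^+ n.
Proof.
elim: n => [|n IH]; first by rewrite !expr0 -qX0 bar_X.
by rewrite exprS barM IH -exprSr.
Qed.
End Torus.

(** * Dominance order and triangularity *)

(* [cone x] stands for x = B n with n >= 0, so that h is dominated by g when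
   [cone (h - g)]. *)
Record qcone (N : nat) := QCone {
  cone : 'cV[int]_N -> Prop;
  ht : 'cV[int]_N -> int;
  cone0 : cone 0;
  coneD : forall x y, cone x -> cone y -> cone (x + y);
  htD : forall x y, ht (x + y) = ht x + ht y;
  ht_ge0 : forall x, cone x -> 0 <= ht x;
  ht_eq0 : forall x, cone x -> ht x = 0 -> x = 0 }.

Section Cone.
Variables (N : nat) (C : qcone N).
Local Notation G := 'cV[int]_N.
Implicit Types x y g h : G.

Lemma ht0 : ht C 0 = 0.
Proof. by have := htD C 0 0; rewrite addr0; lia. Qed.

Lemma htN x : ht C (- x) = - ht C x.
Proof. by have := htD C x (- x); rewrite subrr ht0; lia. Qed.

Lemma htB x y : ht C (x - y) = ht C x - ht C y.
Proof. by rewrite htD htN. Qed.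

Lemma cone_trans g h x : cone C (g - h) -> cone C (h - x) -> cone C (g - x).
Proof. by move=> gh hx; have := coneD gh hx; rewrite addrA subrK. Qed.

Lemma cone_refl g : cone C (g - g).
Proof. by rewrite subrr; exact: cone0. Qed.

Lemma cone_ht g h : cone C (g - h) -> ht C h <= ht C g.
Proof. by move=> /ht_ge0; rewrite htB; lia. Qed.

Lemma cone_ht_lt g h : cone C (g - h) -> g != h -> ht C h < ht C g.
Proof.
move=> gh; rewrite lt_neqAle (cone_ht gh) andbT; apply: contraNneq => E.
by apply/eqP/subr0_eq/(ht_eq0 gh); rewrite htB E subrr.
Qed.

Lemma cone_anti g h : cone C (g - h) -> cone C (h - g) -> g = h.
Proof.
move=> gh hg; apply/eqP/contraT => ne.
by have := cone_ht_lt gh ne; have := cone_ht hg; lia.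
Qed.

(* A unitriangular family: by induction on the height, a coefficient whose
   leading term cancels forces a nonzero coefficient higher up. *)
Lemma cone_family (R : comNzRingType) (I : eqType) (s : seq I) (c : I -> R)
    (deg : I -> G) (f : I -> G -> R) (U : G -> Prop) :
  uniq s -> {in s &, injective deg} ->
  {in s, forall i, f i (deg i) = 1} ->
  {in s, forall i x, f i x != 0 -> cone C (x - deg i)} ->
  (forall x y, U x -> cone C (y - x) -> U y) ->
  (forall x, \sum_(i <- s) c i * f i x != 0 -> U x) ->
  {in s, forall i, c i != 0 -> U (deg i)}.
Proof.
move=> us dinj f1 fC UC sU.
(* The bound reads [ht C (deg i) < n]; some [n] is large enough for each [i]. *)
suff H n : {in s, forall i, (ht C (deg i) - - n%:Z < n%:Z + n%:Z)%R -> c i != 0 -> U (deg i)}.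
  move=> i si; apply: (H `|ht C (deg i)|.+1 i si); lia.
have [m mP] : exists m : int, forall i, i \in s -> m <= ht C (deg i).
  case: (s) => [|j s']; first by exists 0.
  have [i _ iP] := seq_argmax (fun i => - ht C (deg i)) (mem_head j s').
  by exists (ht C (deg i)) => k ks; have := iP k ks; lia.
suff K k : {in s, forall i, ht C (deg i) < m + k%:Z -> c i != 0 -> U (deg i)}.
  by move=> i si _; apply: (K `|ht C (deg i) - m|.+1 i si); lia.
elim: k => [|k IH] i si; first by have := mP i si; lia.
move=> hi ci; have := sU (deg i); rewrite (bigD1_seq i) //= f1 // mulr1.
(* Either no other member contributes at [deg i], and the coefficient of the sum there is [c i], or
   some [j] does; then [deg j] has smaller height, satisfies [U] by induction, and [U] passes on to
   [deg i]. *)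
have [/hasP[j js /andP[ji]] | /hasPn all0] :=
    boolP (has (fun j => (j != i) && (c j * f j (deg i) != 0)) s); last first.
  rewrite big_seq_cond big1 ?addr0; first by apply.
  move=> j /andP[js ji]; apply/eqP; have := all0 j js.
  by rewrite ji negbK.
move=> cf _; have fj : f j (deg i) != 0.
  by apply: contraNneq cf => ->; rewrite mulr0.
have cj : c j != 0 by apply: contraNneq cf => ->; rewrite mul0r.
have Cij := fC j js _ fj; apply: (UC _ _ _ Cij); apply: IH => //.
suff : ht C (deg j) < ht C (deg i) by lia.
by apply: cone_ht_lt Cij _; apply: contraNneq ji => /dinj ->.
Qed.
End Cone.

Section Nonneg.
Variable N : nat.
Implicit Types m : 'cV[int]_N.

Definition nonneg m := forall l, 0 <= m l 0.

Lemma nonnegD m1 m2 : nonneg m1 -> nonneg m2 -> nonneg (m1 + m2).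
Proof. by move=> h1 h2 l; rewrite mxE addr_ge0. Qed.

Lemma nonneg_fv l (n : nat) : nonneg (delta_mx l 0 *+ n).
Proof. by move=> l'; rewrite mulmxnE mxE mulrn_wge0 //; case: (_ && _). Qed.
End Nonneg.

Section Dominated.
Variables (R : qcoef) (N : nat) (w : qform N) (T : qtorus R w) (C : qcone N).
Local Notation G := 'cV[int]_N.
Implicit Types (p q z : T) (g h a x : G) (c : R).
Local Notation vp := (vp R).
Local Notation X := (qX T).

Definition domin g z := forall h, cf z h != 0 -> cone C (h - g).
Definition ptd g z := domin g z /\ cf z g = 1.

Lemma dominD g p q : domin g p -> domin g q -> domin g (p + q).
Proof.
move=> dp dq h; rewrite cfD; have [-> | /dp //] := eqVneq (cf p h) 0.
by rewrite add0r => /dq.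
Qed.

Lemma dominZ g c p : domin g p -> domin g (c *: p).
Proof.
move=> dp h; rewrite cfZ => E; apply: dp; apply: contraNneq E => ->.
by rewrite mulr0.
Qed.

Lemma dominN g p : domin g p -> domin g (- p).
Proof. by move=> dp h; rewrite cfN oppr_eq0; exact: dp. Qed.

Lemma dominB g p q : domin g p -> domin g q -> domin g (p - q).
Proof. by move=> dp dq; apply/dominD/dominN. Qed.

Lemma domin_le g h p : cone C (h - g) -> domin h p -> domin g p.
Proof. by move=> hg dp x /dp xh; apply: cone_trans xh hg. Qed.

Lemma dominM g h p q : domin g p -> domin h q -> domin (g + h) (p * q).
Proof.
move=> dp dq x /cfM_neq0[a [/dp ag /dq xh]].
by have := coneD ag xh; rewrite (_ : _ + _ = x - (g + h)) //; vring.
Qed.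

Lemma domin_bar g p : domin g p -> domin g (qbar p).
Proof.
move=> dp h; rewrite cf_bar => E; apply: dp; apply: contraNneq E => ->.
by rewrite br0.
Qed.

(** By antisymmetry of dominance, only the exponents [g] and [h] can meet at [g + h]. *)
Lemma domin_lead g h p q : domin g p -> domin h q ->
  cf (p * q) (g + h) = vp (w g h) * (cf p g * cf q h).
Proof.
move=> dp dq; rewrite (cfM_single (a := g)).
  by rewrite [g + h]addrC addrK.
move=> b /dp bg /dq; rewrite (_ : _ - h = g - b); last by vring.
by move=> gb; apply: cone_anti gb.
Qed.

Lemma ptd_X a : ptd a (X a).
Proof.
split; last by rewrite cf_X eqxx.
move=> h; rewrite cf_X; case: (eqVneq a h) => [<- _ | _]; last by rewrite eqxx.
exact: cone_refl.
Qed.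

Lemma ptdM g h p q : ptd g p -> ptd h q -> ptd (g + h) (vp (- w g h) *: (p * q)).
Proof.
move=> [dp cp] [dq cq]; split; first by apply/dominZ/dominM.
by rewrite cfZ domin_lead // cp cq !mulr1 vpD addNr vp0.
Qed.

Lemma ptd_uniq g h p : ptd g p -> ptd h p -> g = h.
Proof.
move=> [dg cg] [dh ch]; apply: (@cone_anti _ C); first by apply: dh; rewrite cg oner_eq0.
by apply: dg; rewrite ch oner_eq0.
Qed.

(** A product of pointed elements is, up to the power v^w, pointed at the sum of the degrees.
    Comparison with the given relation reads off both the additivity of [ga] and
    [w1 m1 m2 = w (ga m1) (ga m2)]. *)
Lemma ptd_monomialM (w1 : qform N) (IM : G -> T) (ga : G -> G) :
  (forall m, nonneg m -> ptd (ga m) (IM m)) ->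
  (forall m1 m2, nonneg m1 -> nonneg m2 ->
     IM m1 * IM m2 = vp (w1 m1 m2) *: IM (m1 + m2)) ->
  forall m1 m2, nonneg m1 -> nonneg m2 -> ga (m1 + m2) = ga m1 + ga m2 /\
    IM m1 * IM m2 = vp (w (ga m1) (ga m2)) *: IM (m1 + m2).
Proof.
move=> IM_ptd IM_M m1 m2 h1 h2; have h12 := nonnegD h1 h2.
have [dd c1] := ptdM (IM_ptd _ h1) (IM_ptd _ h2).
have [d12 c12] := IM_ptd _ h12.
have Eg : ga m1 + ga m2 = ga (m1 + m2).
  apply: (@cone_anti _ C).
    apply: d12; have := c1; rewrite IM_M // scalerA vpD cfZ => E0.
    by apply/eqP => z0; move/eqP: E0; rewrite z0 mulr0 eq_sym oner_eq0.
  apply: dd; rewrite IM_M // scalerA vpD cfZ c12 mulr1; exact: vp_neq0.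
split=> //; rewrite IM_M //; congr (_ *: _).
have := c1; rewrite IM_M // scalerA vpD cfZ Eg c12 mulr1 -vp0 => /vp_inj.
by move=> E0; congr vp; lia.
Qed.
End Dominated.

Section Triangular.
Variables (R : qcoef) (N : nat) (w : qform N) (T : qtorus R w) (C : qcone N).
Local Notation G := 'cV[int]_N.
Variable L : G -> T.
Hypothesis Lpt : forall g, ptd C g (L g).
Hypothesis Lbar : forall g, qbar (L g) = L g.
Implicit Types (p q z : T) (g h a x : G) (c : G -> R).
Local Notation vp := (vp R).
Local Notation X := (qX T).

(** The list only has to cover the support, so coordinates are plain functions that can be added and
    reindexed without normalization. *)
Definition coords z c := exists s : seq G,
  [/\ uniq s, forall h, c h != 0 -> h \in s & z = \sum_(h <- s) c h *: L h].

Lemma coord_wide z c s s' : uniq s -> (forall h, c h != 0 -> h \in s) ->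
  uniq s' -> {subset s <= s'} ->
  \sum_(h <- s') c h *: L h = \sum_(h <- s) c h *: L h.
Proof.
move=> us cs us' ss'; rewrite (bigID (mem s)) /= [X in _ + X]big1 ?addr0.
  rewrite -big_filter; apply: perm_big; apply: uniq_perm => //.
    exact: filter_uniq.
  by move=> h; rewrite mem_filter; case hs: (h \in s); rewrite //= ss'.
move=> h hs; have [-> | /cs] := eqVneq (c h) 0; first by rewrite scale0r.
by rewrite (negPf hs).
Qed.

Lemma coord_ext z c c' : c =1 c' -> coords z c -> coords z c'.
Proof.
move=> E [s [us cs ->]]; exists s; split=> // [h|]; first by rewrite -E => /cs.
by apply: eq_bigr => h _; rewrite E.
Qed.

Lemma coord0 : coords 0 (fun=> 0).
Proof. by exists [::]; split=> // [h|]; rewrite ?eqxx ?big_nil. Qed.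

Lemma coordZ z c (b : R) : coords z c -> coords (b *: z) (fun h => b * c h).
Proof.
move=> [s [us cs ->]]; exists s; split=> // [h E|].
  by apply: cs; apply: contraNneq E => ->; rewrite mulr0.
by rewrite scaler_sumr; apply: eq_bigr => h _; rewrite scalerA.
Qed.

Lemma coordD z1 z2 c1 c2 : coords z1 c1 -> coords z2 c2 ->
  coords (z1 + z2) (fun h => c1 h + c2 h).
Proof.
move=> [s1 [u1 h1 ->]] [s2 [u2 h2 ->]].
exists (undup (s1 ++ s2)); split; first exact: undup_uniq.
  move=> h; rewrite mem_undup mem_cat.
  have [-> | /h1 -> //] := eqVneq (c1 h) 0; rewrite add0r => /h2 ->.
  by rewrite orbT.
have su := undup_uniq (s1 ++ s2).
rewrite -(coord_wide 0 u1 h1 su) => [|h]; last by rewrite mem_undup mem_cat => ->.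
rewrite -(coord_wide 0 u2 h2 su) => [|h].
  by rewrite -big_split; apply: eq_bigr => h _; rewrite scalerDl.
by rewrite mem_undup mem_cat orbC => ->.
Qed.

Lemma coordN z c : coords z c -> coords (- z) (fun h => - c h).
Proof.
by move=> /(coordZ (-1)); rewrite scaleN1r; apply: coord_ext => h; rewrite mulN1r.
Qed.

Lemma coordB z1 z2 c1 c2 : coords z1 c1 -> coords z2 c2 ->
  coords (z1 - z2) (fun h => c1 h - c2 h).
Proof. by move=> h1 /coordN h2; exact: coordD. Qed.

Lemma coordL g : coords (L g) (fun h => (g == h)%:R).
Proof.
exists [:: g]; split=> // [h|]; last by rewrite big_seq1 eqxx scale1r.
by rewrite inE eq_sym; case: (eqVneq h g) => // _; rewrite eqxx.
Qed.

Lemma coord_bar z c : coords z c -> coords (qbar z) (fun h => br (c h)).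
Proof.
move=> [s [us cs ->]]; exists s; split=> // [h E|].
  by apply: cs; apply: contraNneq E => ->; rewrite br0.
by rewrite bar_sum; apply: eq_bigr => h _; rewrite barZ Lbar.
Qed.

(** This is [cone_family] for the pointed family [L]. An empty [U] gives linear independence, the
    cone below [g] gives [coord_domin]. *)
Lemma coord_up z c (U : G -> Prop) : coords z c ->
  (forall x y, U x -> cone C (y - x) -> U y) ->
  (forall x, cf z x != 0 -> U x) -> forall h, c h != 0 -> U h.
Proof.
move=> [s [us cs ->]] UC zU h ch.
apply: (@cone_family _ C R _ s c id (fun h => cf (L h)) U us) => //.
- by move=> i _; have [] := Lpt i.
- by move=> i _; have [] := Lpt i.
- move=> x E; apply: zU; rewrite cf_sum; apply: contraNneq E => E.
  by rewrite -[X in _ == X]E; apply/eqP/eq_bigr => i _; rewrite cfZ.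
- exact: cs.
Qed.

Lemma coord_domin z c g : coords z c -> domin C g z ->
  forall h, c h != 0 -> cone C (h - g).
Proof.
move=> cz dz; apply: (coord_up cz) => // x y xg yx.
exact: cone_trans yx xg.
Qed.

Lemma coord_eq0 c : coords 0 c -> c =1 fun=> 0.
Proof.
move=> cz h; apply/eqP/contraT => ch.
by case: (coord_up cz (U := fun=> False) _ _ ch) => // x; rewrite cf0 eqxx.
Qed.

Lemma coord_uniq z c1 c2 : coords z c1 -> coords z c2 -> c1 =1 c2.
Proof.
move=> h1 h2 h; have := coordB h1 h2; rewrite subrr => /coord_eq0/(_ h)/eqP.
by rewrite subr_eq0 => /eqP.
Qed.

Lemma coord_lead z c g : coords z c -> domin C g z -> c g = cf z g.
Proof.
move=> cz dz; have cC := coord_domin cz dz.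
have [s [us cs ->]] := cz; rewrite cf_sum.
have E h : h != g -> cf (c h *: L h) g = 0.
  move=> hg; rewrite cfZ; have [-> | /cC hC] := eqVneq (c h) 0.
    by rewrite mul0r.
  have [-> | gh] := eqVneq (cf (L h) g) 0; first by rewrite mulr0.
  by rewrite (cone_anti hC ((Lpt h).1 _ gh)) eqxx in hg.
have [gs | gs] := boolP (g \in s).
  rewrite (bigD1_seq g) //= cfZ (Lpt g).2 mulr1 big1 ?addr0 //.
have -> : c g = 0 by apply/eqP; apply: contraNT gs => /cs.
rewrite big_seq big1 // => h hs; apply: E; apply: contraNneq gs => <- //.
Qed.

Definition inM z := exists2 c, coords z c & forall h, im (c h).

Lemma inM0 : inM 0.
Proof. by exists (fun=> 0) => [|h]; [exact: coord0 | exact: im0]. Qed.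

Lemma inMD p q : inM p -> inM q -> inM (p + q).
Proof.
move=> [c cp mc] [d dq md]; exists (fun h => c h + d h); first exact: coordD.
by move=> h; apply: imD.
Qed.

Lemma inM_sum (I : eqType) (r : seq I) (f : I -> T) :
  (forall i, i \in r -> inM (f i)) -> inM (\sum_(i <- r) f i).
Proof.
move=> df; rewrite big_seq; apply: big_ind => //; first exact: inM0.
by move=> p q; exact: inMD.
Qed.

Lemma inM_L (b : R) g : im b -> inM (b *: L g).
Proof.
move=> mb; exists (fun h => b * (g == h)%:R); first exact/coordZ/coordL.
by move=> h; case: (g == h); rewrite ?mulr1 ?mulr0 //; exact: im0.
Qed.

Lemma inMZ (b : R) p : im b -> inM p -> inM (b *: p).
Proof.
move=> mb [c cp mc]; exists (fun h => b * c h); first exact: coordZ.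
by move=> h; apply: imM.
Qed.

Definition tri g z := domin C g z /\ inM (z - L g).

Lemma tri_L g : tri g (L g).
Proof. by split; [exact: (Lpt g).1 | rewrite subrr; exact: inM0]. Qed.

(** Coordinates are unique and [L] is bar-invariant, so bar fixes each coordinate; lying in m, it
    vanishes. *)
Lemma inM_bar z : inM z -> qbar z = z -> z = 0.
Proof.
move=> [c cz mc] bz; have := coord_bar cz; rewrite bz => cz'.
have E := coord_uniq cz cz'; have c0 h : c h = 0 by apply: im_br; rewrite // -E.
by case: cz => s [_ _ ->]; rewrite big1 // => h _; rewrite c0 scale0r.
Qed.

Lemma inM_bar_L g z : inM (z - L g) -> qbar z = z -> z = L g.
Proof.
by move=> /inM_bar H bz; apply/subr0_eq/H; rewrite barD barN Lbar bz.
Qed.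

Lemma tri_eq_L g z : tri g z -> qbar z = z -> z = L g.
Proof. by move=> [_]; exact: inM_bar_L. Qed.

Section Operator.
Variables (F : T -> T) (a : G) (nu : G -> int).
Hypothesis FD : {morph F : p q / p + q}.
Hypothesis FZ : forall (c : R), {morph F : p / c *: p}.
Hypothesis Fdom : forall g z, domin C g z -> domin C (g + a) (F z).
Hypothesis nu_le : forall g h, cone C (h - g) -> nu h <= nu g.

Lemma op_sum (I : Type) (r : seq I) (f : I -> T) :
  F (\sum_(i <- r) f i) = \sum_(i <- r) F (f i).
Proof.
have F0 : F 0 = 0 by have := FZ 0 0; rewrite !scale0r.
by apply: (big_morph _ FD F0).
Qed.

(** If [L h] occurs in [z - L g], then [h] is dominated by [g], so [nu h <= nu g]. Normalizing at
    [g] instead of [h] costs a nonpositive power of v, which keeps coefficients in m. *)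
Lemma tri_op g z : (forall h, inM (vp (- nu h) *: F (L h) - L (h + a))) ->
  tri g z -> tri (g + a) (vp (- nu g) *: F z).
Proof.
move=> FL [dz [c cz mc]]; split; first exact/dominZ/Fdom.
have cC := coord_domin cz (dominB dz (Lpt g).1).
have [s [us cs E]] := cz.
rewrite -[z](subrK (L g)) E FD op_sum scalerDr -addrA.
apply: inMD (FL g); rewrite scaler_sumr.
apply: inM_sum => h hs; have [-> | /cC /nu_le hg] := eqVneq (c h) 0.
    by rewrite FZ !scale0r scaler0; exact: inM0.
rewrite FZ scalerA mulrC -scalerA.
have -> : vp (- nu g) *: F (L h) =
    vp (nu h - nu g) *: (vp (- nu h) *: F (L h) - L (h + a)) +
    vp (nu h - nu g) *: L (h + a).
  by rewrite scalerBr subrK scalerA vpD; congr (vp _ *: _); lia.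
have mv : im (c h * vp (nu h - nu g)) by rewrite mulrC; apply: im_vpM => //; lia.
rewrite scalerDr !scalerA; apply: inMD; first exact: inMZ.
exact: inM_L.
Qed.

(* It suffices to test an operator on one triangular element per degree: the
   coefficients of F (L g) are controlled by induction on their height. *)
Lemma op_transfer :
  (forall g, exists c, coords (F (L g)) c) ->
  (forall g, exists P, [/\ ptd C g P, inM (P - L g)
     & inM (vp (- nu g) *: F P - L (g + a))]) ->
  forall g, inM (vp (- nu g) *: F (L g) - L (g + a)).
Proof.
move=> Fspan FP; pose E g := vp (- nu g) *: F (L g) - L (g + a).
pose low (B : int) z := exists2 c, coords z c & forall h, ht C h < B -> im (c h).
have lowD B p q : low B p -> low B q -> low B (p + q).
  move=> [c cp mc] [d dq md]; exists (fun h => c h + d h); first exact: coordD.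
  by move=> h hB; apply: imD; [exact: mc | exact: md].
have low_inM B p : inM p -> low B p by case=> c cp mc; exists c.
have lowZ B (b : R) p : im b -> low B p -> low B (b *: p).
  move=> mb [c cp mc]; exists (fun h => b * c h); first exact: coordZ.
  by move=> h /mc; exact: imM.
have cE g : exists c, coords (E g) c.
  have [c cF] := Fspan g.
  by eexists; apply: coordB; [exact: coordZ cF | exact: coordL].
have dE g : domin C (g + a) (E g).
  by apply: dominB (Lpt _).1; apply/dominZ/Fdom/(Lpt g).1.
suff H n : forall g, low (ht C (g + a) + n%:Z) (E g).
  move=> g; have [c cg] := cE g; exists c => // h.
  have [d dg] := H `|ht C h - ht C (g + a)|.+1 g.
  by rewrite (coord_uniq cg dg); apply; lia.
elim: n => [|n IH] g.
  have [c cg] := cE g; exists c => // h hB.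
  have [-> | /(coord_domin cg (dE g))/cone_ht] := eqVneq (c h) 0; first exact: im0.
  by lia.
have [P [ptP [b cb mb] MP]] := FP g.
have dPL := dominB ptP.1 (Lpt g).1.
have bC := coord_domin cb dPL.
(* Since [L g] is absent from [P - L g], only errors [E h] with [h] of larger height enter, and for
   these the induction hypothesis reaches one step further. *)
have b0 : b g = 0 by rewrite (coord_lead cb dPL) cfB ptP.2 (Lpt g).2 subrr.
have [s [us bs EP]] := cb.
(* The coefficient of [L h] in [P - L g], corrected from the normalization at [g] to that at [h]; it
   stays in m. *)
pose R1 h := b h * vp (nu h - nu g).
have -> : E g = vp (- nu g) *: F P - L (g + a) - \sum_(h <- s) (R1 h *: E h)
               - \sum_(h <- s) R1 h *: L (h + a).
  have -> : F P = F (L g) + \sum_(h <- s) b h *: F (L h).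
    rewrite -[P](subrK (L g)) EP addrC FD op_sum; congr (_ + _).
    by apply: eq_bigr => h _; exact: FZ.
  have -> : \sum_(h <- s) R1 h *: E h =
      vp (- nu g) *: (\sum_(h <- s) b h *: F (L h)) - \sum_(h <- s) R1 h *: L (h + a).
    rewrite scaler_sumr -sumrB; apply: eq_bigr => h _.
    rewrite /E /R1 scalerBr !scalerA; congr (_ *: _ - _).
    by rewrite -mulrA vpD mulrC; congr (vp _ * _); lia.
  rewrite /E scalerDr -[RHS]addrA -opprD subrK [RHS]addrAC.
  by rewrite addrK.
have mR h : h \in s -> im (R1 h).
  move=> hs; rewrite /R1; have [-> | /bC /nu_le hg] := eqVneq (b h) 0.
    by rewrite mul0r; exact: im0.
  by rewrite mulrC; apply: im_vpM => //; lia.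
have lowN B p : low B p -> low B (- p).
  move=> [c cp mc]; exists (fun h => - c h); first exact: coordN.
  by move=> h hB; apply/imN/mc.
have low_sum B (f : G -> T) : (forall h, h \in s -> low B (f h)) ->
    low B (\sum_(h <- s) f h).
  move=> lf; rewrite big_seq; apply: big_ind => //; first exact/low_inM/inM0.
  exact: lowD.
apply: (@lowD); first apply: (@lowD); first exact: low_inM.
  apply/lowN/low_sum => h hs.
  have [bh0 | bh] := eqVneq (b h) 0.
    by rewrite /R1 bh0 mul0r scale0r; apply/low_inM/inM0.
  have gh : h != g by apply: contraNneq bh => ->; rewrite b0.
  have [c ch mc] := IH h; apply: lowZ; first exact: mR.
  exists c => // x xB; apply: mc.
  by have := cone_ht_lt (bC h bh) gh; rewrite !htD in xB *; lia.
apply/lowN/low_sum => h hs; apply/low_inM/inM_L; exact: mR.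
Qed.
End Operator.
End Triangular.

(** * The two tori of an elementary mutation *)

Local Notation fv i := (delta_mx i 0 : 'cV[int]_ _).

Record qmorph (R : qcoef) (N : nat) (w : qform N) (T : qtorus R w) (E : algType R) :=
  QMorph {
    qmor :> T -> E;
    qmorD : {morph qmor : x y / x + y};
    qmorM : {morph qmor : x y / x * y};
    qmorZ : forall c, {morph qmor : x / c *: x};
    qmor1 : qmor 1 = 1 }.

(** * Monomials of one torus expanded in the other *)

Section Lift.
Variables (R : qcoef) (N : nat) (w w' : qform N) (T : qtorus R w) (T' : qtorus R w').
Local Notation G := 'cV[int]_N.
Variables (C : qcone N) (E : algType R).
Variables (i : qmorph T E) (j : qmorph T' E).
Hypothesis i_inj : injective i.
Variables (ka : 'I_N) (p b : G).
Implicit Types (z : T) (a g h x : G).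
Local Notation vp := (vp R).

Hypothesis w_ff : forall a, a ka 0 = 0 -> w' a (fv ka) = w a p.
Hypothesis coneb : cone C b.
Hypothesis b_neq0 : b != 0.
Hypothesis jX : forall a, a ka 0 = 0 -> j (qX T' a) = i (qX T a).
Hypothesis jXk : j (qX T' (fv ka)) = i (qX T p + qX T (p + b)).

(** The witness is a power of the binomial that expands X_k of the other seed. The section is
    neutral between the two seeds and serves both [lift_down] and [lift_up]. *)
Lemma lift_power m : exists z, [/\ i z = j (qX T' (fv ka *+ m)),
  ptd C (p *+ m) z, qbar z = z &
  forall x, cf z x != 0 -> exists n, x = p *+ m + b *+ n].
Proof.
pose u := qX T p + qX T (p + b); exists (u ^+ m).
have ptu : ptd C p u.
  split.
    apply: dominD; first exact: (ptd_X T C p).1.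
    by apply: (domin_le _ (ptd_X T C (p + b)).1); rewrite addrC addKr.
  rewrite cfD !cf_X eqxx (_ : (p + b == p) = false) ?addr0 //.
  by apply: contra_neqF b_neq0 => /eqP E0; apply: (addrI p); rewrite addr0.
have bu : qbar u = u by rewrite barD !bar_X.
have su x : cf u x != 0 -> exists n, x = p + b *+ n.
  rewrite cfD !cf_X; case: (eqVneq p x) => [<- _ | _].
    by exists 0%N; rewrite mulr0n addr0.
  by case: (eqVneq (p + b) x) => [<- _ | _]; [exists 1%N | rewrite addr0 eqxx].
split; last 1 first.
- elim: m => [x | m IH x].
    rewrite expr0 -qX0 cf_X mulr0n; case: (eqVneq 0 x) => [<- _|_].
      by exists 0%N; rewrite mulr0n addr0.
    by rewrite eqxx.
  rewrite exprS => /cfM_neq0[y [/su[n1 ->] /IH[n2 E2]]].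
  exists (n1 + n2)%N; rewrite -[x](subrK (p + b *+ n1)) E2; vring.
- elim: m => [|m IH]; first by rewrite expr0 mulr0n qX0 !qmor1.
  rewrite exprS mulrS qmorM IH -jXk -qmorM qXM lamMnr lamaa mul0rn.
  by rewrite vp0 scale1r.
- elim: m => [|m IH]; first by rewrite expr0 mulr0n -qX0; exact: ptd_X.
  rewrite exprS mulrS; have := ptdM ptu IH.
  by rewrite lamMnr lamaa mul0rn oppr0 vp0 scale1r.
- by rewrite barX bu.
Qed.

Lemma lift_X h : 0 <= h ka 0 -> exists z, [/\ i z = j (qX T' h),
  ptd C (h + h ka 0 *: (p - fv ka)) z, qbar z = z &
  forall x, cf z x != 0 -> exists n, x = h + h ka 0 *: (p - fv ka) + b *+ n].
Proof.
case Eh : (h ka 0) => [m|//] _.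
have [z [ez pz bz sz]] := lift_power m.
pose a := h - fv ka *+ m.
have a0 : a ka 0 = 0 by rewrite /a !mxE mulmxnE !mxE !eqxx Eh; lia.
have Ea : h = a + fv ka *+ m by rewrite subrK.
have Eg : h + m%:Z *: (p - fv ka) = a + p *+ m.
  by rewrite /a; vring.
exists (vp (- w' a (fv ka *+ m)) *: (qX T a * z)).
have ww : w' a (fv ka *+ m) = w a (p *+ m) by rewrite !lamMnr w_ff.
split.
- rewrite qmorZ qmorM ez -(jX a0) -qmorM qXM qmorZ.
  by rewrite scalerA vpD addNr vp0 scale1r -Ea.
- by rewrite Eg ww; apply: ptdM pz; exact: ptd_X.
(* Bar-invariance is checked in [E], where [z] becomes a monomial of [T'] and quasi-commutes with
   X^a. *)
- rewrite barZ br_vp barM bz bar_X opprK; apply: i_inj.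
  rewrite !qmorZ !qmorM ez -(jX a0) -!qmorM !qXM !qmorZ.
  by rewrite !scalerA !vpD (lamC w' a) [fv ka *+ m + a]addrC subrr addNr.
- move=> x; rewrite cfZ vpM_eq0 Eg => /cfM_neq0[y []].
  rewrite cf_X; case: (eqVneq a y) => [<- _ | _]; last by rewrite eqxx.
  by move=> /sz[n E2]; exists n; rewrite -[x](subrK a) E2; vring.
Qed.
End Lift.

Section Mutation.
Variables (R : qcoef) (N : nat) (w w' : qform N) (T : qtorus R w) (T' : qtorus R w').
Local Notation G := 'cV[int]_N.
Variables (C C' : qcone N) (E : algType R).
Variables (i : qmorph T E) (j : qmorph T' E).
Hypothesis i_inj : injective i.
Hypothesis j_inj : injective j.
Hypothesis E_dom : forall x y : E, x * y = 0 -> x = 0 \/ y = 0.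
Variables (ka : 'I_N) (bp bm : G) (d : int) (kap : G).
Variables b p : G.
Hypothesis bE : b = bp - bm.
Hypothesis pE : p = bm - fv ka.
Local Notation vp := (vp R).
Hypothesis bp_ka : bp ka 0 = 0.
Hypothesis bm_ka : bm ka 0 = 0.
Hypothesis d_gt0 : 0 < d.
Hypothesis wb : forall y : G, w b y = d * y ka 0.
(* In the application b is the k-th column of B(t), p and p + b are the exponents
   of mu_k^* X_k(t'), kap is the sum of the unfrozen f_j with j <> k, and psi
   rewrites the basis (f'_j) of M(t') in terms of (f_j). *)
Definition psi (x : G) : G := x + x ka 0 *: (p - fv ka).
Hypothesis w'E : forall x y, w' x y = w (psi x) (psi y).
Hypothesis coneb : cone C b.
Hypothesis coneb' : cone C' (- b).
Hypothesis jX : forall a : G, a ka 0 = 0 -> j (qX T' a) = i (qX T a).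
Hypothesis jXk : j (qX T' (fv ka)) = i (qX T p + qX T (p + b)).
Hypothesis kap_ka : kap ka 0 = 0.
Implicit Types (z : T) (y : T') (g h a x : G) (c : R).
Hypothesis kap_C : forall x, cone C x -> w kap x <= 0.
Hypothesis kap_C0 : forall x, cone C x -> w kap x = 0 -> exists n, x = b *+ n.
Hypothesis kap_C' : forall x, cone C' x -> w' kap x <= 0.

Ltac bring := rewrite ?bE ?pE; vring.

Definition phi (g : G) : G :=
  if 0 <= g ka 0 then g + g ka 0 *: (bp - fv ka - fv ka) else psi g.

Definition phiV (g : G) : G :=
  if 0 < g ka 0 then psi g else g + g ka 0 *: (bp - fv ka - fv ka).

Lemma fv_ka : (fv ka : G) ka 0 = 1.
Proof. by rewrite mxE !eqxx. Qed.

Lemma psi_ka g : psi g ka 0 = - g ka 0.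
Proof. by rewrite /psi pE !mxE bm_ka !eqxx /=; ring. Qed.

Lemma phi_ka g : phi g ka 0 = - g ka 0.
Proof. by rewrite /phi; case: ifP => _; rewrite ?psi_ka // !mxE bp_ka !eqxx /=; ring. Qed.

Lemma psiK g : psi (psi g) = g.
Proof. by rewrite {1}/psi psi_ka /psi; bring. Qed.

Lemma phiVK g : phi (phiV g) = g.
Proof.
rewrite {1}/phi /phiV; case: ltrP => g0.
  by rewrite psi_ka lerNr oppr0 leNgt g0 /= psiK.
have -> : (g + g ka 0 *: (bp - fv ka - fv ka)) ka 0 = - g ka 0.
  by rewrite !mxE bp_ka !eqxx /=; ring.
by rewrite oppr_ge0 g0; bring.
Qed.

Lemma phiK g : phiV (phi g) = g.
Proof.
rewrite /phiV phi_ka /phi oppr_gt0; case: ltrP => g0; first exact: psiK.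
by bring.
Qed.

Lemma phi_inj : injective phi.
Proof. exact: can_inj phiK. Qed.

Lemma phi0 g : g ka 0 = 0 -> phi g = g.
Proof. by move=> g0; rewrite /phi g0 lexx scale0r addr0. Qed.

Lemma psi0 g : g ka 0 = 0 -> psi g = g.
Proof. by move=> g0; rewrite /psi g0 scale0r addr0. Qed.

(** Read in the basis of M(t), phi only adds a multiple of [b]: classes modulo [b] are what the two
    seeds share. *)
Lemma psi_phi g : psi (phi g) = g + Num.max (g ka 0) 0 *: b.
Proof.
rewrite {1}/psi phi_ka /phi; case: lerP => g0.
  by bring.
by rewrite /psi; bring.
Qed.

Lemma phiD g a : a ka 0 = 0 -> phi (g + a) = phi g + a.
Proof.
by move=> a0; rewrite /phi /psi !mxE a0 addr0; case: ifP => _; bring.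
Qed.

(** [psi (phi x)] and [x] differ by a multiple of [b], which pairs to zero with vectors without k-th
    coordinate. For [a = kap] this matches the gradings of the two tori. *)
Lemma w'0 a x : a ka 0 = 0 -> w' a (phi x) = w a x.
Proof.
move=> a0; by rewrite w'E (psi0 a0) psi_phi lamDr lamZr (lamC w b) wb a0; ring.
Qed.

Lemma b_neq0 : b != 0.
Proof.
apply/eqP => b0; have := wb (fv ka).
by rewrite b0 lam0l fv_ka mulr1 => d0; have := d_gt0; rewrite -d0 ltxx.
Qed.

(* z and y are the Laurent expansions in t and t' of the same element. *)
Definition corr z y := i z = j y.

Lemma corrD z1 z2 y1 y2 : corr z1 y1 -> corr z2 y2 -> corr (z1 + z2) (y1 + y2).
Proof. by move=> r1 r2; rewrite /corr qmorD r1 r2 -qmorD. Qed.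

Lemma corrM z1 z2 y1 y2 : corr z1 y1 -> corr z2 y2 -> corr (z1 * z2) (y1 * y2).
Proof. by move=> r1 r2; rewrite /corr qmorM r1 r2 -qmorM. Qed.

Lemma corrZ c z y : corr z y -> corr (c *: z) (c *: y).
Proof. by move=> r; rewrite /corr qmorZ r -qmorZ. Qed.

Lemma corrN z y : corr z y -> corr (- z) (- y).
Proof. by move=> /(corrZ (-1)); rewrite !scaleN1r. Qed.

Lemma corrB z1 z2 y1 y2 : corr z1 y1 -> corr z2 y2 -> corr (z1 - z2) (y1 - y2).
Proof. by move=> r1 r2; apply/corrD/corrN. Qed.

Lemma corr0 : corr 0 0.
Proof. by rewrite /corr -(scale0r (0 : T)) -(scale0r (0 : T')) !qmorZ !scale0r. Qed.

Lemma corr_injl z1 z2 y : corr z1 y -> corr z2 y -> z1 = z2.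
Proof. by move=> r1 r2; apply: i_inj; rewrite [LHS]r1 -r2. Qed.

Lemma corr_injr z y1 y2 : corr z y1 -> corr z y2 -> y1 = y2.
Proof. by move=> r1 r2; apply: j_inj; rewrite -[LHS]r1 r2. Qed.

Lemma corr_X a : a ka 0 = 0 -> corr (qX T a) (qX T' a).
Proof. by move=> a0; rewrite /corr jX. Qed.

Lemma w_pb : w p b = d.
Proof. by rewrite lamC wb pE !mxE bm_ka !eqxx /=; ring. Qed.

(** Mutation is involutive on X_k. Multiplied by X_k(t') on the left, both sides become the same
    combination of monomials common to the two tori; X_k(t') cancels because [E] has no zero
    divisors. *)
Lemma exchange_inv : i (qX T (fv ka)) = j (qX T' (bp - fv ka) + qX T' (bp - fv ka - b)).
Proof.
have Ep : psi (fv ka) = p by rewrite /psi fv_ka; bring.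
have E1 : psi (bp - fv ka) = b + fv ka.
  by rewrite /psi !mxE bp_ka !eqxx /=; bring.
have E2 : psi (bp - fv ka - b) = fv ka.
  by rewrite /psi bE !mxE bp_ka bm_ka !eqxx /=; bring.
apply/esym/subr0_eq.
have [||//] := E_dom (x := j (qX T' (fv ka))) (y := j (qX T' (bp - fv ka) + qX T' (bp - fv ka - b)) - i (qX T (fv ka))).
  rewrite mulrBr {2}jXk -qmorM -qmorM mulrDr !qXM mulrDl !qXM.
  rewrite !w'E Ep E1 E2 qmorD !qmorZ (_ : fv ka + (bp - fv ka) = bp); last by bring.
  rewrite (_ : fv ka + (bp - fv ka - b) = bm); last by bring.
  rewrite !jX // (_ : p + fv ka = bm); last by bring.
  rewrite (_ : p + b + fv ka = bp); last by bring.
  rewrite qmorD !qmorZ lamDr w_pb lamDl wb fv_ka mulr1.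
  by rewrite [d + _]addrC [X in _ - X]addrC subrr.
move=> x0; have : qX T' (fv ka) = 0.
  by apply: j_inj; rewrite x0 -(scale0r (0 : T')) qmorZ scale0r.
move=> /(congr1 (fun y => cf y (fv ka))); rewrite cf0 cf_X eqxx => /eqP.
by rewrite oner_eq0.
Qed.

Lemma lift_down h : 0 <= h ka 0 -> exists z, [/\ corr z (qX T' h),
  ptd C (psi h) z, qbar z = z &
  forall x, cf z x != 0 -> exists n, x = psi h + b *+ n].
Proof.
move=> h0; apply: lift_X h0 => //; last exact: b_neq0.
move=> a a0; rewrite w'E (psi0 a0) /psi fv_ka scale1r; congr (w a _).
by vring.
Qed.

Lemma lift_up h : 0 <= h ka 0 -> exists2 y, corr (qX T h) y & ptd C' (phi h) y.
Proof.
move=> h0.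
have H1 a : a ka 0 = 0 -> w a (fv ka) = w' a (bp - fv ka).
  move=> a0; rewrite w'E (psi0 a0).
  have -> : psi (bp - fv ka) = b + fv ka.
    by rewrite /psi !mxE bp_ka !eqxx /=; bring.
  by rewrite lamDr (lamC _ b) wb a0 mulr0 oppr0 add0r.
have H2 : - b != 0 by rewrite oppr_eq0 b_neq0.
have H3 a : a ka 0 = 0 -> i (qX T a) = j (qX T' a) by move/jX.
have [y [ey py _ _]] := lift_X j_inj H1 coneb' H2 H3 exchange_inv h0.
by exists y; rewrite /corr ?ey // /phi h0.
Qed.

Lemma lift_sum (s : seq G) (c : G -> R) : (forall h, h \in s -> 0 <= h ka 0) ->
  exists q, let y := \sum_(h <- s) c h *: qX T' h in
    corr q y /\ corr (qbar q) (qbar y).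
Proof.
elim: s => [_ | h s IH hs].
  by exists 0; rewrite big_nil /=; split; rewrite ?bar0; exact: corr0.
have [g gs | q [rq rbq]] := IH; first by apply: hs; rewrite inE gs orbT.
have [z [rz _ bz _]] := lift_down (hs h (mem_head _ _)).
exists (c h *: z + q); rewrite big_cons /=; split; first exact/corrD/rq/corrZ.
by rewrite !barD !barZ bz bar_X; apply/corrD/rbq/corrZ.
Qed.

(** Monomials of t' expand in t only when their exponent at k is nonnegative, and there [lift_sum]
    gives the claim. A high power of X_k(t') brings [y] into this range and is cancelled afterwards
    in [E]. *)
Lemma corr_bar z y : corr z y -> corr (qbar z) (qbar y).
Proof.
move=> rzy.
have [M Mpos] : exists M : nat, forall h, h \in supp y -> 0 <= h ka 0 + M%:Z.
  case: (supp y) => [|h s]; first by exists 0%N.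
  have [m _ mP] := seq_argmax (fun h : G => - h ka 0) (mem_head h s).
  by exists (absz (m ka 0)) => x /mP; move: (x ka 0) (m ka 0) => u v; lia.
have q0 h : h \in supp (y * qX T' (fv ka *+ M)) -> 0 <= h ka 0.
  rewrite suppE cf_MX vpM_eq0 -suppE => /Mpos.
  by rewrite !mxE mulmxnE !mxE !eqxx; move: (h ka 0) => u; lia.
have [q [rq rbq]] := lift_sum (cf (y * qX T' (fv ka *+ M))) q0.
rewrite -qE in rq rbq.
have fM : 0 <= (fv ka *+ M : G) ka 0 by rewrite mulmxnE mxE !eqxx; lia.
have [x [rx [_ x1] bx _]] := lift_down fM.
have Eq := corr_injl rq (corrM rzy rx).
move: rbq; rewrite Eq !barM bx bar_X /corr !qmorM -rx => /eqP.
rewrite -subr_eq0 -mulrBr => /eqP/E_dom[ix0|/subr0_eq //].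
have x0 : x = 0 by apply: i_inj; rewrite ix0 -(scale0r (0 : T)) qmorZ scale0r.
by move/eqP: x1; rewrite x0 cf0 eq_sym oner_eq0.
Qed.

Let conj_kap (W : qform N) (S : qtorus R W) (v : S) : S :=
  qX S kap * v * qX S (- kap).

Let cf_conj (W : qform N) (S : qtorus R W) (v : S) x :
  cf (conj_kap v) x = vp (W kap x + W kap x) * cf v x.
Proof.
rewrite /conj_kap cf_MX opprK cf_XM addrK mulrA vpD; congr (vp _ * _).
by rewrite lamDl !lamNr lamaa (lamC W kap x); ring.
Qed.

Lemma corr_conj z y : corr z y -> corr (conj_kap z) (conj_kap y).
Proof.
move=> r; apply: corrM; last by apply: corr_X; rewrite mxE kap_ka oppr0.
by apply: corrM r; exact: corr_X.
Qed.

(* Conjugation by X^kap is the same operator in both tori and it is diagonal;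
   the polynomial in it which kills z also kills y. *)
Lemma corr_grade z y (l0 : int) : corr z y -> (forall h, cf z h != 0 -> w kap h != l0) ->
  forall h, cf y h != 0 -> w' kap h != l0.
Proof.
move=> rzy za h; pose s := [seq w kap x | x <- supp z].
pose k (W : qform N) x (l : int) := vp (W kap x + W kap x) - vp (l + l).
(* [z1] and [y1] are the images of [z] and [y] under the product, over [l] in [t], of the operators
   [conj_kap] minus v^(2l). *)
have H (t : seq int) : exists z1 y1, [/\ corr z1 y1,
    forall x, cf z1 x = \prod_(l <- t) k w x l * cf z x &
    forall x, cf y1 x = \prod_(l <- t) k w' x l * cf y x].
  elim: t => [|l t [z1 [y1 [r1 cz cy]]]].
    by exists z, y; split=> // x; rewrite big_nil mul1r.
  exists (conj_kap z1 - vp (l + l) *: z1), (conj_kap y1 - vp (l + l) *: y1).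
  split; first by apply/corrB/corrZ/r1/corr_conj.
    by move=> x; rewrite cfB cf_conj cfZ cz big_cons /k -mulrA mulrBl.
  by move=> x; rewrite cfB cf_conj cfZ cy big_cons /k -mulrA mulrBl.
have [z1 [y1 [r1 cz cy]]] := H s.
have z0 : z1 = 0.
  apply: cfP => x; rewrite cf0 cz; have [-> | zx] := eqVneq (cf z x) 0.
    exact: mulr0.
  rewrite (big_rem (w kap x)) /=; last by apply: map_f; rewrite suppE.
  by rewrite /k subrr !mul0r.
have y0 : y1 = 0 by rewrite z0 in r1; exact: corr_injr r1 corr0.
move=> yh; apply: contraNneq yh => ha.
have: \prod_(l <- s) k w' h l * cf y h = 0 by rewrite -cy y0 cf0.
have : l0 \notin s.
  by apply/mapP => -[x]; rewrite suppE => /za xa ax; rewrite ax eqxx in xa.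
(* As [l0] is not among the degrees of [z], each factor at [h] is a difference of distinct powers of
   v, which [vp_reg] cancels. *)
clearbody s; clear z1 cz r1 y1 cy z0 y0.
elim: s => [_ | l t IH]; first by rewrite big_nil mul1r => ->.
rewrite inE negb_or => /andP[al] /IH {}IH; rewrite big_cons -mulrA.
rewrite /k mulrBl => /eqP; rewrite subr_eq0 => /eqP /vp_reg H0; apply/IH.
by apply: H0; rewrite ha; move/eqP: al => al; apply/eqP; lia.
Qed.

(** * Triangularity under products with monomials of t and of t[1] *)

Variable uf : pred 'I_N.
Hypothesis uf_ka : uf ka.
Hypothesis coneW : forall x a, cone C x -> (forall l, uf l -> 0 <= a l 0) -> w a x <= 0.
Hypothesis coneW' : forall x a, cone C' x -> (forall l, uf l -> 0 <= a l 0) -> w' a x <= 0.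
Variable L : G -> T.
Hypothesis Lpt : forall g, ptd C g (L g).
Hypothesis Lbar : forall g, qbar (L g) = L g.
Hypothesis L0 : L 0 = 1.
Definition inA z := exists e : G -> R, coords L z e.
Hypothesis inAM : forall z1 z2, inA z1 -> inA z2 -> inA (z1 * z2).
Hypothesis LX : forall (l : 'I_N) g,
  inM L (vp (- w (fv l) g) *: (qX T (fv l) * L g) - L (g + fv l)).
Variable Lp : G -> T'.
Hypothesis Lp_rel : forall g, corr (L g) (Lp g).

Lemma inA_L g : inA (L g).
Proof. by eexists; exact: coordL. Qed.

Lemma L_inj g h z : z = L g -> ptd C h z -> g = h.
Proof. by move=> ->; apply: ptd_uniq. Qed.

Lemma tri_subst g z1 z2 : tri C L g z1 -> z2 = z1 -> tri C L g z2.
Proof. by move=> t1 ->. Qed.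

Definition lgood a := forall g z, tri C L g z ->
  tri C L (g + a) (vp (- w a g) *: (qX T a * z)).

Lemma lgood_op a : (forall x, cone C x -> w a x <= 0) ->
  (forall g, inM L (vp (- w a g) *: (qX T a * L g) - L (g + a))) -> lgood a.
Proof.
move=> wa La g z tz; apply: (tri_op Lpt (F := fun z => qX T a * z)) La tz => //.
- by move=> z1 z2; exact: mulrDr.
- by move=> c z1; rewrite scalerAr.
- move=> h z1 dz; rewrite addrC; apply: dominM dz; exact: (ptd_X T C a).1.
- by move=> h1 h2 /wa; rewrite lamBr; lia.
Qed.

Lemma lgood0 : lgood 0.
Proof. by move=> g z; rewrite addr0 lam0l oppr0 vp0 scale1r qX0 mul1r. Qed.

Lemma lgoodD a1 a2 : lgood a1 -> lgood a2 -> lgood (a1 + a2).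
Proof.
move=> g1 g2 g z /g2/g1 H; rewrite [a1 + a2]addrC addrA; apply: tri_subst H _.
rewrite -scalerAr mulrA qXM -scalerAl !scalerA !vpD [a2 + a1]addrC.
by congr (vp _ *: _); rewrite lamDl lamDr; ring.
Qed.

Lemma lgood_fv l : uf l -> lgood (fv l).
Proof.
move=> ul; apply: lgood_op => [x xC|g]; last exact: LX.
by apply: coneW => // l' _; rewrite mxE; case: (_ && _).
Qed.

Lemma frozen_const l x : ~~ uf l -> cone C x -> w (fv l) x = 0.
Proof.
move=> ul xC; apply/eqP; rewrite eq_le; apply/andP; split.
  by apply: coneW => // l' _; rewrite mxE; case: (_ && _).
rewrite -oppr_le0 -lamNl; apply: coneW => // l' ul'; rewrite !mxE.
by rewrite andbT; case: eqP => // E0; rewrite -E0 ul' in ul.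
Qed.

(** All degrees of [L g] pair equally with a frozen f_l, so X_l quasi-commutes with [L g]. The
    normalized product is then bar-invariant, and triangularity leaves no error. *)
Lemma frozen_factor l g : ~~ uf l ->
  L (g + fv l) = vp (- w (fv l) g) *: (qX T (fv l) * L g).
Proof.
move=> ul; apply/esym/(inM_bar_L Lpt Lbar); first exact: LX.
rewrite barZ br_vp barM Lbar bar_X opprK; apply: cfP => x.
rewrite !cfZ cf_XM cf_MX !mulrA !vpD.
have [-> | /((Lpt g).1)/(frozen_const ul)] := eqVneq (cf (L g) (x - fv l)) 0.
  by rewrite !mulr0.
rewrite lamBr => E0; congr (vp _ * _); rewrite (lamC _ (fv l)); lia.
Qed.

(** Frozen variables act invertibly on the basis. Inverses are wanted because [g - ga m] is
    controlled at unfrozen vertices only. *)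
Lemma lgood_frozen l : ~~ uf l -> lgood (fv l) /\ lgood (- fv l).
Proof.
move=> ul; split; (apply: lgood_op => [x xC|g]).
- by rewrite frozen_const.
- exact: LX.
- by rewrite lamNl frozen_const.
rewrite -[g in L g](subrK (fv l)) frozen_factor // -scalerAr mulrA qXM.
rewrite -scalerAl !scalerA !vpD addNr qX0 mul1r [X in vp X](_ : _ = 0).
  by rewrite vp0 scale1r subrr; exact: inM0.
by rewrite !lamNl !lamBr lamaa; ring.
Qed.

Lemma lgoodZ l (n : int) : (uf l -> 0 <= n) -> lgood (n *: fv l).
Proof.
have pos a (m : nat) : lgood a -> lgood (m%:Z *: a).
  rewrite -natz scaler_nat => ga; elim: m => [|m IH].
    by rewrite mulr0n; exact: lgood0.
  by rewrite mulrS; exact: lgoodD.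
case: (boolP (uf l)) => [ul /(_ isT) | ul _].
  by case: n => // n _; apply/pos/lgood_fv.
have [gp gn] := lgood_frozen ul.
case: n => n; first exact: pos.
by rewrite NegzE scaleNr -scalerN; exact: pos.
Qed.

Lemma lgood_X a : (forall l, uf l -> 0 <= a l 0) -> lgood a.
Proof.
move=> a0; rewrite [a]matrix_sum_delta.
apply: (big_ind lgood) => [|a1 a2|l _]; [exact: lgood0 | exact: lgoodD |].
by rewrite big_ord1; apply: lgoodZ => /a0.
Qed.

Lemma L_X a : (forall l, uf l -> 0 <= a l 0) -> L a = qX T a.
Proof.
move=> /lgood_X/(_ 0 1); rewrite add0r lam0r oppr0 vp0 scale1r mulr1 => H.
apply/esym/(tri_eq_L Lpt Lbar); last exact: bar_X.
by apply: H; rewrite -L0; exact: tri_L.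
Qed.

(* IM m is the expansion in t of the monomial X^m of t[1], of degree ga m, and
   IM (fv k1) = I_k(t); below, IM' m is the expansion in t' of X^m of t'[1]. *)
Variables (w1 : qform N) (IM : G -> T) (ga : G -> G) (k1 : 'I_N).
Hypothesis IM_L : forall m, nonneg m -> IM m = L (ga m).
Hypothesis IM_M : forall m1 m2, nonneg m1 -> nonneg m2 ->
  IM m1 * IM m2 = vp (w1 m1 m2) *: IM (m1 + m2).
Hypothesis ga_le : forall m l, nonneg m -> uf l -> ga m l 0 <= 0.
Hypothesis ga_ka : forall m : G, nonneg m -> m k1 0 = 0 -> ga m ka 0 = 0.
Hypothesis ga_k1 : ga (fv k1) ka 0 = -1.
Hypothesis ga_sub : forall g, exists2 m, nonneg m &
  forall l, uf l -> 0 <= (g - ga m) l 0.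
Hypothesis ga_sub_ka : forall g, exists m : G, [/\ nonneg m, m k1 0 = 0 &
  forall l, uf l -> l != ka -> 0 <= (g - ga m) l 0].

Lemma IM_ptd m : nonneg m -> ptd C (ga m) (IM m).
Proof. by move=> m0; rewrite IM_L. Qed.

Lemma IM_add m1 m2 : nonneg m1 -> nonneg m2 ->
  ga (m1 + m2) = ga m1 + ga m2 /\
  IM m1 * IM m2 = vp (w (ga m1) (ga m2)) *: IM (m1 + m2).
Proof. exact: (ptd_monomialM IM_ptd IM_M). Qed.

(** The triangularity axiom speaks of left factors. By [op_transfer] it suffices to test X^(g - ga
    m1) times [IM m1], with [m1] so large that the first exponent is nonnegative at unfrozen
    vertices. Right multiplication by [IM m] turns [IM m1] into [IM (m1 + m)], again a basis
    element, and X acts on it from the left. *)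
Lemma IM_right m : nonneg m -> forall g z, tri C L g z ->
  tri C L (g + ga m) (vp (- w g (ga m)) *: (z * IM m)).
Proof.
move=> m0; have [dI cI] := IM_ptd m0.
have FD : {morph (fun z : T => z * IM m) : z1 z2 / z1 + z2}.
  by move=> z1 z2; exact: mulrDl.
have FZ (c : R) : {morph (fun z : T => z * IM m) : z1 / c *: z1}.
  by move=> z1; rewrite scalerAl.
have Fdom g z : domin C g z -> domin C (g + ga m) (z * IM m).
  by move=> dz; exact: dominM.
have nule g h : cone C (h - g) -> w h (ga m) <= w g (ga m).
  move=> gh; have := @coneW _ (- ga m) gh.
  rewrite lamNl lamBr !(lamC _ _ (ga m)) => H.
  suff: - (- w h (ga m) - - w g (ga m)) <= 0 by lia.
  by apply: H => l ul; rewrite mxE oppr_ge0; exact: ga_le.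
move=> g z; apply: (tri_op Lpt FD FZ Fdom nule) => {g z}.
apply: (op_transfer Lpt FD FZ Fdom nule) => [g|g].
  by rewrite IM_L //; apply: inAM; exact: inA_L.
have [m1 h1 hg] := ga_sub g; have Eg : ga m1 + (g - ga m1) = g by rewrite addrC subrK.
have t1 : tri C L (ga m1) (IM m1) by rewrite IM_L //; exact: tri_L.
have [d1 i1] := lgood_X hg t1; rewrite Eg in d1 i1.
have [E2 E3] := IM_add h1 m0.
have [_ i2] := lgood_X hg (tri_L Lpt (ga (m1 + m))).
exists (vp (- w (g - ga m1) (ga m1)) *: (qX T (g - ga m1) * IM m1)); split=> //.
  by rewrite -[g in ptd _ g](subrK (ga m1)); apply: ptdM (IM_ptd h1); exact: ptd_X.
move: i2; rewrite -IM_L; last exact: nonnegD.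
rewrite E2 addrAC Eg; congr (inM L (_ - _)).
rewrite -scalerAl -mulrA E3 -scalerAr !scalerA !vpD; congr (vp _ *: _).
by rewrite lamDr !lamBl; ring.
Qed.

(** * Monomials shared by the two seeds and their degrees *)

Hypothesis bp_ge0 : nonneg bp.
Hypothesis bm_ge0 : nonneg bm.
Hypothesis adm_X : forall n : nat, exists g, corr (L g) (qX T' (fv ka *+ n)).

Local Notation x1 := (qX T p + qX T (p + b)).

Lemma corr_x1 : corr x1 (qX T' (fv ka)).
Proof. by rewrite /corr jXk. Qed.

Lemma psiD g h : psi (g + h) = psi g + psi h.
Proof. by rewrite /psi mxE; bring. Qed.

(** X'^h is a power of X_k(t'), a basis element by admissibility, times a monomial X^a common to
    both tori. Left multiplication by X^a keeps triangularity, and the result is bar-invariant. *)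
Lemma lift_L h z : (forall l, uf l -> 0 <= h l 0) -> corr z (qX T' h) -> z = L (psi h).
Proof.
move=> h0 rz; have [z1 [rz1 _ bz1 _]] := lift_down (h0 _ uf_ka).
rewrite -(corr_injl rz rz1) in bz1 => {z1 rz1}.
case Eh : (h ka 0) (h0 _ uf_ka) => [n|//] _.
pose a := h - fv ka *+ n; pose g := psi (fv ka *+ n).
have Ea : h = a + fv ka *+ n by rewrite subrK.
have a0 : a ka 0 = 0 by rewrite /a !mxE mulmxnE !mxE !eqxx Eh; lia.
have ag l : uf l -> 0 <= a l 0.
  have [-> | lk] := eqVneq l ka; first by rewrite a0.
  by move=> /h0; rewrite /a !mxE mulmxnE !mxE (negPf lk) mul0rn subr0.
have [g' rg] := adm_X n.
have : 0 <= (fv ka *+ n : G) ka 0 by rewrite mulmxnE mxE !eqxx; lia.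
move=> /lift_down[z1 [rz1 pz1 _ _]]; rewrite -(corr_injl rg rz1) in pz1.
have Eg := L_inj erefl pz1; rewrite {g' pz1 z1 rz1}Eg -/g in rg.
apply: (tri_eq_L Lpt Lbar) bz1.
have -> : psi h = g + a by rewrite Ea psiD (psi0 a0) addrC.
apply: tri_subst (lgood_X ag (tri_L Lpt g)) _; apply: corr_injl rz _.
rewrite Ea; have -> : qX T' (a + fv ka *+ n) = vp (- w a g) *: (qX T' a * qX T' (fv ka *+ n)).
  by rewrite qXM scalerA vpD w'E (psi0 a0) addNr vp0 scale1r.
by apply: corrZ; apply: corrM rg; exact: corr_X.
Qed.

Lemma bMn_inj n1 n2 : b *+ n1 = b *+ n2 -> n1 = n2.
Proof.
move=> /(congr1 (fun x => w x (fv ka))); rewrite !lamMnl wb fv_ka mulr1.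
by apply: mulrIn; rewrite gt_eqF.
Qed.

Lemma addb_neq g n : (g == g + b *+ n.+1) = false.
Proof.
apply/negP => /eqP E0; suff : 0%N = n.+1 by [].
by apply: bMn_inj; apply: (addrI g); rewrite -E0 mulr0n addr0.
Qed.

Lemma w_kap_b : w kap b = 0.
Proof. by rewrite lamC wb kap_ka mulr0 oppr0. Qed.

(* Quasi-commutation with I_k forces the terms of IM m on the b-string through
   its degree to vanish. *)
Lemma IM_string m : nonneg m -> m k1 0 = 0 ->
  forall n, cf (IM m) (ga m + b *+ n.+1) = 0.
Proof.
move=> m0 mk n; pose g := ga m; pose g1 := ga (fv k1); pose I := IM (fv k1).
have f0 : nonneg (fv k1) by have := nonneg_fv k1 1; rewrite mulr1n.
have gk : g ka 0 = 0 by exact: ga_ka.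
have [dI cI] : ptd C g1 I := IM_ptd f0.
have [dM cM] : ptd C g (IM m) := IM_ptd m0.
have comm : IM m * I = vp (w g g1 + w g g1) *: (I * IM m).
  rewrite (IM_add m0 f0).2 (IM_add f0 m0).2 scalerA vpD [fv k1 + m]addrC.
  by rewrite (lamC w g g1) -addrA subrr addr0.
elim/ltn_ind: n => n IH.
(* [Q] drops the leading term of [IM m]; [a] is the first string position not yet known to
   vanish. *)
pose Q := IM m - qX T g; pose a := g + b *+ n.+1.
have Q0 : cf (IM m) a = cf Q a.
  by rewrite cfB cf_X addb_neq subr0.
(* At [a + g1] the kap-degree keeps both factors on their b-strings, and the positions before [a]
   are empty by induction: only [a] and [g1] can meet. *)
have str x : cf Q x != 0 -> cf I (a + g1 - x) != 0 -> x = a.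
  move=> Qx /dI; rewrite (_ : _ - g1 = a - x); last by vring.
  move=> ax; have xg : cone C (x - g).
    move: Qx; rewrite cfB cf_X; have [<- _ | _] := eqVneq g x.
      exact: cone_refl.
    by rewrite subr0 => /dM.
  have E0 : w kap (x - g) = 0 /\ w kap (a - x) = 0.
    have := kap_C xg; have := kap_C ax; rewrite !lamBr /a lamDr lamMnr w_kap_b mul0rn.
    lia.
  have [k Ek] := kap_C0 xg E0.1; have [k' Ek'] := kap_C0 ax E0.2.
  have Ea : (k + k')%N = n.+1.
    by apply: bMn_inj; rewrite mulrnDr -Ek -Ek' /a; vring.
  have Ex : x = g + b *+ k by rewrite -Ek addrC subrK.
  case: k => [|k] in Ek Ea Ex.
    by move: Qx; rewrite Ex mulr0n addr0 cfB cM cf_X !eqxx subrr eqxx.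
  have [kn | kn] := ltnP k n.
    by move: Qx; rewrite Ex cfB IH // cf_X addb_neq subrr eqxx.
  by rewrite Ex /a; congr (_ + b *+ _); lia.
have c1 : cf (Q * I) (a + g1) = vp (w a g1) * cf Q a.
  by rewrite (cfM_single str) addrAC subrr add0r cI mulr1.
have c2 : cf (I * Q) (a + g1) = vp (w g1 a) * cf Q a.
  rewrite (cfM_single (a := g1)) ?addrK ?cI ?mul1r // => x Ix Qx.
  have := str _ Qx; rewrite opprB [a + g1 + _]addrC subrK => /(_ Ix) Ea.
  by apply: (addrI a); rewrite -[in LHS]Ea subrK.
have wgb : w g b = 0 by rewrite lamC wb gk mulr0 oppr0.
have c3 : cf (Q * I) (a + g1) = vp (w g g1 + w g g1) * cf (I * Q) (a + g1).
  rewrite /Q mulrBl mulrBr !cfB comm cfZ mulrBr; congr (_ - _).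
  rewrite cf_XM cf_MX mulrA vpD; congr (vp _ * _).
  have -> : a + g1 - g = g1 + b *+ n.+1 by rewrite /a; vring.
  by rewrite lamDr lamDl lamMnr lamMnl wgb wb gk mulr0 mul0rn (lamC w g g1); ring.
rewrite -/g -/a Q0; move: c3; rewrite c1 c2 mulrA vpD => /vp_reg; apply.
(* The two powers of v differ by 2 d (n + 1), because [b] pairs with [g1] to [- d]. *)
rewrite (lamC w a g1) /a lamDl lamMnl wb ga_k1 -mulr_natr natz.
apply/eqP => E0; have : d * n.+1%:Z = 0.
  by move: E0; move: (w g g1) => u; lia.
by apply/eqP; rewrite mulf_neq0 ?gt_eqF.
Qed.

(** A term of the same kap-degree as the leading one lies on its b-string by [kap_C0], and
    [IM_string] clears that string. *)
Lemma IM_top m h : nonneg m -> m k1 0 = 0 -> cf (IM m) h != 0 ->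
  h = ga m \/ w kap h < w kap (ga m).
Proof.
move=> m0 mk mh; have hC := (IM_ptd m0).1 _ mh.
have := kap_C hC; rewrite lamBr le_eqVlt => /orP[/eqP E0 | lt]; last by right; lia.
left; have [|n E1] := kap_C0 hC; first by rewrite lamBr.
have Eh : h = ga m + b *+ n by rewrite -E1 addrC subrK.
case: n => [|n] in E1 Eh; first by rewrite Eh mulr0n addr0.
by move: mh; rewrite Eh IM_string // eqxx.
Qed.

Lemma corr_grade_le z y (l0 : int) : corr z y ->
  (forall h, cf z h != 0 -> w kap h <= l0) ->
  forall h, cf y h != 0 -> w' kap h <= l0.
Proof.
move=> r zl h yh; rewrite leNgt; apply/negP => lh.
have := @corr_grade _ _ (w' kap h) r _ h yh.
by rewrite eqxx => H; apply: notF (H _) => x /zl; case: eqP => //; lia.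
Qed.

Variable IM' : G -> T'.
Hypothesis IM'_rel : forall m : G, nonneg m -> m k1 0 = 0 -> corr (IM m) (IM' m).
Hypothesis IM'_pt : forall m : G, nonneg m -> m k1 0 = 0 ->
  exists g, ptd C' g (IM' m).

(** By [IM_top] and [corr_grade], the top layer of [IM' m] is the single monomial X^(ga m). The
    degree at which [IM' m] is pointed dominates [ga m], so it lies in that layer and equals
    [ga m]. *)
Lemma IM'_ptd m : nonneg m -> m k1 0 = 0 -> ptd C' (ga m) (IM' m).
Proof.
move=> m0 mk; have [g' [dg' cg']] := IM'_pt m0 mk; pose g := ga m.
have gk : g ka 0 = 0 by exact: ga_ka.
have r := IM'_rel m0 mk; have [dM cM] := IM_ptd m0.
have E0 : w' kap g = w kap g by rewrite -[in LHS](phi0 gk) w'0.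
have g1 h : w' kap h = w kap g -> cf (IM' m) h = (g == h)%:R.
  move=> Eh; apply/eqP; rewrite -subr_eq0 -(cf_X T') -cfB.
  apply/negP => /negP hn.
  have := @corr_grade _ _ (w kap g) (corrB r (corr_X gk)) _ h hn.
  rewrite Eh eqxx => H; apply: notF (H _) => x.
  rewrite cfB cf_X; case: (eqVneq g x) => [<- | gx]; first by rewrite cM subrr !eqxx.
  rewrite subr0 => /(IM_top m0 mk)[Ex | lt]; first by rewrite /g Ex eqxx in gx.
  by rewrite lt_eqF.
have le1 : w' kap g' <= w kap g.
  apply: (corr_grade_le r) => [h /dM hC|]; last by rewrite cg' oner_eq0.
  by have := kap_C hC; rewrite lamBr -/g; lia.
have : cf (IM' m) g != 0 by rewrite g1 // eqxx oner_eq0.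
move=> /dg' /kap_C'; rewrite lamBr E0 => le2.
have := cg'; rewrite g1; last by lia.
case: (eqVneq g g') => [Eg _ | _ /eqP]; first by rewrite -/g Eg.
by rewrite eq_sym oner_eq0.
Qed.

(** * Standard elements and multiplication by X_k(t') *)

Lemma phiV_D x a : a ka 0 = 0 -> phiV (x + a) = phiV x + a.
Proof.
by move=> a0; rewrite /phiV /psi !mxE a0 addr0; case: ifP => _; vring.
Qed.

(** Multiplication by X_k(t') shifts degrees in t' by f_k; this is the same shift on the labels of
    [L], where it is only piecewise linear. *)
Definition tau (g : G) : G := phiV (phi g + fv ka).

Lemma tau_D x a : a ka 0 = 0 -> tau (x + a) = tau x + a.
Proof. by move=> a0; rewrite /tau (phiD _ a0) addrAC (phiV_D _ a0). Qed.

Lemma tau_pos g : 0 < g ka 0 -> tau g = g + p + b.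
Proof.
move=> g0; rewrite /tau /phiV mxE phi_ka fv_ka (_ : 0 < _ = false); last first.
  by move: (g ka 0) g0 => u; lia.
by rewrite /phi (ltW g0); bring.
Qed.

Lemma tau_neg g : g ka 0 <= 0 -> tau g = g + p.
Proof.
move=> g0; rewrite /tau /phiV mxE phi_ka fv_ka (_ : 0 < _); last first.
  by move: (g ka 0) g0 => u; lia.
have -> : phi g = psi g.
  rewrite /phi; case: ifP => // g1.
  have g00 : g ka 0 = 0 by apply/eqP; rewrite eq_le g0.
  by rewrite psi0 // g00 scale0r addr0.
by rewrite psiD psiK /psi fv_ka; vring.
Qed.

Lemma w_tau g a : a ka 0 = 0 -> w (tau g) a = w (g + p) a.
Proof.
move=> a0; have [g0 | g0] := ltrP 0 (g ka 0); last by rewrite tau_neg.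
by rewrite tau_pos // lamDl wb a0 mulr0 addr0.
Qed.

(* The left factors S of the standard elements, with their expansion S' in t';
   the last clause computes X_k(t') * S. *)
Definition sdata h0 S (S' : T') := [/\ S = L h0, corr S S', ptd C' (phi h0) S',
  forall x, cf S x != 0 -> exists n, x = h0 + b *+ n &
  exists c h1, [/\ im c, forall a : G, a ka 0 = 0 -> w h1 a = w (h0 + p) a &
    vp (- w' (fv ka) (phi h0)) *: (x1 * S) = L (tau h0) + c *: L h1]].

Lemma psi_fv : psi (fv ka) = p.
Proof. by rewrite /psi fv_ka; vring. Qed.

(** The exchange relation gives two monomials of t. After normalization the one of degree [tau h0]
    has coefficient 1 and the other v^(- d h0_k), in m because h0_k > 0; this positivity also keeps
    both exponents nonnegative at k. *)
Lemma sdata_pos h0 : 0 < h0 ka 0 -> (forall l, uf l -> 0 <= h0 l 0) ->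
  exists S', sdata h0 (qX T h0) S'.
Proof.
move=> k0 hp; have [y ry py] := lift_up (ltW k0).
have hp2 (a : G) l : nonneg a -> uf l -> 0 <= (h0 + a - fv ka) l 0.
  move=> ap ul; rewrite !mxE andbT; have [-> | lk] := eqVneq l ka.
    by have := ap ka; move: (h0 ka 0) k0 (a ka 0) => u u0 v; lia.
  by have := ap l; have := hp _ ul; move: (h0 l 0) (a l 0) => u v; lia.
exists y; split=> //; first by rewrite L_X.
  move=> x; rewrite cf_X; have [<- _ | _] := eqVneq h0 x; last by rewrite eqxx.
  by exists 0%N; rewrite mulr0n addr0.
exists (vp (- (d * h0 ka 0))), (h0 + p); split=> //.
  by apply: im_vp; rewrite oppr_lt0 mulr_gt0.
rewrite tau_pos //.
have -> : h0 + p = h0 + bm - fv ka by bring.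
have -> : h0 + bm - fv ka + b = h0 + bp - fv ka by bring.
rewrite !L_X => [|l|l]; [|exact: hp2|exact: hp2].
rewrite mulrDl !qXM scalerDr !scalerA !vpD addrC.
have -> : p + b + h0 = h0 + bp - fv ka by bring.
have -> : p + h0 = h0 + bm - fv ka by bring.
rewrite w'E psi_fv psi_phi max_l ?(ltW k0) // lamDr lamZr w_pb lamDl wb.
congr (_ + _).
  by rewrite -[RHS]scale1r -vp0; congr (vp _ *: _); ring.
by congr (vp _ *: _); ring.
Qed.

(** Here the product with X_k(t') is a single monomial of t', again in [L] by [lift_L], so the error
    term is zero. *)
Lemma sdata_lift h : (forall l, uf l -> 0 <= h l 0) ->
  exists S, sdata (psi h) S (qX T' h).
Proof.
move=> hp; have hk := hp _ uf_ka; have [S [rS pS bS sS]] := lift_down hk.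
have pk : (psi h) ka 0 <= 0 by rewrite psi_ka oppr_le0.
have Eh : phi (psi h) = h.
  rewrite /phi; case: ifP => g1; last exact: psiK.
  have g00 : (psi h) ka 0 = 0 by apply/eqP; rewrite eq_le pk.
  rewrite g00 scale0r addr0; apply: psi0.
  by move: g00; rewrite psi_ka; move: (h ka 0) => u; lia.
exists S; split=> //; first exact: lift_L.
  by rewrite Eh; exact: ptd_X.
exists 0, (psi h + p); split=> //; first exact: im0.
rewrite scale0r addr0 tau_neg // Eh.
have -> : psi h + p = psi (h + fv ka) by rewrite psiD psi_fv.
apply: lift_L => [l ul|].
  by rewrite mxE addr_ge0 ?hp // mxE; case: (_ && _).
have -> : qX T' (h + fv ka) = vp (- w' (fv ka) h) *: (qX T' (fv ka) * qX T' h).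
  by rewrite qXM scalerA vpD addNr vp0 scale1r addrC.
by apply/corrZ/corrM => //; exact: corr_x1.
Qed.

Lemma std_elt g : exists P P', [/\ tri C L g P, ptd C g P, corr P P',
  ptd C' (phi g) P' & (forall h, w kap h = w kap g -> br (cf P h) = cf P h) /\
  inM L (vp (- w' (fv ka) (phi g)) *: (x1 * P) - L (tau g))].
Proof.
(* [m] avoids [k1] and makes the remaining exponent nonnegative away from k. The remainder is formed
   in M(t) if g_k > 0, and otherwise in M(t') from [phi g], whose k-th coordinate has the opposite
   sign. *)
have [h0 [m [S [S' [m0 mk Eg sd]]]]] : exists h0 m S S',
    [/\ nonneg m, m k1 0 = 0, g = h0 + ga m & sdata h0 S S'].
  have [gpos | gneg] := ltrP 0 (g ka 0).
    have [m [m0 mk mg]] := ga_sub_ka g; have gk := ga_ka m0 mk.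
    have k0 : 0 < (g - ga m) ka 0 by rewrite !mxE gk subr0.
    have [l ul|S' sd] := sdata_pos k0.
      by have [-> | lk] := eqVneq l ka; [exact: ltW | exact: mg].
    by exists (g - ga m), m, (qX T (g - ga m)), S'; split=> //; rewrite subrK.
  have [m [m0 mk mg]] := ga_sub_ka (phi g); have gk := ga_ka m0 mk.
  have [l ul|S sd] := @sdata_lift (phi g - ga m).
    have [-> | lk] := eqVneq l ka; last exact: mg.
    by rewrite !mxE gk subr0 phi_ka oppr_ge0.
  exists (psi (phi g - ga m)), m, S, (qX T' (phi g - ga m)); split=> //.
  rewrite -{2}(psi0 gk) -psiD subrK psi_phi max_r //.
  by rewrite scale0r addr0.
have gk := ga_ka m0 mk; have [ES rS pS sS [c [h1 [mc wh1 ex]]]] := sd.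
have bS : qbar S = S by rewrite ES.
have tS : tri C L h0 S by rewrite ES; exact: tri_L.
have pSC : ptd C h0 S by rewrite ES.
have wg : w' (phi h0) (ga m) = w h0 (ga m).
  by rewrite lamC w'0 // -lamC.
exists (vp (- w h0 (ga m)) *: (S * IM m)), (vp (- w h0 (ga m)) *: (S' * IM' m)).
split.
- by rewrite Eg; exact: IM_right.
- by rewrite Eg; apply: ptdM pSC (IM_ptd m0).
- by apply/corrZ/corrM/IM'_rel.
- by rewrite Eg phiD // -wg; apply: ptdM pS (IM'_ptd m0 mk).
split.
  move=> h Eh.
  (* In the top layer only the leading monomial of [IM m] counts. It commutes with X^b, so one power
     of v normalizes the whole string carrying [S], and bar-invariance is inherited from [S]. *)
  have E0 : cf (S * IM m) h = cf (S * qX T (ga m)) h.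
    apply/eqP; rewrite -subr_eq0 -cfB -mulrBr; apply/negP => /negP.
    move=> /cfM_neq0[x [/sS[n En]]]; rewrite cfB cf_X.
    have [<- | gx] := eqVneq (ga m) (h - x); first by rewrite (IM_ptd m0).2 subrr eqxx.
    rewrite subr0 => /(IM_top m0 mk)[Ex | lt]; first by rewrite Ex eqxx in gx.
    by move: lt; rewrite lamBr Eh Eg En !lamDr lamMnr w_kap_b mul0rn; lia.
  rewrite cfZ E0 cf_MX mulrA vpD.
  have [-> | Sh] := eqVneq (cf S (h - ga m)) 0; first by rewrite mulr0 br0.
  have [n En] := sS _ Sh; rewrite En lamDl lamMnl wb gk mulr0 mul0rn addr0 addNr vp0.
  by rewrite mul1r -En -[in LHS]cf_bar bS.
have wpg : w' (fv ka) (ga m) = w p (ga m) by rewrite w'E psi_fv (psi0 gk).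
have t1 := (IM_right m0 (tri_L Lpt (tau h0))).2.
(* [h1] and [tau h0] both pair with [ga m] as [h0 + p] does, so the same power of v normalizes the
   main term and the error term. *)
have [z [ze zm]] : exists z, vp (- w h1 (ga m)) *: (L h1 * IM m) = z + L (h1 + ga m) /\ inM L z.
  have [_ H] := IM_right m0 (tri_L Lpt h1).
  by eexists; split; last exact: H; rewrite subrK.
have -> : vp (- w' (fv ka) (phi g)) *: (x1 * (vp (- w h0 (ga m)) *: (S * IM m))) - L (tau g) =
   (vp (- w (tau h0) (ga m)) *: (L (tau h0) * IM m) - L (tau h0 + ga m)) +
   (c *: z + c *: L (h1 + ga m)).
  rewrite -scalerDr -ze Eg phiD // tau_D // [in RHS]addrAC; congr (_ - _).
  have -> : vp (- w' (fv ka) (phi h0 + ga m)) *: (x1 * (vp (- w h0 (ga m)) *: (S * IM m))) =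
    vp (- w p (ga m) - w h0 (ga m)) *: ((vp (- w' (fv ka) (phi h0)) *: (x1 * S)) * IM m).
    rewrite -scalerAr mulrA -scalerAl !scalerA !vpD lamDr wpg; congr (vp _ *: _).
    by ring.
  rewrite ex mulrDl scalerDr -scalerAl !scalerA; congr (_ *: _ + _ *: _).
    by congr (vp _); rewrite w_tau // lamDl; ring.
  by rewrite mulrC; congr (_ * vp _); rewrite wh1 // lamDl; ring.
apply: inMD t1 _; apply: inMD; [exact: inMZ | exact: inM_L].
Qed.

(** * Dominance in t' of the transported basis *)

Lemma sum_neq0 (V : zmodType) (I : eqType) (s : seq I) (P : pred I) (f : I -> V) :
  \sum_(l <- s | P l) f l != 0 -> exists l, [/\ l \in s, P l & f l != 0].
Proof.
move=> ne; have /hasP[l ls /andP[pl fl]] : has (fun l => P l && (f l != 0)) s.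
  apply: contraNT ne => /hasPn all0; rewrite big_seq_cond big1 // => l /andP[ls pl].
  by apply/eqP; have := all0 l ls; rewrite pl negbK.
by exists l.
Qed.

Lemma Lp_bar g : qbar (Lp g) = Lp g.
Proof.
by apply: corr_injr (Lp_rel g); have := corr_bar (Lp_rel g); rewrite Lbar.
Qed.

Lemma L_kap g h : cf (L g) h != 0 -> w kap h <= w kap g.
Proof. by move=> /((Lpt g).1)/kap_C; rewrite lamBr; lia. Qed.

(** In the top layer [P] and [L g] are both bar-invariant, so the coefficients there satisfy c = bar
    c and, lying in m, vanish. The two elements thus agree in that layer, and [corr_grade] moves the
    agreement to t'. *)
Lemma std_exp g : exists P' (s : seq G) (c : G -> R), [/\ uniq s, ptd C' (phi g) P',
  P' = Lp g + \sum_(h <- s) c h *: Lp h, (forall h, im (c h)) &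
  forall h, c h != 0 -> w kap h < w kap g] /\
  forall h, w' kap h = w kap g -> cf (Lp g) h = cf P' h.
Proof.
have [P [P' [[dP [c cz mc]] pP rP pP' [bP _]]]] := std_elt g.
have dPL : domin C g (P - L g) := dominB dP (Lpt g).1.
have cC := coord_domin Lpt cz dPL; have [s [us cs Es]] := cz.
have ck h : c h != 0 -> w kap h <= w kap g.
  by move=> /cC/kap_C; rewrite lamBr; lia.
pose top := [seq h <- s | w kap h == w kap g].
have Etop x : w kap x = w kap g ->
    cf (P - L g) x = \sum_(h <- top) c h * cf (L h) x.
  move=> Ex; rewrite Es cf_sum /top big_filter [RHS]big_mkcond.
  apply: eq_bigr => h _; rewrite cfZ; case: eqP => // ne.
  have [-> | /ck le] := eqVneq (c h) 0; first by rewrite mul0r.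
  have [-> | /L_kap] := eqVneq (cf (L h) x) 0; first by rewrite mulr0.
  by rewrite Ex; lia.
have c0 h : w kap h = w kap g -> c h = 0.
  move=> Eh; apply/eqP/contraT => ch; exfalso.
  have hs : h \in top by rewrite mem_filter Eh eqxx cs.
  (* [U] is empty here: truncated to the top layer the [L h] are still unitriangular, so all
     [c h - br (c h)] vanish. *)
  apply: (@cone_family _ C R _ top (fun h => c h - br (c h)) id
    (fun h x => if w kap x == w kap g then cf (L h) x else 0) (fun=> False)
    _ _ _ _ _ _ h hs).
  - exact: filter_uniq.
  - by [].
  - by move=> l; rewrite mem_filter => /andP[-> _]; rewrite (Lpt l).2.
  - move=> l _ x; case: ifP => _; last by rewrite eqxx.
    exact: (Lpt l).1.
  - by [].
  - move=> x; case: (eqVneq (w kap x) (w kap g)) => Ex; last first.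
      by rewrite big1 ?eqxx // => l _; rewrite mulr0.
    under eq_bigr do rewrite mulrBl.
    rewrite sumrB -Etop // -[X in _ - X](_ : br (cf (P - L g) x) = _).
      by rewrite cfB brD brN bP // -[br (cf (L g) x)]cf_bar Lbar subrr eqxx.
    rewrite Etop // br_sum; apply: eq_bigr => l _.
    by rewrite brM -[br (cf (L l) x)]cf_bar Lbar.
  by apply: contraNneq ch => /subr0_eq E1; rewrite (im_br (mc h)).
exists P', s, c; split.
  split=> // [|h ch]; last by rewrite lt_neqAle ck // andbT; apply: contraNneq ch => /c0 ->.
  apply: (corr_injr rP); rewrite -[P](subrK (L g)) addrC Es; apply: corrD (Lp_rel g) _.
  elim: (s) => [|h s' IH]; first by rewrite !big_nil; exact: corr0.
  by rewrite !big_cons; apply: corrD IH; exact: corrZ.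
move=> h Eh; apply/eqP; rewrite eq_sym -subr_eq0 -cfB; apply/negP => /negP hn.
have := @corr_grade _ _ (w kap g) (corrB rP (Lp_rel g)) _ h hn.
rewrite Eh eqxx => H; apply: notF (H _) => x.
case: (eqVneq (w kap x) (w kap g)) => // /Etop ->.
rewrite big_seq big1 ?eqxx // => l; rewrite mem_filter => /andP[/eqP/c0 -> _].
by rewrite mul0r.
Qed.

Lemma Lp_kap g h : cf (Lp g) h != 0 -> w' kap h <= w kap g.
Proof. by apply: (corr_grade_le (Lp_rel g)) => x; exact: L_kap. Qed.

Lemma Lp_top g h : w' kap h = w kap g -> cf (Lp g) h != 0 -> cone C' (h - phi g).
Proof.
have [P' [s [c [[_ pP _ _ _] EP]]]] := std_exp g.
by move=> /EP ->; exact: pP.1.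
Qed.

Lemma Lp_lead g : cf (Lp g) (phi g) = 1.
Proof.
have [P' [s [c [[_ pP _ _ _] EP]]]] := std_exp g.
by rewrite EP ?pP.2 // w'0.
Qed.

(* Expanding P' - bar P' in the basis shows, degree by degree, that only basis
   elements dominated by phi g occur in P'. *)
Lemma Lp_domin g : domin C' (phi g) (Lp g).
Proof.
suff H n : forall g h, cf (Lp g) h != 0 -> w kap g - w' kap h < n%:Z -> cone C' (h - phi g).
  move=> h hn; apply: (H `|w kap g - w' kap h|.+1 g h hn); lia.
elim: n => [|n IH] {}g h hn lt; first by have := Lp_kap hn; lia.
have [P' [s [c [[us pP EP mc clt] _]]]] := std_exp g.
(* A second induction, on the depth of a basis element below the top layer, bounds the labels
   occurring in [P']; the outer one bounds the terms of the shallower elements. *)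
have inner m : (m <= n)%N -> forall h, h \in s -> c h != 0 ->
    w kap g - w kap h <= m%:Z -> cone C' (phi h - phi g).
  elim: m => [_ x _ /clt|m IHm mn x xs cx lx]; first by lia.
  have [le | lt1] := lerP (w kap g - w kap x) m%:Z; first by apply: IHm => //; exact: ltnW.
  pose l := w kap g - m.+1%:Z; have El : w kap x = l by rewrite /l; lia.
  apply: (@cone_family _ C' R _ [seq a <- s | w kap a == l] (fun h => c h - br (c h)) phi
    (fun h x => if w' kap x == l then cf (Lp h) x else 0) (fun x => cone C' (x - phi g))
    _ _ _ _ _ _ x).
  - exact: filter_uniq.
  - by move=> y1 y2 _ _; exact: phi_inj.
  - move=> y; rewrite mem_filter => /andP[/eqP ly _].
    by rewrite w'0 // ly eqxx Lp_lead.
  - move=> y; rewrite mem_filter => /andP[/eqP ly _] z.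
    by case: (eqVneq (w' kap z) l) => E1; [apply: Lp_top; rewrite ly | rewrite eqxx].
  - by move=> y z yg zy; exact: cone_trans zy yg.
  - move=> z; case: (eqVneq (w' kap z) l) => Ez; last first.
      by rewrite big1 ?eqxx // => y _; rewrite mulr0.
    have E1 : cf (P' - qbar P') z = \sum_(a <- s) (c a - br (c a)) * cf (Lp a) z.
      rewrite EP barD Lp_bar bar_sum opprD addrACA subrr add0r -sumrB cf_sum.
      by apply: eq_bigr => y _; rewrite barZ Lp_bar -scalerBl cfZ.
    rewrite big_filter => ne.
    (* If [z] does not survive in [P' - qbar P'], layer [l] cancels at [z] against some [y] of
       another layer. As [z] occurs in [Lp y], that layer is higher, and the two inductions put [z]
       below [phi y] and [phi y] below [phi g]. *)
    have [E2 | E2] := eqVneq (cf (P' - qbar P') z) 0; last first.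
      exact: (dominB pP.1 (domin_bar pP.1)) _ E2.
    move: E1; rewrite E2 (bigID (fun y : G => w kap y == l)) /= => /eqP.
    rewrite eq_sym addr_eq0 => /eqP E1; rewrite E1 oppr_eq0 in ne.
    have [y [ys ly ny]] := sum_neq0 ne.
    have cy : c y != 0.
      by apply: contraNneq ny => ->; rewrite br0 subr0 mul0r.
    have ly2 : cf (Lp y) z != 0 by apply: contraNneq ny => ->; rewrite mulr0.
    have k1y := Lp_kap ly2; have k2y := clt _ cy.
    have zy : cone C' (z - phi y).
      apply: IH => //; rewrite Ez /l.
      by move: (w kap y) (w kap g) k2y mn => u v; clear; lia.
    apply: cone_trans zy _; apply: IHm => //; first exact: ltnW.
    move: k1y ly; rewrite Ez /l.
    by move: (w kap y) (w kap g) => u v; clear => le /eqP ne; lia.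
  - by rewrite mem_filter El eqxx.
  by apply: contraNneq cx => /subr0_eq E1; rewrite (im_br (mc x)).
(* A term of [Lp g] comes from [P'], pointed at [phi g], or from some [Lp y] of smaller kap-degree,
   to which both inductions apply. *)
have := EP => /(congr1 (fun y => cf y h)); rewrite cfD cf_sum => E1.
have [E2 | E2] := eqVneq (cf P' h) 0; last exact: pP.1.
have : \sum_(a <- s) cf (c a *: Lp a) h != 0.
  by apply: contraNneq hn => E3; move: E1; rewrite E2 E3 addr0 => <-.
move=> /sum_neq0[y [ys _]]; rewrite cfZ => ny.
have cy : c y != 0 by apply: contraNneq ny => ->; rewrite mul0r.
have ly : cf (Lp y) h != 0 by apply: contraNneq ny => ->; rewrite mulr0.
have k1y := Lp_kap ly; have k2y := clt _ cy.
apply: (@cone_trans _ C' _ (phi y)); first by apply: IH => //; lia.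
by apply: (inner n) => //; lia.
Qed.

Lemma Lp_ptd g : ptd C' (phi g) (Lp g).
Proof. by split; [exact: Lp_domin | exact: Lp_lead]. Qed.

(** * The triangular basis properties for t' *)

Definition Lm (g : G) : T' := Lp (phiV g).

Lemma Lm_ptd g : ptd C' g (Lm g).
Proof. by rewrite -[g in ptd _ g](phiVK g); exact: Lp_ptd. Qed.

Lemma Lm_bar g : qbar (Lm g) = Lm g.
Proof. exact: Lp_bar. Qed.

Lemma coords_rel z y (e : G -> R) : coords L z e -> corr z y ->
  coords Lm y (fun g => e (phiV g)).
Proof.
move=> [s [us es ->]] r; exists (map phi s); split.
- by rewrite map_inj_uniq //; exact: phi_inj.
- by move=> h /es; rewrite -[X in _ -> X \in _](phiVK h) mem_map //; exact: phi_inj.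
apply: corr_injr r _; rewrite big_map; elim: (s) => [|h s' IH].
  by rewrite !big_nil; exact: corr0.
by rewrite !big_cons /Lm phiK; apply: corrD IH; exact/corrZ/Lp_rel.
Qed.

Lemma inM_rel z y : inM L z -> corr z y -> inM Lm y.
Proof. by move=> [e ez me] /(coords_rel ez) ey; exists (fun g => e (phiV g)). Qed.

(** For l <> k the relation is carried over from t, X_l being common. For l = k, [op_transfer] asks
    only about the standard elements; products stay in the span because X_k(t') is itself a basis
    element. *)
Lemma Lm_X (l : 'I_N) g :
  inM Lm (vp (- w' (fv l) g) *: (qX T' (fv l) * Lm g) - Lm (g + fv l)).
Proof.
have [-> | lk] := eqVneq l ka.
  apply: (op_transfer Lm_ptd (F := fun y => qX T' (fv ka) * y)).
  - by move=> z1 z2; exact: mulrDr.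
  - by move=> c z1; rewrite scalerAr.
  - by move=> h z1 dz; rewrite addrC; apply: dominM dz; exact: (ptd_X T' C' _).1.
  - move=> h1 h2 hC; rewrite -subr_le0 -lamBr; apply: coneW' => // l' _.
    by rewrite mxE; case: (_ && _).
  - move=> h; have [g1] := adm_X 1; rewrite mulr1n => r1.
    have [e er] := inAM (inA_L g1) (inA_L (phiV h)).
    by eexists; apply: coords_rel er _; exact: corrM r1 (Lp_rel _).
  move=> h; have [P [P' [[_ mP] _ rP pP' [_ mxP]]]] := std_elt (phiV h).
  rewrite phiVK in pP' mxP; exists P'; split=> //.
    by apply: inM_rel mP _; apply/corrB/Lp_rel.
  apply: inM_rel mxP _; rewrite /tau phiVK; apply: corrB (Lp_rel _).
  by apply/corrZ/corrM => //; exact: corr_x1.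
have f0 : (fv l : G) ka 0 = 0 by rewrite mxE eq_sym (negPf lk).
apply: inM_rel (LX l (phiV g)) _; rewrite -w'0 // phiVK; apply: corrB.
  by apply/corrZ/corrM/Lp_rel; exact: corr_X.
by rewrite -phiV_D //; exact: Lp_rel.
Qed.

Lemma mono_X' m : nonneg m -> exists g, corr (L g) (qX T' m).
Proof.
move=> m0; have [z [rz _ _ _]] := lift_down (m0 ka).
by exists (psi m); rewrite -(lift_L _ rz).
Qed.

Variable w1' : qform N.
Hypothesis IM'_M : forall m1 m2, nonneg m1 -> nonneg m2 ->
  IM' m1 * IM' m2 = vp (w1' m1 m2) *: IM' (m1 + m2).
Hypothesis adm_I : forall n : nat, exists g, corr (L g) (IM' (fv k1 *+ n)).

(** The power of I_k(t') is a basis element by admissibility, and the other factor corresponds to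
    [IM a], so [IM_right] applies. The factors quasi-commute, and leading coefficients identify [e]
    with [w g (ga a)]; hence the normalized product is bar-invariant. *)
Lemma mono_IM' m : nonneg m -> exists g, corr (L g) (IM' m).
Proof.
move=> m0; case Ek : (m k1 0) (m0 k1) => [n|//] _.
pose a := m - fv k1 *+ n; have Em : m = fv k1 *+ n + a by rewrite addrC subrK.
have a0 : a k1 0 = 0 by rewrite /a !mxE mulmxnE !mxE !eqxx Ek; lia.
have ag : nonneg a.
  move=> l; have [-> | lk] := eqVneq l k1; first by rewrite a0.
  by have := m0 l; rewrite /a !mxE mulmxnE !mxE (negPf lk) mul0rn subr0.
have fg := nonneg_fv k1 n; have [g rg] := adm_I n.
have rI := IM'_rel ag a0; pose e := w1' (fv k1 *+ n) a.
have rm : corr (vp (- e) *: (L g * IM a)) (IM' m).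
  have -> : IM' m = vp (- e) *: (IM' (fv k1 *+ n) * IM' a).
    by rewrite IM'_M // scalerA vpD addNr vp0 scale1r -Em.
  exact/corrZ/corrM.
have comm : L g * IM a = vp (e + e) *: (IM a * L g).
  apply: corr_injl (corrM rg rI) _.
  have -> : IM' (fv k1 *+ n) * IM' a = vp (e + e) *: (IM' a * IM' (fv k1 *+ n)).
    rewrite !IM'_M // scalerA vpD [a + _]addrC; congr (vp _ *: _).
    by rewrite (lamC _ _ a) /e; ring.
  by apply/corrZ/corrM.
have [dL cL] := Lpt g; have [dI cI] := IM_ptd ag.
have Ee : e = w g (ga a).
  have := domin_lead dL dI; rewrite comm cfZ [g + _]addrC (domin_lead dI dL) cL cI !mulr1 vpD.
  by move=> /vp_inj; rewrite (lamC w g); lia.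
exists (g + ga a); rewrite -(tri_eq_L Lpt Lbar (IM_right ag (tri_L Lpt g))) -Ee //.
rewrite barZ br_vp opprK barM Lbar IM_L // Lbar -IM_L // comm scalerA vpD.
by rewrite addKr.
Qed.

Lemma mutated_triangular :
  [/\ forall g, ptd C' g (Lm g), forall g, qbar (Lm g) = Lm g,
      forall l g, inM Lm (vp (- w' (fv l) g) *: (qX T' (fv l) * Lm g) - Lm (g + fv l)),
      forall m, nonneg m -> exists g, corr (L g) (qX T' m)
    & forall m, nonneg m -> exists g, corr (L g) (IM' m)].
Proof.
split; [exact: Lm_ptd | exact: Lm_bar | exact: Lm_X | exact: mono_X' | exact: mono_IM'].
Qed.

End Mutation.

(** * The tori of quantum seeds *)

(** If [a < b] and [m] is the top exponent of [c], comparison at [m + b] forces the larger exponent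
    [m + b - a] in [c]. *)
Lemma laurent_reg (a b : int) (c : laurent) :
  a != b -> vpow a * c = vpow b * c -> c = 0.
Proof.
wlog ab : a b / a < b => [H ne E|_ E].
  have [lt | lt | Eab] := ltrgtP a b; first exact: H lt ne E.
    by apply: H lt _ (esym E); rewrite eq_sym.
  by rewrite Eab eqxx in ne.
apply: lcP => x; rewrite lc0; apply/eqP/contraT.
rewrite /lc mcoeff_neq0 => xc.
have [m mc mP] := seq_argmax (id : int -> int) xc.
have := congr1 (lc^~ (m + b)) E; rewrite !lc_vpowM addrK => E1.
have : m + b - a \in msupp (c : {malg int[int]}).
  by rewrite -mcoeff_neq0 -[_ @_ _]/(lc c _) E1 /lc mcoeff_neq0.
by move=> /mP /=; lia.
Qed.

Definition qlaurent : qcoef := @QCoef laurent vpow laurent_bar in_m vpow0 vpowD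
  lbarD lbarM lbar_vpow in_mD in_mN in_mM in_m_vpow in_m_vpowM in_m_bar laurent_reg.

Lemma twmul_basis (R : comNzRingType) (G : zmodType) (u : twist R G) a b :
  twmul u << 1 *g a >> << 1 *g b >> = u a b *: (<< 1 *g a + b >> : {malg R[G]}).
Proof.
apply/malgP => x; rewrite twmulUU mcoeffZ mcoeffU mcoeffU !mul1r.
by case: (_ == x); rewrite ?mulr1n ?mulr0n ?mulr1 ?mulr0.
Qed.

Lemma mcoeff_shift (R : comNzRingType) (G : zmodType) a (q : {malg R[G]}) x :
  (twmul (fun _ _ => 1) << 1 *g a >> q)@_x = q@_(x - a).
Proof.
pose u := @Twist R G (fun _ _ => 1) (fun _ _ _ => erefl) (fun _ => erefl) (fun _ => erefl).
rewrite -[fun _ _ => 1]/(twist_fun u) twmulUg raddf_sum /=.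
rewrite [in RHS](monalgE q) raddf_sum /=.
apply: eq_bigr => b _; rewrite mcoeffU mcoeffU mul1r mulr1.
congr (_ *+ nat_of_bool _); apply/eqP/eqP => [<-|->].
  by rewrite [a + _]addrC addrK.
by rewrite addrC subrK.
Qed.

Section SeedTorus.
Variables (nuf nf : nat) (t : qseed nuf nf).
Local Notation lattice := 'cV[int]_(nuf + nf).
Implicit Types (P Q : LP t) (m x : lattice).

Lemma quasi_lamC m x : lam_form (quasi t) x m = - lam_form (quasi t) m x.
Proof.
have -> : lam_form (quasi t) x m = ((x^T *m quasi t *m m)^T) 0 0 by rewrite mxE.
by rewrite /lam_form !trmx_mul trmxK quasi_skew mulNmx mulmxN mxE mulmxA.
Qed.

Definition seed_form : qform (nuf + nf) := QForm (@lam_formDr _ _ t) quasi_lamC.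

Definition scf (p : LP t) (m : lattice) : laurent := (coeffs p)@_m.

Lemma scfP p q : scf p =1 scf q -> p = q.
Proof. by move=> E; apply/malgP. Qed.

Lemma scfD p q m : scf (p + q) m = scf p m + scf q m.
Proof. exact: mcoeffD. Qed.

Lemma scfZ (c : laurent) p m : scf (c *: p) m = c * scf p m.
Proof. exact: mcoeffZ. Qed.

Lemma scf_X m x : scf (Xm t m) x = (m == x)%:R.
Proof. exact: mcoeffU. Qed.

Lemma scf_supp p m : (m \in (msupp (coeffs p) : seq _)) = (scf p m != 0).
Proof. by rewrite /scf mcoeff_neq0. Qed.

Lemma Xm0 : Xm t 0 = 1.
Proof. by []. Qed.

Lemma XmM m x : Xm t m * Xm t x = vpow (lam_form (quasi t) m x) *: Xm t (m + x).
Proof. exact: (twmul_basis (qtwist t)). Qed.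

Lemma scf_bar p m : scf (bar p) m = laurent_bar (scf p m).
Proof.
rewrite /bar /scf {1}/coeffs raddf_sum /=.
have -> : \sum_(i <- msupp (coeffs p))
     << laurent_bar (coeffs p)@_i *g i >>@_m =
   \sum_(i <- msupp (coeffs p)) laurent_bar << (coeffs p)@_i *g i >>@_m.
  apply: eq_bigr => i _; rewrite [LHS]mcoeffU [X in _ = laurent_bar X]mcoeffU; case: eqP => _; rewrite ?mulr1n //.
  by rewrite !mulr0n lbar0.
by rewrite -lbar_sum -raddf_sum /= -monalgE.
Qed.

Lemma scf_cprod m (q : LP t) x : scf (Defs.cprod (Xm t m) q) x = scf q (x - m).
Proof. exact: mcoeff_shift. Qed.

Lemma scf_uniq (p : LP t) : uniq (msupp (coeffs p) : seq _).
Proof. exact: fset_uniq. Qed.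

Definition seed_torus : qtorus qlaurent seed_form :=
  @QTorus qlaurent _ seed_form (LP t) scf
    (fun p => msupp (coeffs p)) (@Xm _ _ t) (@bar _ _ t)
    scf_uniq scf_supp scfP scfD scfZ scf_X Xm0 XmM scf_bar.
End SeedTorus.

Section SeedCone.
Variables (nuf nf : nat) (t : qseed nuf nf).
Local Notation lattice := 'cV[int]_(nuf + nf).
Local Notation lam := (lam_form (quasi t)).
Local Notation uf := (lshift nf).
Local Notation B := (exB t).

Lemma lam_exB : exists d : 'rV[int]_nuf, (forall k, 0 < d 0 k) /\
  forall n y, lam (B *m n) y = \sum_j d 0 j * n j 0 * y (uf j) 0.
Proof.
have [d [d_gt0 E]] := exB_quasi t; exists d; split=> // n y.
rewrite /lam_form trmx_mul -[_ *m B^T *m _]mulmxA E -mulmxA.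
rewrite -[y in LHS]vsubmxK mul_row_col mul0mx addr0 mul_diag_mx mxE.
by apply: eq_bigr => j _; rewrite !mxE mulrA [n j 0 * _]mulrC.
Qed.

Definition ufsum (S : pred 'I_nuf) : lattice := \sum_(j | S j) fvec (uf j).

Lemma ufsumE (S : pred 'I_nuf) j : ufsum S (uf j) 0 = (S j)%:R.
Proof.
rewrite summxE; have [Sj | Sj] := boolP (S j).
  rewrite (bigD1 j) //= big1 ?addr0; first by rewrite mxE !eqxx.
  by move=> l /andP[_ lj]; rewrite mxE eq_lshift eq_sym (negPf lj).
rewrite big1 // => l Sl; rewrite mxE eq_lshift; case: eqP => // E.
by rewrite E Sl in Sj.
Qed.

Definition in_cone (x : lattice) := exists n : 'cV[nat]_nuf, x = B *m natv n.

(** At B n this is the sum of d_j n_j with all d_j > 0, which makes it additive and zero on the cone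
    only at 0. *)
Definition height (x : lattice) : int := - lam (ufsum predT) x.

Lemma in_cone0 : in_cone 0.
Proof.
exists (const_mx 0%N); suff -> : natv (const_mx 0%N) = 0 :> 'cV[int]_nuf.
  by rewrite mulmx0.
by apply/colP => a; rewrite !mxE.
Qed.

Lemma in_coneD x y : in_cone x -> in_cone y -> in_cone (x + y).
Proof.
move=> [n ->] [m ->]; exists (\col_j addn (n j 0) (m j 0)); rewrite -mulmxDr; congr (_ *m _).
by apply/colP => a; rewrite !mxE.
Qed.

Lemma heightD x y : height (x + y) = height x + height y.
Proof. by rewrite /height lam_formDr opprD. Qed.

Lemma lam_cone a (n : 'cV[nat]_nuf) : exists2 d : 'I_nuf -> int, (forall j, 0 < d j) &
  - lam a (B *m natv n) = \sum_j d j * (n j 0)%:Z * a (uf j) 0.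
Proof.
have [d [d_gt0 E]] := lam_exB; exists (d 0) => //.
rewrite -quasi_lamC E; apply: eq_bigr => j _; by rewrite mxE.
Qed.

Lemma height_ge0 x : in_cone x -> 0 <= height x.
Proof.
move=> [n ->]; have [d d0 E] := lam_cone (ufsum predT) n; rewrite /height E.
by apply: sumr_ge0 => j _; rewrite ufsumE mulr1 mulr_ge0 // ltW.
Qed.

Lemma height_eq0 x : in_cone x -> height x = 0 -> x = 0.
Proof.
move=> [n ->]; have [d d0 E] := lam_cone (ufsum predT) n; rewrite /height E => /eqP.
rewrite psumr_eq0 => [|j _]; last by rewrite ufsumE mulr1 mulr_ge0 // ltW.
move=> /allP H; rewrite (_ : natv n = 0) ?mulmx0 //.
apply/colP => j; have := H j (mem_index_enum _).
by rewrite /= ufsumE mulr1 mulf_eq0 gt_eqF // orFb => /eqP; rewrite !mxE.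
Qed.

Definition seed_cone : qcone (nuf + nf) :=
  QCone in_cone0 in_coneD heightD height_ge0 height_eq0.

Lemma exB_natv_inj (n m : 'cV[nat]_nuf) : B *m natv n = B *m natv m -> n = m.
Proof.
move=> E; have [d [d_gt0 F]] := lam_exB; apply/colP => j.
have := congr1 (fun x => lam x (fvec (uf j))) E; rewrite !F.
have S (v : 'cV[nat]_nuf) :
    \sum_l d 0 l * natv v l 0 * fvec (uf j) (uf l) 0 = d 0 j * (v j 0)%:Z.
  rewrite (bigD1 j) //= big1 ?addr0 => [|l lj].
    by rewrite !mxE !eqxx mulr1.
  by rewrite [fvec _ _ _]mxE eq_lshift (negPf lj) mulr0.
by rewrite !S => /(mulfI (lt0r_neq0 (d_gt0 j))) [].
Qed.

Lemma dom_leP x y : dom_le t x y <-> in_cone (x - y).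
Proof.
split=> [[n ->] | [n E]]; exists n; first by rewrite [y + _]addrC addrK.
by rewrite -E addrC subrK.
Qed.

Lemma seed_coneW x (a : lattice) : in_cone x -> (forall j, 0 <= a (uf j) 0) -> lam a x <= 0.
Proof.
move=> [n ->] a0; have [d d0 E] := lam_cone a n; rewrite -oppr_ge0 E.
by apply: sumr_ge0 => j _; rewrite !mulr_ge0 // ltW.
Qed.

(** At x = B n the pairing is minus the sum of d_j n_j over j <> k; its vanishing leaves only
    n_k. *)
Lemma seed_kap_C0 k x : in_cone x -> lam (ufsum (predC1 k)) x = 0 ->
  exists n, x = col k B *+ n.
Proof.
move=> [n ->] l0; have [d d0 E] := lam_cone (ufsum (predC1 k)) n.
exists (n k 0); move: E; rewrite l0 oppr0 => /esym/eqP.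
rewrite psumr_eq0 => [|j _]; last by rewrite ufsumE !mulr_ge0 ?ler0n // ltW.
move=> /allP H; apply/colP => i; rewrite mulmxnE !mxE (bigD1 k) //= big1 ?addr0.
  by rewrite !mxE -mulr_natr natz.
move=> j jk; have := H j (mem_index_enum _); rewrite /= ufsumE /= jk mulr1.
by rewrite mulf_eq0 gt_eqF // orFb !mxE => /eqP[->]; rewrite mulr0.
Qed.
End SeedCone.

Lemma malg_of_seq (R : comNzRingType) (K : choiceType) (V : lmodType R)
    (s : seq K) (e : K -> R) (f : K -> V) : uniq s ->
  exists c : {malg R[K]}, (forall k, c@_k = if k \in s then e k else 0) /\
  \sum_(k <- msupp c) c@_k *: f k = \sum_(k <- s) e k *: f k.
Proof.
move=> us; exists (\sum_(k <- s) << e k *g k >>).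
have E k : (\sum_(k <- s) << e k *g k >> : {malg R[K]})@_k = if k \in s then e k else 0.
  rewrite raddf_sum /=; case: ifPn => ks.
    rewrite (bigD1_seq k) //= mcoeffUU big1 ?addr0 // => l lk.
    by rewrite mcoeffU (negPf lk).
  rewrite big_seq big1 // => l ls; rewrite mcoeffU; case: eqP => // El.
  by rewrite -El ls in ks.
split=> //; set c := \sum_(k <- s) _.
rewrite [RHS](bigID (fun k => e k != 0)) /= [X in _ = _ + X]big1 ?addr0; last first.
  by move=> k; rewrite negbK => /eqP ->; rewrite scale0r.
rewrite -[RHS]big_filter.
have sE : perm_eq (msupp c) [seq k <- s | e k != 0].
  apply: uniq_perm; rewrite ?fset_uniq ?filter_uniq // => k.
  by rewrite mem_filter -mcoeff_neq0 E; case: ifP; rewrite ?eqxx ?andbT ?andbF.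
rewrite (perm_big _ sE) /= !big_filter big_seq_cond [RHS]big_seq_cond.
by apply: eq_bigr => k /andP[ks _]; rewrite E ks.
Qed.

(** The relation is boolean and [D] a choice type, so the selection is constructive; [b0] fills in
    outside [P]. *)
Lemma fun_choice (A : Type) (D : choiceType) (P : pred A) (Q : A -> pred D) :
  D -> (forall a, P a -> exists b, Q a b) -> exists f, forall a, P a -> Q a (f a).
Proof.
move=> b0 H; exists (fun a => match @decP (P a) _ idP with
  left h => xchoose (H a h) | right _ => b0 end).
by move=> a Pa; case: decP => // h; exact: (xchooseP (H a h)).
Qed.

Section SeedBasis.
Variables (nuf nf : nat) (t : qseed nuf nf).
Local Notation lattice := 'cV[int]_(nuf + nf).
Local Notation T := (seed_torus t).
Local Notation C := (seed_cone t).

Lemma natv0 : natv (const_mx 0%N) = 0 :> 'cV[int]_nuf.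
Proof. by apply/colP => a; rewrite !mxE. Qed.

Lemma scf_sum I (r : seq I) (P : pred I) (f : I -> LP t) m :
  scf (\sum_(i <- r | P i) f i) m = \sum_(i <- r | P i) scf (f i) m.
Proof. exact: (cf_sum (T := T)). Qed.

Lemma pointedP g (p : LP t) : pointed g p <-> ptd C g (p : T).
Proof.
split=> [[c [c0 Ep]] | [dp cp]].
  have E x : scf p x = (0 == x - g)%:R +
      \sum_(n <- msupp c) c@_n * (exB t *m natv n == x - g)%:R.
    rewrite Ep scf_cprod scfD -Xm0 scf_X scf_sum; congr (_ + _).
    by apply: eq_bigr => n _; rewrite scfZ scf_X.
  split; last first.
    rewrite -[LHS]/(scf p g) E subrr eqxx big_seq big1 ?addr0 // => n nc.
    have [E0 | _] := eqVneq; last by rewrite mulr0.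
    have E1 : exB t *m natv n = exB t *m natv (const_mx 0%N).
      by rewrite E0 natv0 mulmx0.
    by rewrite -(exB_natv_inj E1) nc in c0.
  move=> x; rewrite -[cf (p : T) x]/(scf p x) E; have [<- _ | _] := eqVneq 0 (x - g).
    exact: in_cone0.
  rewrite add0r => /sum_neq0[n [_ _]].
  have [<- _ | _] := eqVneq (exB t *m natv n) (x - g); first by exists n.
  by rewrite mulr0 eqxx.
(* For each degree of [p] its vector n is selected; the witness [c] is supported on those of the
   degrees other than [g]. *)
have [f fP] := @fun_choice lattice 'cV[nat]_nuf (fun x => scf p x != 0)
  (fun x n => x - g == exB t *m natv n) (const_mx 0%N)
  (fun x px => let: ex_intro n En := dp x px in ex_intro _ n (introT eqP En)).
have fE x : scf p x != 0 -> x = g + exB t *m natv (f x).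
  by move=> /fP/eqP <-; rewrite addrC subrK.
pose s : seq lattice := [seq x <- msupp (coeffs p) | x != g].
have sP x : x \in s -> x != g /\ scf p x != 0.
  by rewrite mem_filter scf_supp => /andP[].
have us : uniq (map f s).
  rewrite map_inj_in_uniq ?filter_uniq ?fset_uniq // => x y /sP[_ /fE Ex] /sP[_ /fE Ey] Exy.
  by rewrite Ex Ey Exy.
have [c [cE cS]] := malg_of_seq (fun n => scf p (g + exB t *m natv n))
   (fun n => Ym t (natv n)) us.
exists c; split.
  rewrite -mcoeff_eq0; apply/eqP; apply: (etrans (cE _)).
  case: ifP => [/mapP[x /sP[xg /fE Ex] E0] | _]; last by [].
  by move: xg; rewrite Ex -E0 natv0 mulmx0 addr0 eqxx.
apply: scfP => x; rewrite scf_cprod cS big_map scfD -Xm0 scf_X scf_sum.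
have -> : \sum_(y <- s) scf (scf p (g + exB t *m natv (f y)) *: Ym t (natv (f y))) (x - g)
    = \sum_(y <- s) scf p y * (y == x)%:R.
  rewrite big_seq [RHS]big_seq; apply: eq_bigr => y /sP[_ /fE Ey].
  have Efy : exB t *m natv (f y) = y - g by rewrite [in RHS]Ey addrC addKr.
  by rewrite scfZ scf_X -Ey Efy (inj_eq (addIr _)).
rewrite eq_sym subr_eq0; have [-> | xg] := eqVneq x g.
  rewrite [X in _ + X]big_seq [X in _ + X]big1 ?addr0; first exact: cp.
  by move=> y /sP[yg _]; rewrite (negPf yg) mulr0.
rewrite add0r; clear cp; have [px | px] := eqVneq (scf p x) 0.
  rewrite px big_seq big1; first by [].
  move=> y /sP[_ py]; have [Ey | _] := eqVneq y x; last by rewrite mulr0.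
  by rewrite Ey px eqxx in py.
rewrite (bigD1_seq x) /=; last 2 first.
- by rewrite mem_filter xg scf_supp.
- by rewrite filter_uniq ?fset_uniq.
rewrite eqxx mulr1 big1 ?addr0; first by [].
by move=> y yx; rewrite (negPf yx) mulr0.
Qed.

Lemma expand_coords (L : lattice -> LP t) (c : {malg laurent[lattice]}) :
  coords (L : lattice -> T) (expand L c) (mcoeff^~ c).
Proof.
exists (msupp c); split; [exact: fset_uniq | | by []].
by move=> h; rewrite mcoeff_neq0.
Qed.

Lemma coords_expand (L : lattice -> LP t) (z : LP t) (e : lattice -> laurent) :
  coords (L : lattice -> T) z e ->
  exists c : {malg laurent[lattice]}, z = expand L c /\ forall h, c@_h = e h.
Proof.
move=> [s [us es Ez]].
have [c [cE cS]] := malg_of_seq (V := T) e (L : lattice -> T) us.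
exists c; split; first (rewrite Ez -cS; reflexivity).
move=> h; apply: (etrans (cE h)); case: ifPn => [_ | hs]; first by [].
by apply/eqP; rewrite eq_sym; apply: contraNT hs => /es.
Qed.

(** The product is dominated by [g + fvec i], with coefficient v^lambda(f_i, g) there. This is
    therefore its unique maximal degree, and normalization is multiplication by the inverse
    power. *)
Lemma triangular_inM (L : lattice -> LP t) i g :
  (forall g, pointed g (L g)) ->
  (exists b : {malg laurent[lattice]},
      [/\ forall g', g' \in msupp b -> dom_lt t g' (g + fvec i),
          forall g', in_m b@_g'
        & normalization (Xv t i * L g) (L (g + fvec i) + expand L b)]) <->
  inM (L : lattice -> T) (vp qlaurent (- seed_form t (fvec i) g) *:
     ((qX T (fvec i) : T) * (L g : T)) - L (g + fvec i)).
Proof.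
move=> Lp; have Lpt h : ptd C h (L h : T) by apply/pointedP.
pose p : T := qX T (fvec i) * (L g : T); pose h := g + fvec i.
have dp : domin C h p.
  by rewrite /h addrC; apply: dominM (Lpt g).1; exact: (ptd_X T C _).1.
have cp : cf p h = vp qlaurent (seed_form t (fvec i) g).
  rewrite /h addrC (domin_lead (ptd_X T C _).1 (Lpt g).1).
  by rewrite (Lpt g).2 (ptd_X T C _).2 !mulr1.
have max_h : maximal_degree (p : LP t) h.
  split; first by have := vp_neq0 qlaurent (seed_form t (fvec i) g); rewrite -cp -suppE.
  move=> g'; rewrite -[_ \in _]/(g' \in supp p) suppE => /dp hg' [/dom_leP gh ne].
  by apply: ne; exact: (cone_anti (C := C)).
split=> [[b [_ mb [h' [max' uh' Ep]]]] | [e ee me]].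
  have Eh : h = h' := uh' _ max_h.
  rewrite -Eh in Ep; have cpe : (coeffs (Xv t i * L g))@_h = vp qlaurent (seed_form t (fvec i) g) := cp.
  rewrite cpe in Ep.
  have {}Ep : p = vp qlaurent (seed_form t (fvec i) g) *: ((L h : T) + (expand L b : T)) := Ep.
  exists (mcoeff^~ b); last exact: mb.
  rewrite -/p -/h Ep scalerA vpD addNr vp0 scale1r addrC addKr.
  exact: expand_coords.
have dpL : domin C h (vp qlaurent (- seed_form t (fvec i) g) *: p - (L h : T)).
  by apply: dominB (Lpt h).1; exact: dominZ.
have eC := coord_domin Lpt ee dpL.
have e0 : e h = 0.
  rewrite (coord_lead Lpt ee dpL) cfB cfZ cp (Lpt h).2 vpD addNr vp0 subrr.
  reflexivity.
have [b [Eb bE]] := coords_expand ee.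
exists b; split.
- move=> g'; rewrite -mcoeff_neq0 bE => eg; split; first exact/dom_leP/eC.
  by move=> Eg; move/eqP: eg; rewrite Eg e0.
- by move=> g'; rewrite bE; exact: me.
exists h; split.
- exact: max_h.
- move=> g' [g'p mg']; apply/eqP/contraT => /eqP ne; exfalso.
  apply: (mg' h max_h.1); split; last exact: ne.
  by apply/dom_leP/dp; rewrite -suppE.
have {}Eb : (expand L b : T) = vp qlaurent (- seed_form t (fvec i) g) *: p - (L h : T) := esym Eb.
have E2 : p = vp qlaurent (seed_form t (fvec i) g) *: ((L h : T) + (expand L b : T)).
  by rewrite Eb addrC subrK scalerA vpD subrr vp0 scale1r.
rewrite -[X in X *: _]/(cf p h) cp; exact: E2.
Qed.
End SeedBasis.

Section Generate.
Variables (R : qcoef) (N : nat) (w w' : qform N) (T : qtorus R w) (T' : qtorus R w').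
Local Notation G := 'cV[int]_N.
Variables (E : algType R) (i : qmorph T E) (j : qmorph T' E) (ka : 'I_N).
Hypothesis w'w : forall a a' : G, a ka 0 = 0 -> a' ka 0 = 0 -> w' a a' = w a a'.
Hypothesis j_fv : forall l, l != ka -> j (qX T' (delta_mx l 0)) = i (qX T (delta_mx l 0)).

Lemma qX_generate (a : G) : a ka 0 = 0 -> j (qX T' a) = i (qX T a).
Proof.
pose good (a : G) := a ka 0 = 0 /\ j (qX T' a) = i (qX T a).
have good0 : good 0 by split; rewrite ?mxE // !qX0 !qmor1.
have goodD a1 a2 : good a1 -> good a2 -> good (a1 + a2).
  move=> [z1 e1] [z2 e2]; split; first by rewrite mxE z1 z2.
  have H (W : qform N) (S : qtorus R W) (f : qmorph S E) :
      f (qX S (a1 + a2)) = vp R (- W a1 a2) *: (f (qX S a1) * f (qX S a2)).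
    by rewrite -qmorM qXM qmorZ scalerA vpD addNr vp0 scale1r.
  by rewrite !H e1 e2 w'w.
have goodN a1 : good a1 -> good (- a1).
  move=> [z1 e1]; split; first by rewrite mxE z1 oppr0.
  have H (W : qform N) (S : qtorus R W) (f : qmorph S E) a2 :
      f (qX S a2) * f (qX S (- a2)) = 1.
    by rewrite -qmorM qXM lamNr lamaa oppr0 vp0 scale1r subrr qX0 qmor1.
  rewrite -[LHS]mul1r -(H _ _ i (- a1)) opprK -e1 -mulrA H mulr1.
  reflexivity.
have goodMn a1 (n : nat) : good a1 -> good (a1 *+ n).
  by move=> g1; elim: n => [|n IH]; rewrite ?mulr0n // mulrS; exact: goodD.
move=> a0; suff [] : good a by [].
rewrite [a]matrix_sum_delta; apply: (big_ind good) => // l _; rewrite big_ord1.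
have [-> | lk] := eqVneq l ka; first by rewrite a0 scale0r.
have gl : good (delta_mx l 0) by split; [rewrite mxE eq_sym (negPf lk) | exact: j_fv].
case: (a l 0) => n; first by rewrite -natz scaler_nat; exact: goodMn.
by rewrite NegzE scaleNr -natz scaler_nat; apply/goodN/goodMn.
Qed.
End Generate.

(** * Skew-fields and mutation maps as instances of the abstract setting *)

Section Fields.
Variables (nuf nf : nat) (F : cluster_fields nuf nf).
Local Notation lattice := 'cV[int]_(nuf + nf).
Local Notation uf := (lshift nf).
Implicit Types t : qseed nuf nf.

Lemma frac_dom t (x y : F t) : x * y = 0 -> x = 0 \/ y = 0.
Proof.
move=> xy; have [-> | x0] := eqVneq x 0; first by left.
by right; rewrite -[y](mulKr (frac_skew x0)) xy mulr0.
Qed.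

Definition emb_mor t : qmorph (seed_torus t) (F t) :=
  @QMorph qlaurent _ _ (seed_torus t) (F t) (emb (F t))
    (rmorphD (emb (F t))) (rmorphM (emb (F t))) (linearZZ (emb (F t)))
    (rmorph1 (emb (F t))).

Definition mu_mor t k : qmorph (seed_torus (mutate k t)) (F t) :=
  @QMorph qlaurent _ _ (seed_torus (mutate k t)) (F t)
    (fun z => mu F t k (emb (F (mutate k t)) z))
    (rmorphD (mu F t k \o emb (F (mutate k t))))
    (rmorphM (mu F t k \o emb (F (mutate k t))))
    (linearZZ (mu F t k \o emb (F (mutate k t))))
    (rmorph1 (mu F t k \o emb (F (mutate k t)))).

Section OneStep.
Variables (t : qseed nuf nf) (k : 'I_nuf).
Local Notation t' := (mutate k t).
Local Notation B := (exB t).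

Definition bplus : lattice := \col_i pos (B i k).
Definition bminus : lattice := \col_i pos (- B i k).

Lemma pos_ge0 x : 0 <= pos x.
Proof. by rewrite /pos le_max lexx orbT. Qed.

Lemma bplusB : col k B = bplus - bminus.
Proof. by apply/colP => i; rewrite !mxE /pos; lia. Qed.

Lemma exB_kk : B (uf k) k = 0.
Proof. exact: compatible_diag0 (quasi_skew t) (exB_quasi t) _. Qed.

Lemma mut_psi x y : seed_form t' x y =
  seed_form t (psi (uf k) (bminus - fvec (uf k)) x) (psi (uf k) (bminus - fvec (uf k)) y).
Proof.
pose P : 'M[int]_(nuf + nf) := \matrix_(i, j) mut_fvec B k j i 0.
have PE (v : lattice) : psi (uf k) (bminus - fvec (uf k)) v = P *m v.
  apply/colP => i; rewrite /psi !mxE !andbT.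
  have -> : \sum_j P i j * v j 0 =
      \sum_j (i == j)%:R * v j 0 + \sum_j (P i j - (i == j)%:R) * v j 0.
    by rewrite -big_split; apply: eq_bigr => j _; rewrite /= mulrBl addrC subrK.
  rewrite (bigD1 i) //= eqxx mul1r big1 ?addr0; last first.
    by move=> j ji; rewrite eq_sym (negPf ji) mul0r.
  rewrite (bigD1 (uf k)) //= big1 ?addr0; last first.
    by move=> j jk; rewrite mut_PE (negPf jk) subrr mul0r.
  by rewrite mut_PE eqxx; ring.
rewrite !PE /= /lam_form mutLamE -/P trmx_mul !mulmxA.
reflexivity.
Qed.

Lemma mut_col : in_cone t' (- col k B).
Proof.
exists (\col_j (j == k : nat)); apply/colP => i; rewrite !mxE (bigD1 k) //= big1 ?addr0.
  by rewrite !mxE eqxx orbT mulr1.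
by move=> j jk; rewrite !mxE (negPf jk) mulr0.
Qed.

Lemma col_cone : in_cone t (col k B).
Proof.
exists (\col_j (j == k : nat)); apply/colP => i; rewrite !mxE (bigD1 k) //= big1 ?addr0.
  by rewrite !mxE eqxx mulr1.
by move=> j jk; rewrite !mxE (negPf jk) mulr0.
Qed.

Lemma lam_col : exists2 d : int, 0 < d &
  forall y : lattice, seed_form t (col k B) y = d * y (uf k) 0.
Proof.
have [d [d0 E]] := lam_exB t; exists (d 0 k) => // y.
rewrite colE /= E (bigD1 k) //= big1 ?addr0; first by rewrite !mxE !eqxx mulr1.
by move=> j jk; rewrite mxE (negPf jk) mulr0 mul0r.
Qed.

Lemma mu_monomial (a : lattice) : a (uf k) 0 = 0 ->
  mu_mor t k (qX (seed_torus t') a) = emb_mor t (qX (seed_torus t) a).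
Proof.
apply: qX_generate => [a1 a2 z1 z2 | l lk].
  by rewrite mut_psi /psi z1 z2 !scale0r !addr0.
rewrite /= -[Xm _ _]/(Xv t' l) mu_var /mut_var (negPf lk).
reflexivity.
Qed.

Lemma mu_exchange : mu_mor t k (qX (seed_torus t') (delta_mx (uf k) 0)) =
  emb_mor t (qX (seed_torus t) (bminus - fvec (uf k)) +
             qX (seed_torus t) (bminus - fvec (uf k) + col k B)).
Proof.
rewrite /= -[Xm _ (delta_mx _ _)]/(Xv t' (uf k)) mu_var /mut_var eqxx.
have S (u : lattice) : \sum_j u j 0 *: fvec j = u.
  by rewrite [RHS]matrix_sum_delta; apply: eq_bigr => j _; rewrite big_ord1.
have -> : \sum_j pos (- B j k) *: fvec j = bminus.
  by rewrite -[RHS]S; apply: eq_bigr => j _; rewrite mxE.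
have -> : \sum_j pos (B j k) *: fvec j = bplus.
  by rewrite -[RHS]S; apply: eq_bigr => j _; rewrite mxE.
rewrite bplusB [- fvec _ + bminus]addrC; congr (emb _ (_ + Xm _ _)).
by vring.
Qed.
End OneStep.

Section Words.
Variable t0 : qseed nuf nf.
Implicit Types w s : seq 'I_nuf.

Lemma mu_inj t k : injective (mu F t k).
Proof. exact: can_inj (muK (c := F) (t := t) (k := k)). Qed.

Lemma mu_wordM w : {morph @mu_word _ _ F t0 w : x y / x * y}.
Proof. by elim: w => [|k w IH] x y //=; rewrite rmorphM IH. Qed.

Lemma mu_wordZ w c : {morph @mu_word _ _ F t0 w : x / c *: x}.
Proof. by elim: w => [|k w IH] x //=; rewrite linearZZ IH. Qed.

Lemma mu_word1 w : @mu_word _ _ F t0 w 1 = 1.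
Proof. by elim: w => [|k w IH] //=; rewrite rmorph1 IH. Qed.

Lemma mu_word_inj w : injective (@mu_word _ _ F t0 w).
Proof. by elim: w => [|k w IH] x y //= /IH/mu_inj. Qed.

Lemma muV_wordK w : cancel (@muV_word _ _ F t0 w) (@mu_word _ _ F t0 w).
Proof. by elim: w => [|k w IH] x //=; rewrite muVK IH. Qed.

Lemma mu_wordK w : cancel (@mu_word _ _ F t0 w) (@muV_word _ _ F t0 w).
Proof. by elim: w => [|k w IH] x //=; rewrite IH muK. Qed.

Lemma mu_starK s w z : mu_word (mu_star F t0 s w z) = mu_word z.
Proof. exact: muV_wordK. Qed.

Lemma mu_starM s w : {morph mu_star F t0 s w : x y / x * y}.
Proof. by move=> x y; apply: mu_word_inj; rewrite mu_wordM !mu_starK mu_wordM. Qed.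

Lemma mu_starZ s w c : {morph mu_star F t0 s w : x / c *: x}.
Proof. by move=> x; apply: mu_word_inj; rewrite mu_wordZ !mu_starK mu_wordZ. Qed.

Lemma mu_star1 s w : mu_star F t0 s w 1 = 1.
Proof. by apply: mu_word_inj; rewrite mu_starK !mu_word1. Qed.

Lemma mu_starX s w z n : mu_star F t0 s w (z ^+ n) = mu_star F t0 s w z ^+ n.
Proof.
by elim: n => [|n IH]; rewrite ?expr0 ?mu_star1 // !exprS mu_starM IH.
Qed.

Lemma mu_star_cons s w k z : mu F (seed t0 w) k (mu_star F t0 s (k :: w) z) =
  mu_star F t0 s w z.
Proof. by rewrite /mu_star /= muVK. Qed.

Lemma mu_star_frozen s w l : mu_star F t0 s w (emb (F (seed t0 s)) (Xv (seed t0 s) (rshift nuf l)))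
  = emb (F (seed t0 w)) (Xv (seed t0 w) (rshift nuf l)).
Proof.
apply: mu_word_inj; rewrite mu_starK.
have H v : mu_word (emb (F (seed t0 v)) (Xv (seed t0 v) (rshift nuf l))) =
    emb (F t0) (Xv t0 (rshift nuf l)).
  by elim: v => [|k v IH] //=; rewrite mu_var /mut_var eq_rlshift IH.
by rewrite !H.
Qed.
End Words.
End Fields.

(** * Mutation of triangular bases *)

Lemma lattice_ind (N : nat) (P : 'cV[int]_N -> Prop) :
  P 0 -> (forall m1 m2, nonneg m1 -> nonneg m2 -> P m1 -> P m2 -> P (m1 + m2)) ->
  (forall l, P (delta_mx l 0)) -> forall m, nonneg m -> P m.
Proof.
move=> P0 PD Pf m m0; suff [] : nonneg m /\ P m by [].
rewrite [m]matrix_sum_delta; apply: (big_ind (fun m => nonneg m /\ P m)).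
- by split=> // l; rewrite mxE.
- by move=> a b [a0 Pa] [b0 Pb]; split; [exact: nonnegD | exact: PD].
move=> l _; rewrite big_ord1; case: (m l 0) (m0 l) => n // _.
rewrite -natz scaler_nat; elim: n => [|n [IH1 IH2]].
  by rewrite mulr0n; split=> // i; rewrite mxE.
have f0 : nonneg (delta_mx l 0 : 'cV[int]_N) by have := nonneg_fv l 1; rewrite mulr1n.
by rewrite mulrS; split; [exact: nonnegD | exact: PD].
Qed.

Section SeedMutation.
Variables (nuf nf : nat) (F : cluster_fields nuf nf) (t0 : qseed nuf nf).
Local Notation lattice := 'cV[int]_(nuf + nf).
Local Notation uf := (lshift nf).
Local Notation e w := (emb (F (seed t0 w))).
Local Notation ST w := (seed_torus (seed t0 w)).
Local Notation SC w := (seed_cone (seed t0 w)).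
Implicit Types w s : seq 'I_nuf.

Lemma embM w (x y : LP (seed t0 w)) : e w (x * y) = e w x * e w y.
Proof. exact: rmorphM. Qed.

Lemma embZ w c (x : LP (seed t0 w)) : e w (c *: x) = c *: e w x.
Proof. exact: linearZZ. Qed.

Lemma mu_star_id w z : mu_star F t0 w w z = z.
Proof. exact: mu_wordK. Qed.

Lemma mu_star_Xm s w m1 m2 :
  mu_star F t0 s w (e s (Xm _ m1)) * mu_star F t0 s w (e s (Xm _ m2)) =
  vpow (lam_form (quasi (seed t0 s)) m1 m2) *: mu_star F t0 s w (e s (Xm _ (m1 + m2))).
Proof. by rewrite -mu_starM -embM XmM embZ mu_starZ. Qed.

(** Only the generators are given as pointed. Products are pointed up to a power of v; comparing
    leading coefficients of the two orders of multiplication shows that it is the power in X^m1 *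
    X^m2. *)
Lemma pointed_monomials w s sigma : injective_reachable F t0 w s sigma ->
  forall m, nonneg m -> exists y g,
    e w y = mu_star F t0 s w (e s (Xm _ m)) /\ ptd (SC w) g (y : ST w).
Proof.
move=> ir; apply: lattice_ind.
- exists (Xm _ 0), 0; rewrite !Xm0 !rmorph1 mu_star1; split; first by [].
  exact: (ptd_X (ST w)).
- move=> m1 m2 _ _ [y1 [g1 [E1 p1]]] [y2 [g2 [E2 p2]]].
  pose l1 := lam_form (quasi (seed t0 s)) m1 m2.
  pose z1 : ST w := y1; pose z2 : ST w := y2.
  have Ez : z1 * z2 = vp qlaurent (l1 + l1) *: (z2 * z1).
    apply: (@emb_inj _ _ _ (F (seed t0 w))).
    rewrite -[LHS]/(e w (y1 * y2)) -[RHS]/(e w (vpow (l1 + l1) *: (y2 * y1))).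
    rewrite [RHS]embZ [LHS]embM [X in _ = _ *: X]embM E1 E2.
    rewrite [LHS]mu_star_Xm [X in _ = _ *: X]mu_star_Xm scalerA vpowD.
    by rewrite (quasi_lamC _ m1 m2) -/l1 addrK [m2 + m1]addrC.
  have El : seed_form (seed t0 w) g1 g2 = l1.
    have q1 : ptd (SC w) g1 z1 := p1; have q2 : ptd (SC w) g2 z2 := p2.
    have := domin_lead q1.1 q2.1; rewrite Ez cfZ [g1 + g2]addrC (domin_lead q2.1 q1.1).
    rewrite q1.2 q2.2 !mulr1 vpD => /vp_inj.
    have dbl (u v : int) : v + v - u = u -> u = v by lia.
    by rewrite (lamC _ g1 g2) => /dbl.
  exists (vpow (- l1) *: (y1 * y2)), (g1 + g2); split; last by rewrite -El; exact: ptdM.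
  rewrite [LHS]embZ [X in _ *: X = _]embM E1 E2 mu_star_Xm scalerA vpowD addNr.
  rewrite scale1r.
  reflexivity.
- move=> l; case: (split_ordP l) => j ->.
    have [p [g [Ep /pointedP pg _]]] := ir ((sigma^-1)%g j).
    exists p, g; split; last exact: pg.
    by rewrite [LHS]Ep /inj_var permKV.
  exists (Xm _ (delta_mx (rshift nuf j) 0)), (delta_mx (rshift nuf j) 0).
  split; last exact: (ptd_X (ST w)).
  exact: esym (mu_star_frozen F t0 s w j).
Qed.

Section Assembly.
Variables (w w1 : seq 'I_nuf) (sigma : {perm 'I_nuf}) (k : 'I_nuf).
Variables (A : F (seed t0 w) -> Prop) (L : lattice -> LP (seed t0 w)).
Hypothesis ir : injective_reachable F t0 w w1 sigma.
Hypothesis ir' : injective_reachable F t0 (k :: w) (sigma k :: w1) sigma.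
Hypothesis triL : triangular_basis F t0 w w1 A L.
Hypothesis adm : admissible F t0 w (sigma k :: w1) sigma k L.

Local Notation t := (seed t0 w).
Local Notation t' := (mutate k (seed t0 w)).
Local Notation T := (seed_torus t).
Local Notation T' := (seed_torus t').
Local Notation i := (emb_mor F t).
Local Notation j := (mu_mor F t k).
Local Notation ka := (uf k).
Local Notation bp := (bplus t k).
Local Notation bm := (bminus t k).
Local Notation p := (bm - fvec ka).

Lemma tri_ptd g : ptd (seed_cone t) g (L g : T).
Proof. exact/pointedP/(tri_pointed triL). Qed.

Lemma inA_A (z : T) : inA (L : lattice -> T) z <-> A (e w z).
Proof.
have [A1 AZ AM] := tri_subalg triL; have [LA Lfree Lspan] := tri_basis triL.
split=> [[c] | /Lspan[c /emb_inj E]]; last first.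
  by exists (mcoeff^~ c); have := expand_coords L c; rewrite -E.
move=> /coords_expand[c' [-> _]]; rewrite /expand.
have A0 : A (e w 0).
  by have := AZ (-1) _ _ A1 A1; rewrite scaleN1r addNr rmorph0.
have H (s : seq lattice) : A (e w (\sum_(g <- s) c'@_g *: L g)).
  elim: s => [|g s IH]; first by rewrite big_nil.
  rewrite big_cons (rmorphD (e w)) /= embZ; exact: AZ.
exact: H.
Qed.

Lemma inA_closed (z1 z2 : T) : inA (L : lattice -> T) z1 ->
  inA (L : lattice -> T) z2 -> inA (L : lattice -> T) (z1 * z2).
Proof.
have [_ _ AM] := tri_subalg triL.
move=> /inA_A A1 /inA_A A2; apply/inA_A.
have -> : e w (z1 * z2 : T) = e w (z1 : LP t) * e w (z2 : LP t) by exact: embM.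
exact: AM.
Qed.

Definition nonnegb (m : lattice) := [forall l, 0 <= m l 0].

Lemma nonnegP m : reflect (nonneg m) (nonnegb m).
Proof. exact: forallP. Qed.

Lemma L_one : (L 0 : T) = 1.
Proof.
have m0 l : 0 <= (0 : lattice) l 0 by rewrite mxE.
have [g] := tri_monomials triL m0; rewrite mu_star_id => /emb_inj Eg.
have p0 : ptd (seed_cone t) 0 (L g : T) by rewrite Eg; exact: (ptd_X T).
by rewrite (ptd_uniq p0 (tri_ptd g)) Eg.
Qed.

(** Membership in U_q(t) makes each basis element a Laurent polynomial for t' as well. *)
Lemma corr_lift : exists Lp : lattice -> LP t', forall g,
  corr i j (L g : T) (Lp g : T').
Proof.
have H g : predT g -> exists y, e w (L g) == mu F t k (e (k :: w) y).
  move=> _; have [LA _ _] := tri_basis triL.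
  have [y Ey] := tri_upper triL (LA g) (k :: w).
  by exists y; rewrite Ey /mu_star /= mu_wordK.
have [f fP] := fun_choice (0 : LP t') H.
by exists f => g; apply/eqP/fP.
Qed.

Lemma injective_monomials : exists ga : lattice -> lattice, forall m, nonneg m ->
  e w (L (ga m)) = mu_star F t0 w1 w (e w1 (Xm _ m)).
Proof.
have H m : nonnegb m ->
    exists g, e w (L g) == mu_star F t0 w1 w (e w1 (Xm _ m)).
  by move=> /nonnegP/(tri_monomials1 triL)[g Eg]; exists g; apply/eqP.
have [f fP] := fun_choice (0 : lattice) H.
by exists f => m /nonnegP/fP/eqP.
Qed.

Lemma injective_monomials' : exists IM' : lattice -> LP t', forall m, nonneg m ->
  e (k :: w) (IM' m) = mu_star F t0 (sigma k :: w1) (k :: w) (e (sigma k :: w1) (Xm _ m)) /\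
  exists g, ptd (seed_cone t') g (IM' m : T').
Proof.
have H m : nonnegb m -> exists y, e (k :: w) y ==
    mu_star F t0 (sigma k :: w1) (k :: w) (e (sigma k :: w1) (Xm _ m)).
  by move=> /nonnegP/(pointed_monomials ir')[y [g [Ey _]]]; exists y; apply/eqP.
have [f fP] := fun_choice (0 : LP t') H.
exists f => m m0; have /nonnegP/fP/eqP fm := m0; split; first exact: fm.
have [y [g [Ey pg]]] := pointed_monomials ir' m0.
by exists g; have /emb_inj -> := etrans fm (esym Ey).
Qed.

(** Degrees are additive by [ptd_monomialM], so generators decide: X_(sigma l) has unfrozen degree
    -f_l by injective-reachability, and frozen variables have none. *)
Lemma ga_additive (ga : lattice -> lattice) :
  (forall m, nonneg m -> e w (L (ga m)) = mu_star F t0 w1 w (e w1 (Xm _ m))) ->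
  (forall m1 m2, nonneg m1 -> nonneg m2 -> (L (ga m1) : T) * L (ga m2) =
     vp qlaurent (seed_form (seed t0 w1) m1 m2) *: (L (ga (m1 + m2)) : T)) /\
  forall m, nonneg m -> forall l, ga m (uf l) 0 = - m (uf (sigma l)) 0.
Proof.
move=> gaE.
have M m1 m2 : nonneg m1 -> nonneg m2 -> (L (ga m1) : T) * L (ga m2) =
     vp qlaurent (seed_form (seed t0 w1) m1 m2) *: (L (ga (m1 + m2)) : T).
  move=> h1 h2; apply: (@emb_inj _ _ _ (F t)).
  rewrite -[LHS]/(e w (L (ga m1) * L (ga m2))).
  rewrite -[RHS]/(e w (vpow (lam_form (quasi (seed t0 w1)) m1 m2) *: L (ga (m1 + m2)))).
  rewrite [LHS]embM [RHS]embZ (gaE _ h1) (gaE _ h2) (gaE _ (nonnegD h1 h2)).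
  exact: mu_star_Xm.
split=> //; have H := ptd_monomialM (IM := fun m => L (ga m) : T) (fun m _ => tri_ptd (ga m)) M.
have ga_eq m g : nonneg m -> ptd (seed_cone t) g (L (ga m) : T) -> ga m = g.
  by move=> _ pg; apply: ptd_uniq (tri_ptd _) pg.
apply: lattice_ind => [l | m1 m2 h1 h2 IH1 IH2 l | l' l].
- have := (H 0 0); rewrite addr0 => -[||E _]; [by move=> l'; rewrite mxE..|].
  have -> : ga 0 = 0 by apply: (addrI (ga 0)); rewrite -E addr0.
  by rewrite !mxE oppr0.
- by rewrite (H _ _ h1 h2).1 !mxE IH1 IH2 opprD.
have f0 : nonneg (delta_mx l' 0 : lattice) by have := nonneg_fv l' 1; rewrite mulr1n.
case: (split_ordP l') f0 => a -> f0.
  have [q [g [Eq /pointedP pg ug]]] := ir ((sigma^-1)%g a).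
  have E0 : L (ga (delta_mx (uf a) 0)) = q.
    by apply: (@emb_inj _ _ _ (F t)); rewrite (gaE _ f0) Eq /inj_var permKV.
  rewrite (ga_eq _ g f0); last by rewrite E0.
  have := congr1 (fun v : 'cV[int]_nuf => v l 0) ug; rewrite !mxE => ->.
  by rewrite eq_lshift !andbT -(inj_eq (@perm_inj _ sigma)) permKV.
rewrite (ga_eq _ (delta_mx (rshift nuf a) 0) f0).
  by rewrite !mxE !eq_lrshift.
have -> : L (ga (delta_mx (rshift nuf a) 0)) = Xm _ (delta_mx (rshift nuf a) 0).
  by apply: (@emb_inj _ _ _ (F t)); rewrite (gaE _ f0); exact: mu_star_frozen.
exact: (ptd_X T).
Qed.

Lemma mut_mono_cons (m : lattice) : m (uf (sigma k)) 0 = 0 ->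
  mu_star F t0 (sigma k :: w1) w (e (sigma k :: w1) (Xm _ m)) =
  mu_star F t0 w1 w (e w1 (Xm _ m)).
Proof.
move=> mk; rewrite /mu_star /=; congr (muV_word w (mu_word _)).
exact: (@mu_monomial _ _ F (seed t0 w1) (sigma k) m mk).
Qed.

Lemma mutated_basis : exists L' : lattice -> LP t', [/\ forall g, ptd (seed_cone t') g (L' g : T'),
  forall g, qbar (L' g : T') = L' g,
  forall l g, inM (L' : lattice -> T')
    (vp qlaurent (- seed_form t' (fvec l) g) *: (qX T' (fvec l) * (L' g : T')) - L' (g + fvec l)),
  forall m, nonneg m -> (exists g, e (k :: w) (L' g) = e (k :: w) (Xm t' m)) /\
    exists g, e (k :: w) (L' g) =
      mu_star F t0 (sigma k :: w1) (k :: w) (e (sigma k :: w1) (Xm _ m)) &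
  [/\ forall g, mu F t k (e (k :: w) (L' (phi ka bp p g))) = e w (L g),
     forall g, exists g', mu F t k (e (k :: w) (L' g)) = e w (L g') &
     forall z y c, mu F t k (e (k :: w) y) = e w z -> coords (L : lattice -> T) z c ->
       exists c', coords (L' : lattice -> T') y c']].
Proof.
have [ga gaE] := injective_monomials; have [IM' IM'P] := injective_monomials'.
have [Lp Lp_rel] := corr_lift; have [M gaU] := ga_additive gaE.
have [d d0 wb] := lam_col t k.
pose ufp := [pred l : 'I_(nuf + nf) | (l < nuf)%N].
have ufpE l : ufp l -> exists a, l = uf a.
  by move=> /= ln; exists (Ordinal ln); apply: val_inj.
have uf_ka : ufp ka by exact: (ltn_ord k).
have uf_uf a : ufp (uf a) by exact: (ltn_ord a).
have i_inj : injective i by move=> y1 y2; exact: emb_inj.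
have j_inj : injective j by move=> y1 y2 /mu_inj/emb_inj.
have bp_ka : bp ka 0 = 0 by rewrite mxE exB_kk /pos maxxx.
have bm_ka : bm ka 0 = 0 by rewrite mxE exB_kk oppr0 /pos maxxx.
have kap_ka : ufsum nf (predC1 k) ka 0 = 0 by rewrite ufsumE /= eqxx.
have kap_uf l : 0 <= ufsum nf (predC1 k) (uf l) 0 by rewrite ufsumE; case: (predC1 k l).
have kapC (x : lattice) : cone (seed_cone t) x -> seed_form t (ufsum nf (predC1 k)) x <= 0.
  by move=> xC; apply: seed_coneW.
have kapC' (x : lattice) : cone (seed_cone t') x -> seed_form t' (ufsum nf (predC1 k)) x <= 0.
  by move=> xC; apply: seed_coneW.
have kapC0 (x : lattice) : cone (seed_cone t) x ->
    seed_form t (ufsum nf (predC1 k)) x = 0 -> exists n, x = col k (exB t) *+ n.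
  by move=> xC x0; exact: seed_kap_C0 xC x0.
have cW (x a : lattice) : cone (seed_cone t) x -> (forall l, ufp l -> 0 <= a l 0) ->
    seed_form t a x <= 0.
  by move=> xC a0; apply: seed_coneW xC _ => l; exact: a0.
have cW' (x a : lattice) : cone (seed_cone t') x -> (forall l, ufp l -> 0 <= a l 0) ->
    seed_form t' a x <= 0.
  by move=> xC a0; apply: seed_coneW xC _ => l; exact: a0.
have barL g : qbar (L g : T) = L g := tri_bar triL g.
have LX l g : inM (L : lattice -> T) (vp qlaurent (- seed_form t (fvec l) g) *:
     (qX T (fvec l) * (L g : T)) - L (g + fvec l)).
  apply/triangular_inM; first exact: (tri_pointed triL).
  exact: (tri_triangular triL).
have ga_le m l : nonneg m -> ufp l -> ga m l 0 <= 0.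
  by move=> m0 /ufpE[a ->]; rewrite gaU // oppr_le0.
have ga_ka m : nonneg m -> m (uf (sigma k)) 0 = 0 -> ga m ka 0 = 0.
  by move=> m0 mk; rewrite gaU // mk oppr0.
have ga_k1 : ga (fvec (uf (sigma k))) ka 0 = -1.
  rewrite gaU; first by rewrite mxE !eqxx.
  by have := nonneg_fv (uf (sigma k)) 1; rewrite mulr1n.
have gsub (S : pred 'I_nuf) (g : lattice) : exists m : lattice, [/\ nonneg m,
    forall l, S l -> 0 <= (g - ga m) (uf l) 0 & forall l, ~~ S l -> m (uf (sigma l)) 0 = 0].
  (* As [ga m] has coordinate - m_(sigma l) at l, the exponent [-g_l]_+ at sigma l raises g_l to at
     least 0 for [l] in [S]. *)
  pose m : lattice := \col_l (if split l is inl a then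
    if S ((sigma^-1)%g a) then pos (- g (uf ((sigma^-1)%g a)) 0) else 0 else 0).
  have mE l : m (uf (sigma l)) 0 = if S l then pos (- g (uf l) 0) else 0.
    by rewrite mxE (unsplitK (inl _)) permK.
  have m0 : nonneg m.
    by move=> l; rewrite mxE; case: (split l) => // a; case: ifP => // _; exact: pos_ge0.
  exists m; split=> // l Sl; last by rewrite mE (negPf Sl).
  by rewrite mxE [(- _ : lattice) _ _]mxE gaU // mE Sl /pos; move: (g (uf l) 0) => u; lia.
have ga_sub g : exists2 m, nonneg m & forall l, ufp l -> 0 <= (g - ga m) l 0.
  have [m [m0 mg _]] := gsub predT g; exists m => // l /ufpE[a ->]; exact: mg.
have ga_sub_ka g : exists m : lattice, [/\ nonneg m, m (uf (sigma k)) 0 = 0 &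
    forall l, ufp l -> l != ka -> 0 <= (g - ga m) l 0].
  have [m [m0 mg mk]] := gsub (predC1 k) g; exists m; split=> //.
    by apply: mk; rewrite /= eqxx.
  by move=> l /ufpE[a ->] ak; apply: mg; apply: contraNneq ak => ->.
have bp0 : nonneg bp by move=> l; rewrite mxE pos_ge0.
have bm0 : nonneg bm by move=> l; rewrite mxE pos_ge0.
have powX s (l : 'I_(nuf + nf)) n : e s (Xm _ (fvec l)) ^+ n = e s (Xm _ (fvec l *+ n)).
  elim: n => [|n IH]; first by rewrite expr0 mulr0n Xm0 rmorph1.
  have l0 : lam_form (quasi (seed t0 s)) (fvec l) (fvec l *+ n) = 0.
    by rewrite -[LHS]/(seed_form _ _ _) lamMnr lamaa mul0rn.
  rewrite exprS IH -embM XmM l0 scale1r mulrS.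
  reflexivity.
have admX (n : nat) : exists g, corr i j (L g : T) (qX T' (fvec ka *+ n)).
  have [[g Eg] _] := adm n; exists g; rewrite /corr /= Eg.
  congr (mu F t k _); exact: (powX (k :: w)).
have IM'_rel m : nonneg m -> m (uf (sigma k)) 0 = 0 -> corr i j (L (ga m) : T) (IM' m : T').
  move=> m0 mk; rewrite /corr /= gaE // (IM'P m m0).1 mu_star_cons.
  by rewrite mut_mono_cons.
have IM'_pt m : nonneg m -> m (uf (sigma k)) 0 = 0 ->
    exists g, ptd (seed_cone t') g (IM' m : T').
  by move=> m0 _; exact: (IM'P m m0).2.
have IM'_M m1 m2 : nonneg m1 -> nonneg m2 -> (IM' m1 : T') * IM' m2 =
    vp qlaurent (seed_form (seed t0 (sigma k :: w1)) m1 m2) *: (IM' (m1 + m2) : T').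
  move=> h1 h2; apply: (@emb_inj _ _ _ (F t')).
  rewrite -[LHS]/(e (k :: w) (IM' m1 * IM' m2)).
  rewrite -[RHS]/(e (k :: w) (vpow (lam_form (quasi (seed t0 (sigma k :: w1))) m1 m2) *: IM' (m1 + m2))).
  rewrite [LHS](@embM (k :: w)) [RHS](@embZ (k :: w)).
  rewrite (IM'P _ h1).1 (IM'P _ h2).1 (IM'P _ (nonnegD h1 h2)).1.
  exact: (mu_star_Xm (sigma k :: w1) (k :: w) m1 m2).
have admI (n : nat) : exists g, corr i j (L g : T) (IM' (fvec (uf (sigma k)) *+ n) : T').
  have [_ [g Eg]] := adm n; exists g; rewrite /corr /= Eg.
  rewrite (IM'P _ (nonneg_fv _ n)).1 /inj_var -mu_starX (powX (sigma k :: w1)).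
  reflexivity.
have cb : cone (seed_cone t) (col k (exB t)) := col_cone t k.
have cb' : cone (seed_cone t') (- col k (exB t)) := mut_col t k.
have pEr : p = bm - (delta_mx ka 0 : lattice) by [].
have MT := mutated_triangular i_inj j_inj (@frac_dom _ _ F t)
  (bplusB t k) pEr bp_ka bm_ka d0 wb (mut_psi t k) cb cb'
  (@mu_monomial _ _ F t k) (mu_exchange F t k) kap_ka kapC kapC0 kapC' uf_ka cW cW'
  tri_ptd barL L_one inA_closed LX Lp_rel (IM := fun m => L (ga m) : T)
  (fun m _ => erefl) M ga_le ga_ka ga_k1 ga_sub ga_sub_ka bp0 bm0 admX IM'_rel IM'_pt
  IM'_M admI.
have [L'pt L'bar L'X monoX monoI] := MT.
have LmK g : Lm (T' := T') ka bp p Lp (phi ka bp p g) = Lp g.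
  by rewrite /Lm (phiK pEr bp_ka bm_ka).
have back g (y : LP t') : corr i j (L g : T) (y : T') ->
    e (k :: w) (Lm (T' := T') ka bp p Lp (phi ka bp p g)) = e (k :: w) y.
  by move=> r; rewrite LmK; apply: mu_inj; rewrite -[LHS](Lp_rel g) -[RHS]r.
exists (Lm (T' := T') ka bp p Lp); split; [exact: L'pt | exact: L'bar | exact: L'X | |].
  move=> m m0; split.
    by have [g /back rg] := monoX m m0; exists (phi ka bp p g).
  have [g /back rg] := monoI m m0; exists (phi ka bp p g).
  by rewrite rg (IM'P m m0).1.
split.
- by move=> g; rewrite LmK; exact: esym (Lp_rel g).
- by move=> g; exists (phiV ka bp p g); exact: esym (Lp_rel _).
move=> z y c r cz; eexists.
exact: (coords_rel j_inj pEr bp_ka bm_ka Lp_rel cz (esym r)).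
Qed.

Lemma tropical_phi g : tropical t k g = phi ka bp p g.
Proof.
apply/colP => l; rewrite mxE /phi /psi; have [-> | lk] := eqVneq l ka.
  case: ifP => _; rewrite !mxE exB_kk ?oppr0 /pos maxxx !eqxx /=; ring.
by case: ifP => _; rewrite !mxE (negPf lk) /=; ring.
Qed.

Lemma mutated_triangular_basis : exists L' : lattice -> LP (seed t0 (k :: w)),
  [/\ forall z, contains F t0 (k :: w) L' z <-> contains F t0 w L (mu F t k z),
      triangular_basis F t0 (k :: w) (sigma k :: w1) (fun z => A (mu F t k z)) L'
    & compatible F t0 w k L L'].
Proof.
have [L' [pt' bar' X' mono [comp back coordsL]]] := mutated_basis.
have [A1 AZ AM] := tri_subalg triL; have [LA Lfree Lspan] := tri_basis triL.
exists L'; split.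
- move=> z; split=> [[g <-] | [g Eg]].
    by have [g' Eg'] := back g; exists g'; exact: esym Eg'.
  exists (phi ka bp p g); apply: (@mu_inj _ _ F t k); exact: (etrans (comp g) Eg).
- split.
  + split; first by rewrite rmorph1.
      move=> c x y Ax Ay; rewrite rmorphD /= linearZZ; exact: AZ.
    by move=> x y Ax Ay; rewrite rmorphM; exact: AM.
  + move=> z /(tri_upper triL) up s; have [q Eq] := up s; exists q.
    by apply: (@mu_inj _ _ F t k); rewrite mu_star_cons.
  + split.
    * by move=> g; have [g' Eg'] := back g; have := LA g'; rewrite -Eg'.
    * move=> c Ec; have := expand_coords L' c; rewrite Ec => /(coord_eq0 pt') c0.
      by apply/malgP => h; rewrite mcoeff0; exact: c0.
    move=> z Az; have [q Eq] := tri_upper triL Az (k :: w).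
    have Ez : z = e (k :: w) q.
      by apply: (@mu_inj _ _ F t k); rewrite Eq /mu_star /= mu_wordK.
    have [c Ec] := Lspan _ Az.
    have [c' cq] : exists c', coords (L' : lattice -> T') (q : T') c'.
      by apply: (coordsL _ _ _ _ (expand_coords L c)); rewrite -Ez Ec.
    have [c1 [Eq1 _]] := coords_expand cq.
    exists c1; exact: (etrans Ez (congr1 (e (k :: w)) Eq1)).
  + exact: bar'.
  + move=> m m0; have [[g Eg] _] := mono m m0; exists g.
    by rewrite mu_star_id; exact: Eg.
  + by move=> m m0; have [_ [g Eg]] := mono m m0; exists g; exact: Eg.
  + by move=> g; apply/pointedP/pt'.
  move=> l g; apply/triangular_inM; last exact: X'.
  by move=> h; apply/pointedP/pt'.
move=> g; apply: (@mu_inj _ _ F t k); rewrite muVK tropical_phi; exact: esym (comp g).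
Qed.
End Assembly.
End SeedMutation.

Theorem proposition6p4p3 (nuf nf : nat) (F : cluster_fields nuf nf)
    (t0 : qseed nuf nf) (w w1 : seq 'I_nuf) (sigma : {perm 'I_nuf})
    (k : 'I_nuf) (A : F (seed t0 w) -> Prop)
    (L : 'cV[int]_(nuf + nf) -> LP (seed t0 w)) :
  injective_reachable F t0 w w1 sigma ->
  injective_reachable F t0 (k :: w) (sigma k :: w1) sigma ->
  triangular_basis F t0 w w1 A L ->
  admissible F t0 w (sigma k :: w1) sigma k L ->
  exists L' : 'cV[int]_(nuf + nf) -> LP (seed t0 (k :: w)),
    [/\ forall z : F (seed t0 (k :: w)),
          contains F t0 (k :: w) L' z <-> contains F t0 w L (mu F (seed t0 w) k z),
        triangular_basis F t0 (k :: w) (sigma k :: w1)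
          (fun z : F (seed t0 (k :: w)) => A (mu F (seed t0 w) k z)) L'
      & compatible F t0 w k L L'].
Proof. by move=> ir ir' triL adm; exact: mutated_triangular_basis ir ir' triL adm. Qed.
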